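(* Let $\Bbbk$ be a field and $\mathcal C$ a $\Bbbk$-linear monoidal category. Assigning to a simple transitive (Cauchy complete) $\mathcal C$-module category $\mathbf M$ with cyclic generator $X$ the monoid $[X,X]$ induces a bijection $$\{\text{simple transitive }\mathcal C\text{-module categories}\}/\simeq\;\longleftrightarrow\;\{\text{simple monoids in }\mathcal C\text{-Tamb}(\mathcal C,\mathcal C)\}/\sim_{\mathrm{Morita}},$$ where the left side is taken up to equivalence of $\mathcal C$-module categories.
   Context: All categories, functors, etc. are $\Bbbk$-linear; $FG$ abbreviates $F\otimes G$ in $\mathcal C$. A $\mathcal C$-module category is a category $\mathbf M$ with a strong monoidal functor $\mathcal C\to\mathrm{End}(\mathbf M)$, $F\mapsto\mathbf MF$, with coherence isomorphisms $\mathbf m_{G,F}:\mathbf MG\,\mathbf MF\Rightarrow\mathbf M(GF)$, $\mathbf m_{\mathbb 1}:\mathrm{Id}\Rightarrow\mathbf M\mathbb 1$; module functors commute with the actions up to coherent natural isomorphism. An ideal of $\mathbf M$ is a two-sided ideal $\mathbf I$ of the category $\mathbf M$ with $\mathbf MF(\mathbf I)\subseteq\mathbf I$ for all $F\in\mathcal C$. $\mathbf M$ is simple transitive if its only ideals are $0$ and $\mathbf M$; then every non-zero object is a cyclic generator. Cauchy complete means additive and idempotent split; a Cauchy complete $\mathbf M$ is cyclic with cyclic generator $X$ if every object is a direct summand of a finite direct sum of objects $\mathbf MF\,X$. $\mathcal C\text{-Tamb}(\mathcal C,\mathcal C)$ is the category of Tambara modules: functors $\mathtt\Phi:\mathcal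 C^{\mathrm{op}}\otimes_\Bbbk\mathcal C\to\mathbf{Vec}_\Bbbk$ with linear maps $\mathsf t_{H;F,G}:\mathtt\Phi(F,G)\to\mathtt\Phi(HF,HG)$, natural in $F,G$, extranatural in $H$, compatible with associators and unitors; morphisms are natural transformations commuting with the $\mathsf t$'s. It is monoidal under $(\mathtt\Psi\diamond\mathtt\Phi)(F,G)=\int^{H}\mathtt\Psi(F,H)\otimes\mathtt\Phi(H,G)$ with unit $\mathcal C(-,-)$, and has reflexive coequalizers preserved by $\diamond$, so relative tensor products exist. The monoid $[X,X]$ is $(F,G)\mapsto\mathrm{Hom}_{\mathbf M}(\mathbf MFX,\mathbf MGX)$ with $\mathsf t_H(f)=(\mathbf m_{H,G})_X\circ\mathbf MH(f)\circ(\mathbf m_{H,F})_X^{-1}$, unit $f\mapsto(\mathbf Mf)_X$, multiplication $b\otimes c\mapsto c\circ b$. A monoid $A$ is simple if its only subobjects in the category of $A$-$A$-bimodules are $A$ and $0$. Monoids $A,B$ are Morita equivalent if there are bimodules ${}_AM_B$, ${}_BN_A$ with $M\otimes_BN\cong A$ and $N\otimes_AM\cong B$ as bimodules. *)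

(* Defs.v *)
From HB Require Import structures.
From Stdlib Require Import RelationClasses.
From mathcomp Require Import all_boot all_algebra.
From mathcomp Require Import boolp.

Set Implicit Arguments.
Unset Strict Implicit.
Unset Printing Implicit Defensive.

Import GRing.Theory.
Local Open Scope ring_scope.
Local Open Scope quotient_scope.

Declare Scope kcat_scope.
Delimit Scope kcat_scope with kcat.
Local Open Scope kcat_scope.

Reserved Notation "g ∘ f" (at level 40, left associativity).
Reserved Notation "F ⊗ G" (at level 38, left associativity).
Reserved Notation "f ⊠ g" (at level 38, left associativity).
Reserved Notation "P ◇ Q" (at level 38, left associativity).

(** Categories are small: the coends below range over all objects. *)

Record kcat (k : fieldType) := KCat {
  ob :> Type;
  hom : ob -> ob -> lmodType k;
  idm : forall X, hom X X;
  kcomp : forall X Y Z, hom Y Z -> hom X Y -> hom X Z;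
  comp1m : forall X Y (f : hom X Y), kcomp (idm Y) f = f;
  compm1 : forall X Y (f : hom X Y), kcomp f (idm X) = f;
  compA : forall X Y Z W (h : hom Z W) (g : hom Y Z) (f : hom X Y),
    kcomp h (kcomp g f) = kcomp (kcomp h g) f;
  comp_linl : forall X Y Z (f : hom X Y), linear (fun g : hom Y Z => kcomp g f);
  comp_linr : forall X Y Z (g : hom Y Z), linear (fun f : hom X Y => kcomp g f)
}.

Arguments idm {k _} X.
Notation "g ∘ f" := (kcomp g f) : kcat_scope.

Definition mutually_inverse k (C : kcat k) (X Y : C) (f : hom X Y) (g : hom Y X)
  : Prop := g ∘ f = idm X /\ f ∘ g = idm Y.

Definition is_iso k (C : kcat k) (X Y : C) (f : hom X Y) : Prop :=
  exists g, mutually_inverse f g.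

Record kfunctor k (C D : kcat k) := KFunctor {
  fob :> C -> D;
  fmor : forall X Y, hom X Y -> hom (fob X) (fob Y);
  fmor1 : forall X, fmor (idm X) = idm (fob X);
  fmorM : forall X Y Z (g : hom Y Z) (f : hom X Y), fmor (g ∘ f) = fmor g ∘ fmor f;
  fmor_lin : forall X Y, linear (@fmor X Y)
}.

Definition is_equivalence k (C D : kcat k) (F : kfunctor C D) : Prop :=
  exists (G : kfunctor D C) (eta : forall X, hom X (G (F X)))
         (eps : forall Y, hom (F (G Y)) Y),
  [/\ forall X, is_iso (eta X), forall Y, is_iso (eps Y),
      forall X X' (f : hom X X'), eta X' ∘ f = fmor G (fmor F f) ∘ eta X
    & forall Y Y' (g : hom Y Y'), eps Y' ∘ fmor F (fmor G g) = g ∘ eps Y].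

Record kmoncat (k : fieldType) := KMonCat {
  mcat :> kcat k;
  tens : mcat -> mcat -> mcat;
  tensm : forall F F' G G' : mcat,
    hom F F' -> hom G G' -> hom (tens F G) (tens F' G');
  munit : mcat;
  tensm1 : forall F G : mcat, tensm (idm F) (idm G) = idm (tens F G);
  tensmM : forall (F F' F'' G G' G'' : mcat) (f' : hom F' F'') (f : hom F F')
    (g' : hom G' G'') (g : hom G G'),
    tensm (f' ∘ f) (g' ∘ g) = tensm f' g' ∘ tensm f g;
  tensm_linl : forall (F F' G G' : mcat) (g : hom G G'),
    linear (fun f : hom F F' => tensm f g);
  tensm_linr : forall (F F' G G' : mcat) (f : hom F F'),
    linear (fun g : hom G G' => tensm f g);
  assoc : forall F G H : mcat, hom (tens (tens F G) H) (tens F (tens G H));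
  assoc' : forall F G H : mcat, hom (tens F (tens G H)) (tens (tens F G) H);
  assocK : forall F G H, mutually_inverse (assoc F G H) (assoc' F G H);
  assoc_nat : forall (F F' G G' H H' : mcat)
    (f : hom F F') (g : hom G G') (h : hom H H'),
    assoc F' G' H' ∘ tensm (tensm f g) h = tensm f (tensm g h) ∘ assoc F G H;
  lunit : forall F : mcat, hom (tens munit F) F;
  lunit' : forall F : mcat, hom F (tens munit F);
  lunitK : forall F, mutually_inverse (lunit F) (lunit' F);
  lunit_nat : forall (F F' : mcat) (f : hom F F'),
    lunit F' ∘ tensm (idm munit) f = f ∘ lunit F;
  runit : forall F : mcat, hom (tens F munit) F;
  runit' : forall F : mcat, hom F (tens F munit);
  runitK : forall F, mutually_inverse (runit F) (runit' F);
  runit_nat : forall (F F' : mcat) (f : hom F F'),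
    runit F' ∘ tensm f (idm munit) = f ∘ runit F;
  pentagon : forall F G H K : mcat,
    tensm (idm F) (assoc G H K) ∘ assoc F (tens G H) K ∘ tensm (assoc F G H) (idm K)
    = assoc F G (tens H K) ∘ assoc (tens F G) H K;
  triangle : forall F G : mcat,
    tensm (idm F) (lunit G) ∘ assoc F munit G = tensm (runit F) (idm G)
}.

Arguments munit {k} _.
Notation "F ⊗ G" := (tens F G) : kcat_scope.
Notation "f ⊠ g" := (tensm f g) : kcat_scope.

(** The strong monoidal functor [C -> End(M)] is written out on components: [mact F] is
  the endofunctor MF, [mact2 f X] is the component at X of the natural
  transformation Mf, and [mmu G F], [meta] are the coherence isomorphisms
  m_{G,F} : MG MF => M(GF) and m_1 : Id => M1. *)

Record modcat k (C : kmoncat k) := ModCat {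
  mdcat :> kcat k;
  mact : C -> kfunctor mdcat mdcat;
  mact2 : forall F G : C, hom F G -> forall X : mdcat, hom (mact F X) (mact G X);
  mact2_nat : forall (F G : C) (f : hom F G) (X Y : mdcat) (x : hom X Y),
    mact2 f Y ∘ fmor (mact F) x = fmor (mact G) x ∘ mact2 f X;
  mact2_1 : forall (F : C) (X : mdcat), mact2 (idm F) X = idm (mact F X);
  mact2_M : forall (F G H : C) (g : hom G H) (f : hom F G) (X : mdcat),
    mact2 (g ∘ f) X = mact2 g X ∘ mact2 f X;
  mact2_lin : forall (F G : C) (X : mdcat),
    linear (fun f : hom F G => mact2 f X);
  mmu : forall (G F : C) (X : mdcat), hom (mact G (mact F X)) (mact (G ⊗ F) X);
  mmu' : forall (G F : C) (X : mdcat), hom (mact (G ⊗ F) X) (mact G (mact F X));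
  mmuK : forall G F X, mutually_inverse (mmu G F X) (mmu' G F X);
  mmu_nat : forall (G F : C) (X Y : mdcat) (x : hom X Y),
    mmu G F Y ∘ fmor (mact G) (fmor (mact F) x)
    = fmor (mact (G ⊗ F)) x ∘ mmu G F X;
  mmu_nat2 : forall (G G' F F' : C) (g : hom G G') (f : hom F F') (X : mdcat),
    mmu G' F' X ∘ (fmor (mact G') (mact2 f X) ∘ mact2 g (mact F X))
    = mact2 (g ⊠ f) X ∘ mmu G F X;
  meta : forall X : mdcat, hom X (mact (munit C) X);
  meta' : forall X : mdcat, hom (mact (munit C) X) X;
  metaK : forall X, mutually_inverse (meta X) (meta' X);
  meta_nat : forall (X Y : mdcat) (x : hom X Y),
    meta Y ∘ x = fmor (mact (munit C)) x ∘ meta X;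
  mmuA : forall (H G F : C) (X : mdcat),
    mact2 (assoc H G F) X ∘ (mmu (H ⊗ G) F X ∘ mmu H G (mact F X))
    = mmu H (G ⊗ F) X ∘ fmor (mact H) (mmu G F X);
  mmu1l : forall (F : C) (X : mdcat),
    mact2 (lunit F) X ∘ (mmu (munit C) F X ∘ meta (mact F X)) = idm (mact F X);
  mmu1r : forall (F : C) (X : mdcat),
    mact2 (runit F) X ∘ (mmu F (munit C) X ∘ fmor (mact F) (meta X)) = idm (mact F X)
}.

Record modfunctor k (C : kmoncat k) (M N : modcat C) := ModFunctor {
  mffun :> kfunctor M N;
  mfs : forall (F : C) (X : M), hom (mact N F (mffun X)) (mffun (mact M F X));
  mfs_iso : forall (F : C) (X : M), is_iso (mfs F X);
  mfs_nat : forall (F : C) (X Y : M) (x : hom X Y),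
    mfs F Y ∘ fmor (mact N F) (fmor mffun x)
    = fmor mffun (fmor (mact M F) x) ∘ mfs F X;
  mfs_nat2 : forall (F G : C) (f : hom F G) (X : M),
    mfs G X ∘ mact2 f (mffun X) = fmor mffun (mact2 f X) ∘ mfs F X;
  mfs_mu : forall (G F : C) (X : M),
    mfs (G ⊗ F) X ∘ mmu G F (mffun X)
    = fmor mffun (mmu G F X) ∘ (mfs G (mact M F X) ∘ fmor (mact N G) (mfs F X));
  mfs_eta : forall X : M, mfs (munit C) X ∘ meta (mffun X) = fmor mffun (meta X)
}.

Definition modcat_equiv k (C : kmoncat k) (M N : modcat C) : Prop :=
  exists Phi : modfunctor M N, is_equivalence Phi.

Record is_ideal k (C : kmoncat k) (M : modcat C)
    (I : forall X Y : M, hom X Y -> Prop) : Prop := IsIdeal {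
  ideal0 : forall X Y : M, I X Y 0;
  ideal_lin : forall (X Y : M) a (f g : hom X Y),
    I X Y f -> I X Y g -> I X Y (a *: f + g);
  ideal_comp : forall (X Y Z W : M) (h : hom Z W) (g : hom Y Z) (f : hom X Y),
    I Y Z g -> I X W (h ∘ g ∘ f);
  ideal_act : forall (F : C) (X Y : M) (f : hom X Y),
    I X Y f -> I (mact M F X) (mact M F Y) (fmor (mact M F) f)
}.

(** As for [simple_monoid] below, the zero case is not excluded. *)
Definition simple_transitive k (C : kmoncat k) (M : modcat C) : Prop :=
  forall I : (forall X Y : M, hom X Y -> Prop), is_ideal I ->
    (forall X Y (f : hom X Y), I X Y f <-> f = 0) \/ (forall X Y (f : hom X Y), I X Y f).

Definition is_zero_object k (M : kcat k) (Z : M) : Prop :=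
  forall X : M, (forall f : hom X Z, f = 0) /\ (forall f : hom Z X, f = 0).

Definition is_direct_sum k (M : kcat k) n (Xs : 'I_n -> M) (P : M) : Prop :=
  exists (inj : forall i, hom (Xs i) P) (prj : forall i, hom P (Xs i)),
  [/\ forall i, prj i ∘ inj i = idm (Xs i),
      forall i j, i != j -> prj j ∘ inj i = 0
    & \sum_(i < n) inj i ∘ prj i = idm P].

Definition pairf T (X Y : T) : 'I_2 -> T := fun i => if i == ord0 then X else Y.

Record cauchy_complete k (M : kcat k) : Prop := CauchyComplete {
  cc_zero : exists Z : M, is_zero_object Z;
  cc_sum : forall X Y : M, exists P, is_direct_sum (pairf X Y) P;
  cc_split : forall (X : M) (e : hom X X), e ∘ e = e ->
    exists (Y : M) (r : hom X Y) (s : hom Y X), r ∘ s = idm Y /\ s ∘ r = e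
}.

Definition cyclic_generator k (C : kmoncat k) (M : modcat C) (X : M) : Prop :=
  forall Y : M, exists n (Fs : 'I_n -> C) (P Q : M),
    is_direct_sum (fun i => mact M (Fs i) X) P /\ is_direct_sum (pairf Y Q) P.

Record stmodcat k (C : kmoncat k) := StModCat {
  stm :> modcat C;
  stm_cauchy : cauchy_complete stm;
  stm_simple : simple_transitive stm
}.

(** A k-linear functor C^op ⊗_k C -> Vec, given on elementary tensors f ⊗ g. *)

Record prof k (C : kcat k) := Prof {
  pob :> C -> C -> lmodType k;
  pmap : forall F F' G G' : C, hom F' F -> hom G G' -> pob F G -> pob F' G';
  pmap_lin : forall F F' G G' (f : hom F' F) (g : hom G G'), linear (pmap f g);
  pmap_linl : forall F F' G G' (g : hom G G') (x : pob F G),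
    linear (fun f : hom F' F => pmap f g x);
  pmap_linr : forall F F' G G' (f : hom F' F) (x : pob F G),
    linear (fun g : hom G G' => pmap f g x);
  pmap1 : forall F G (x : pob F G), pmap (idm F) (idm G) x = x;
  pmapM : forall F F' F'' G G' G'' (f' : hom F'' F') (f : hom F' F)
    (g' : hom G' G'') (g : hom G G') (x : pob F G),
    pmap (f ∘ f') (g' ∘ g) x = pmap f' g' (pmap f g x)
}.

Arguments pmap_lin {k C} p {F F' G G'} f g.
Arguments pmap1 {k C} p {F G} x.
Arguments pmapM {k C} p {F F' F'' G G' G''} f' f g' g x.

Record tamb k (C : kmoncat k) := Tamb {
  tprof :> prof C;
  tstr : forall H F G : C, tprof F G -> tprof (H ⊗ F) (H ⊗ G);
  tstr_lin : forall H F G, linear (@tstr H F G);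
  tstr_nat : forall (H F F' G G' : C) (f : hom F' F) (g : hom G G') (x : tprof F G),
    tstr H (pmap f g x) = pmap (idm H ⊠ f) (idm H ⊠ g) (tstr H x);
  tstr_extra : forall (H H' F G : C) (h : hom H H') (x : tprof F G),
    pmap (idm (H ⊗ F)) (h ⊠ idm G) (tstr H x)
    = pmap (h ⊠ idm F) (idm (H' ⊗ G)) (tstr H' x);
  tstr_assoc : forall (H K F G : C) (x : tprof F G),
    tstr (H ⊗ K) x = pmap (assoc H K F) (assoc' H K G) (tstr H (tstr K x));
  tstr_unit : forall (F G : C) (x : tprof F G),
    tstr (munit C) x = pmap (lunit F) (lunit' G) x
}.

Arguments tstr {k C} t H {F G} _.

Record tmor k (C : kmoncat k) (P Q : tamb C) := TMor {
  tfun :> forall F G : C, P F G -> Q F G;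
  tfun_lin : forall F G, linear (@tfun F G);
  tfun_nat : forall (F F' G G' : C) (f : hom F' F) (g : hom G G') (x : P F G),
    tfun (pmap f g x) = pmap f g (tfun x);
  tfun_tt : forall (H F G : C) (x : P F G), tfun (tstr P H x) = tstr Q H (tfun x)
}.

Lemma tmor_eq k (C : kmoncat k) (P Q : tamb C) (u v : tmor P Q) :
  (forall F G (x : P F G), u _ _ x = v _ _ x) -> u = v.
Proof.
case: u v => [u ul un ut] [v vl vn vt] /= uv.
have {uv} e : u = v by do 3 apply: functional_extensionality_dep => ?; exact: uv.
by subst v; congr TMor; exact: Prop_irrelevance.
Qed.

Definition tid k (C : kmoncat k) (P : tamb C) : tmor P P.
Proof. by exists (fun _ _ x => x). Defined.

Definition tcomp k (C : kmoncat k) (P Q R : tamb C) (v : tmor Q R) (u : tmor P Q) :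
  tmor P R.
Proof.
exists (fun F G x => v F G (u F G x)).
- by move=> F G a x y; rewrite !tfun_lin.
- by move=> *; rewrite !tfun_nat.
- by move=> *; rewrite !tfun_tt.
Defined.

Lemma tcompE k (C : kmoncat k) (P Q R : tamb C) (v : tmor Q R) (u : tmor P Q)
    (F G : C) (x : P F G) : tcomp v u F G x = v F G (u F G x).
Proof. by []. Qed.

Notation "v ∘t u" := (tcomp v u) (at level 40, left associativity) : kcat_scope.

Lemma linear_0 (k : fieldType) (U V : lmodType k) (f : U -> V) : linear f -> f 0 = 0.
Proof.
move=> fl; have := fl 1 0 0; rewrite scaler0 add0r scale1r => /eqP.
by rewrite -subr_eq0 opprD addrA subrr add0r oppr_eq0 => /eqP.
Qed.

Lemma linear_D (k : fieldType) (U V : lmodType k) (f : U -> V) : linear f ->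
  forall u v, f (u + v) = f u + f v.
Proof. by move=> fl u v; have := fl 1 u v; rewrite !scale1r. Qed.

Lemma linear_Z (k : fieldType) (U V : lmodType k) (f : U -> V) : linear f ->
  forall a u, f (a *: u) = a *: f u.
Proof. by move=> fl a u; have := fl a u 0; rewrite (linear_0 fl) !addr0. Qed.

(** The coend ∫^H P(F,H) ⊗ Q(H,G): formal sums of elementary tensors p ⊗ q,
  with p in P(F,H) and q in Q(H,G),
  modulo the congruence generated by bilinearity and dinaturality in H. Scalars
  act on the left factor, so no coefficients are needed. *)

Section Coend.
Variables (k : fieldType) (C : kcat k) (P Q : prof C) (F G : C).

Definition cterm : Type := {H : C & (P F H * Q H G)%type}.
Definition cgen (H : C) (p : P F H) (q : Q H G) : cterm := existT _ H (p, q).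

Inductive crel : seq cterm -> seq cterm -> Prop :=
| crel_refl x : crel x x
| crel_sym x y : crel x y -> crel y x
| crel_trans y x z : crel x y -> crel y z -> crel x z
| crel_cat x x' y y' : crel x x' -> crel y y' -> crel (x ++ y) (x' ++ y')
| crel_catC x y : crel (x ++ y) (y ++ x)
| crel_0 H (q : Q H G) : crel [:: cgen 0 q] [::]
| crel_Dl H (p p' : P F H) (q : Q H G) :
    crel [:: cgen (p + p') q] [:: cgen p q; cgen p' q]
| crel_Dr H (p : P F H) (q q' : Q H G) :
    crel [:: cgen p (q + q')] [:: cgen p q; cgen p q']
| crel_Z H a (p : P F H) (q : Q H G) :
    crel [:: cgen (a *: p) q] [:: cgen p (a *: q)]
| crel_dinat H H' (h : hom H H') (p : P F H) (q : Q H' G) :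
    crel [:: cgen (pmap (idm F) h p) q] [:: cgen p (pmap h (idm G) q)].

Definition cform : Type := seq cterm.
HB.instance Definition _ := gen_eqMixin cform.
HB.instance Definition _ := gen_choiceMixin cform.

Definition crelb (x y : cform) : bool := `[< crel x y >].

Fact crelb_refl : reflexive crelb.
Proof. by move=> x; apply/asboolP; exact: crel_refl. Qed.
Fact crelb_sym : symmetric crelb.
Proof. by move=> x y; apply/asboolP/asboolP; exact: crel_sym. Qed.
Fact crelb_trans : transitive crelb.
Proof. by move=> y x z /asboolP xy /asboolP yz; apply/asboolP; exact: crel_trans yz. Qed.

Canonical crelb_equiv := EquivRel crelb crelb_refl crelb_sym crelb_trans.
Definition coend : Type := {eq_quot crelb}.
HB.instance Definition _ : EqQuotient cform crelb coend := EqQuotient.on coend.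
HB.instance Definition _ := Choice.on coend.

Definition cscale_form a (x : cform) : cform :=
  map (fun t : cterm => cgen (a *: (tagged t).1) (tagged t).2) x.

Lemma cpiP (x y : cform) : \pi_coend x = \pi_coend y <-> crel x y.
Proof. by split=> [/eqmodP/asboolP|] // xy; apply/eqmodP/asboolP. Qed.

Lemma crel_scale a x y : crel x y -> crel (cscale_form a x) (cscale_form a y).
Proof.
elim=> {x y} /=.
- by move=> x; exact: crel_refl.
- by move=> x y _; exact: crel_sym.
- by move=> y x z _ xy _; exact: crel_trans.
- by move=> x x' y y' _ ? _ ?; rewrite /cscale_form !map_cat; exact: crel_cat.
- by move=> x y; rewrite /cscale_form !map_cat; exact: crel_catC.
- by move=> H q; rewrite scaler0; exact: crel_0.
- by move=> H p p' q; rewrite scalerDr; exact: crel_Dl.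
- by move=> H p q q'; exact: crel_Dr.
- move=> H b p q; rewrite scalerA mulrC -scalerA; exact: crel_Z.
- move=> H H' h p q.
  by rewrite -(linear_Z (pmap_lin P (idm F) h)); exact: crel_dinat.
Qed.

Definition cadd (u v : coend) : coend :=
  locked (\pi_coend (repr u ++ repr v : cform)).
Definition cscale a (u : coend) : coend :=
  locked (\pi_coend (cscale_form a (repr u))).
Definition czero : coend := \pi_coend ([::] : cform).
Definition copp (u : coend) : coend := cscale (-1) u.

Lemma repr_pi (x : cform) : crel (repr (\pi_coend x)) x.
Proof. by apply/cpiP; rewrite reprK. Qed.

Lemma cadd_pi (x y : cform) : cadd (\pi_coend x) (\pi_coend y) = \pi_coend (x ++ y : cform).
Proof. by rewrite /cadd -lock; apply/cpiP; apply: crel_cat; exact: repr_pi. Qed.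

Lemma cscale_pi a (x : cform) : cscale a (\pi_coend x) = \pi_coend (cscale_form a x).
Proof. by rewrite /cscale -lock; apply/cpiP; apply: crel_scale; exact: repr_pi. Qed.

Fact caddA : associative cadd.
Proof.
by move=> u v w; elim/quotW: u => x; elim/quotW: v => y; elim/quotW: w => z; rewrite !cadd_pi catA.
Qed.
Fact caddC : commutative cadd.
Proof. by move=> u v; elim/quotW: u => x; elim/quotW: v => y; rewrite !cadd_pi; apply/cpiP; exact: crel_catC. Qed.
Fact cadd0 : left_id czero cadd.
Proof. by move=> u; elim/quotW: u => x; rewrite /czero cadd_pi. Qed.

Lemma crel_perm_mid t x y : crel (t :: x ++ y) (x ++ t :: y).
Proof.
by have := crel_cat (crel_catC [:: t] x) (crel_refl y); rewrite /= -catA.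
Qed.

Lemma crel_scaleDl a b x :
  crel (cscale_form (a + b) x) (cscale_form a x ++ cscale_form b x).
Proof.
elim: x => [|[H [p q]] x IH] /=; first exact: crel_refl.
rewrite scalerDl -(cat1s (cgen _ _) (cscale_form (a + b) x)).
apply: crel_trans (crel_cat (crel_Dl _ _ _) IH) _.
rewrite /= -[_ :: _ :: _]cat1s -[X in crel _ X]cat1s.
by apply: crel_cat; [exact: crel_refl|exact: crel_perm_mid].
Qed.

Lemma crel_scale0 x : crel (cscale_form 0 x) [::].
Proof.
elim: x => [|[H [p q]] x IH] /=; first exact: crel_refl.
rewrite scale0r -[X in crel X]cat1s -[X in crel _ X]cats0.
by apply: crel_cat => //; exact: crel_0.
Qed.

Lemma cscale_form1 x : cscale_form 1 x = x.
Proof. by elim: x => [|[H [p q]] x IH] //=; rewrite scale1r IH. Qed.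

Fact caddN : left_inverse czero copp cadd.
Proof.
move=> u; elim/quotW: u => x; rewrite /copp cscale_pi cadd_pi; apply/cpiP.
rewrite -[in X in _ ++ X](cscale_form1 x).
apply: crel_trans (crel_sym (crel_scaleDl _ _ _)) _.
by rewrite addNr; exact: crel_scale0.
Qed.

HB.instance Definition _ := GRing.isZmodule.Build coend caddA caddC cadd0 caddN.

Fact cscaleA a b v : cscale a (cscale b v) = cscale (a * b) v.
Proof.
elim/quotW: v => x; rewrite !cscale_pi; congr (\pi_coend _).
by elim: x => [|[H [p q]] x IH] //=; rewrite scalerA IH.
Qed.
Fact cscale1 : left_id 1 cscale.
Proof. by move=> u; elim/quotW: u => x; rewrite cscale_pi cscale_form1. Qed.
Fact cscaleDr : right_distributive cscale +%R.
Proof.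
move=> a; move=> u v; elim/quotW: u => x; elim/quotW: v => y.
by rewrite [_ + _]cadd_pi !cscale_pi [RHS]cadd_pi /cscale_form map_cat.
Qed.
Fact cscaleDl v : {morph cscale^~ v : a b / a + b}.
Proof.
elim/quotW: v => x a b /=; rewrite !cscale_pi [RHS]cadd_pi.
by apply/cpiP; exact: crel_scaleDl.
Qed.

HB.instance Definition _ :=
  GRing.Zmodule_isLmodule.Build k coend cscaleA cscale1 cscaleDr cscaleDl.

Definition pure (H : C) (p : P F H) (q : Q H G) : coend :=
  \pi_coend ([:: cgen p q] : cform).

Lemma pure_linl H (q : Q H G) : linear (fun p : P F H => pure p q).
Proof.
move=> a p p'; rewrite /pure [_ *: \pi_coend _]cscale_pi [RHS]cadd_pi /=.
by apply/cpiP; exact: crel_Dl.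
Qed.

Lemma pure_linr H (p : P F H) : linear (fun q : Q H G => pure p q).
Proof.
move=> a q q'; rewrite /pure [_ *: \pi_coend _]cscale_pi [RHS]cadd_pi /=; apply/cpiP.
apply: crel_trans (crel_Dr _ _ _) _.
rewrite -[X in crel X]cat1s -[X in crel _ X]cat1s; apply: crel_cat; last exact: crel_refl.
exact/crel_sym/crel_Z.
Qed.

Lemma pure_dinat H H' (h : hom H H') (p : P F H) (q : Q H' G) :
  pure (pmap (idm F) h p) q = pure p (pmap h (idm G) q).
Proof. by apply/cpiP; exact: crel_dinat. Qed.

Lemma coend_ind (S : coend -> Prop) :
  S 0 -> (forall H (p : P F H) (q : Q H G) v, S v -> S (pure p q + v)) ->
  forall v, S v.
Proof.
move=> S0 SD; elim/quotW; elim=> [|[H [p q]] x IH]; first exact: S0.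
by have := SD H p q _ IH; rewrite [_ + _]cadd_pi.
Qed.

Lemma coend_ext (V : lmodType k) (f g : coend -> V) : linear f -> linear g ->
  (forall H (p : P F H) (q : Q H G), f (pure p q) = g (pure p q)) ->
  forall v, f v = g v.
Proof.
move=> fl gl fg; apply: coend_ind => [|H p q v IH].
  by rewrite (linear_0 fl) (linear_0 gl).
by rewrite (linear_D fl) (linear_D gl) fg IH.
Qed.

Section Lift.
Variables (V : lmodType k) (b : forall H : C, P F H -> Q H G -> V).
Hypothesis b_linl : forall H (q : Q H G), linear (fun p : P F H => b p q).
Hypothesis b_linr : forall H (p : P F H), linear (fun q : Q H G => b p q).
Hypothesis b_dinat : forall H H' (h : hom H H') (p : P F H) (q : Q H' G),
  b (pmap (idm F) h p) q = b p (pmap h (idm G) q).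

Definition csum (x : cform) : V :=
  foldr (fun t s => b (tagged t).1 (tagged t).2 + s) 0 x.

Lemma csum_cat x y : csum (x ++ y) = csum x + csum y.
Proof. by elim: x => [|t x IH] /=; rewrite ?add0r // IH addrA. Qed.

Lemma csum_rel x y : crel x y -> csum x = csum y.
Proof.
elim=> {x y} //=.
- by move=> y x z _ -> _ ->.
- by move=> x x' y y' _ e _ e'; rewrite !csum_cat e e'.
- by move=> x y; rewrite !csum_cat addrC.
- by move=> H q; rewrite (linear_0 (b_linl q)) addr0.
- by move=> H p p' q; rewrite (linear_D (b_linl q)) addrA.
- by move=> H p q q'; rewrite (linear_D (b_linr p)) addrA.
- by move=> H a p q; rewrite (linear_Z (b_linl q)) (linear_Z (b_linr p)).
- by move=> H H' h p q; rewrite b_dinat.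
Qed.

Definition clift (v : coend) : V := csum (repr v).

Lemma clift_pi (x : cform) : clift (\pi_coend x) = csum x.
Proof. by apply: csum_rel; exact: repr_pi. Qed.

Lemma clift_pure H (p : P F H) (q : Q H G) : clift (pure p q) = b p q.
Proof. by rewrite clift_pi /= addr0. Qed.

Lemma clift_lin : linear clift.
Proof.
move=> a; move=> u v; elim/quotW: u => x; elim/quotW: v => y.
rewrite [_ *: \pi_coend _]cscale_pi [_ + _]cadd_pi !clift_pi csum_cat; congr (_ + _).
elim: x => [|[H [p q]] x IH] /=; first by rewrite scaler0.
by rewrite IH scalerDr (linear_Z (b_linl q)).
Qed.
End Lift.
End Coend.

Arguments pure {k C P Q F G H} p q.
Arguments clift {k C P Q F G V} b v.

Lemma linear_comp (k : fieldType) (U V W : lmodType k) (g : V -> W) (f : U -> V) :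
  linear g -> linear f -> linear (fun x => g (f x)).
Proof. by move=> gl fl a x y; rewrite fl gl. Qed.

Section Pmap.
Variables (k : fieldType) (C : kcat k) (P : prof C).

Lemma pmap_compl F F' F'' G (f' : hom F'' F') (f : hom F' F) (x : P F G) :
  pmap f' (idm G) (pmap f (idm G) x) = pmap (f ∘ f') (idm G) x.
Proof. by rewrite -pmapM comp1m. Qed.

Lemma pmap_compr F G G' G'' (g' : hom G' G'') (g : hom G G') (x : P F G) :
  pmap (idm F) g' (pmap (idm F) g x) = pmap (idm F) (g' ∘ g) x.
Proof. by rewrite -pmapM comp1m. Qed.

Lemma pmap_lr F F' G G' (f : hom F' F) (g : hom G G') (x : P F G) :
  pmap f (idm G') (pmap (idm F) g x) = pmap f g x.
Proof. by rewrite -pmapM !comp1m. Qed.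

Lemma pmap_rl F F' G G' (f : hom F' F) (g : hom G G') (x : P F G) :
  pmap (idm F') g (pmap f (idm G) x) = pmap f g x.
Proof. by rewrite -pmapM !compm1. Qed.
End Pmap.

Arguments pmap_compl {k C} P {F F' F'' G} f' f x.
Arguments pmap_compr {k C} P {F G G' G''} g' g x.
Arguments pmap_lr {k C} P {F F' G G'} f g x.
Arguments pmap_rl {k C} P {F F' G G'} f g x.

Section Diamond.
Variables (k : fieldType) (C : kmoncat k).

Section Objects.
Variables P Q : tamb C.

Definition diam_pmap (F F' G G' : C) (f : hom F' F) (g : hom G G') :
    coend P Q F G -> coend P Q F' G' :=
  clift (fun H p q => pure (pmap f (idm H) p) (pmap (idm H) g q)).

Lemma diam_pmap_linl (F F' G G' : C) (f : hom F' F) (g : hom G G') H (q : Q H G) :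
  linear (fun p : P F H => pure (pmap f (idm H) p) (pmap (idm H) g q)).
Proof. exact: linear_comp (pure_linl _) (pmap_lin _ _ _). Qed.

Lemma diam_pmap_linr (F F' G G' : C) (f : hom F' F) (g : hom G G') H (p : P F H) :
  linear (fun q : Q H G => pure (pmap f (idm H) p) (pmap (idm H) g q)).
Proof. exact: linear_comp (pure_linr _) (pmap_lin _ _ _). Qed.

Lemma diam_pmap_dinat (F F' G G' : C) (f : hom F' F) (g : hom G G') H H'
    (h : hom H H') (p : P F H) (q : Q H' G) :
  pure (pmap f (idm H') (pmap (idm F) h p)) (pmap (idm H') g q)
  = pure (pmap f (idm H) p) (pmap (idm H) g (pmap h (idm G) q)).
Proof. by rewrite pmap_lr pmap_rl -(pmap_lr _ h g) -pure_dinat pmap_rl. Qed.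

Lemma diam_pmap_pure (F F' G G' : C) (f : hom F' F) (g : hom G G') H
    (p : P F H) (q : Q H G) :
  diam_pmap f g (pure p q) = pure (pmap f (idm H) p) (pmap (idm H) g q).
Proof.
apply: clift_pure.
- by move=> *; exact: diam_pmap_linl.
- by move=> *; exact: diam_pmap_linr.
- by move=> *; exact: diam_pmap_dinat.
Qed.

Lemma diam_pmap_lin (F F' G G' : C) (f : hom F' F) (g : hom G G') :
  linear (diam_pmap f g).
Proof.
apply: clift_lin.
- by move=> *; exact: diam_pmap_linl.
- by move=> *; exact: diam_pmap_linr.
- by move=> *; exact: diam_pmap_dinat.
Qed.

Definition diam_prof : prof C.
Proof.
exists (fun F G => coend P Q F G : lmodType k) diam_pmap.
- by move=> F F' G G' f g; exact: diam_pmap_lin.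
- move=> F F' G G' g x a f f'; move: x.
  apply: coend_ext; first exact: diam_pmap_lin.
    move=> b x y /=; rewrite !diam_pmap_lin !scalerDr !scalerA (mulrC a b) -!scalerA.
    by rewrite addrACA.
  by move=> H p q; rewrite !diam_pmap_pure pmap_linl pure_linl.
- move=> F F' G G' f x a g g'; move: x.
  apply: coend_ext; first exact: diam_pmap_lin.
    move=> b x y /=; rewrite !diam_pmap_lin !scalerDr !scalerA (mulrC a b) -!scalerA.
    by rewrite addrACA.
  by move=> H p q; rewrite !diam_pmap_pure pmap_linr pure_linr.
- move=> F G; apply: coend_ext; [exact: diam_pmap_lin|by []|] => H p q.
  by rewrite diam_pmap_pure !pmap1.
- move=> F F' F'' G G' G'' f' f g' g.
  apply: coend_ext; first exact: diam_pmap_lin.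
    exact: linear_comp (diam_pmap_lin _ _) (diam_pmap_lin _ _).
  by move=> H p q; rewrite !diam_pmap_pure pmap_compl pmap_compr.
Defined.

Definition diam_tt (H F G : C) : coend P Q F G -> coend P Q (H ⊗ F) (H ⊗ G) :=
  clift (fun K p q => pure (tstr P H p) (tstr Q H q)).

Lemma diam_tt_linl (H F G K : C) (q : Q K G) :
  linear (fun p : P F K => pure (tstr P H p) (tstr Q H q)).
Proof. exact: linear_comp (pure_linl _) (@tstr_lin _ _ _ _ _ _). Qed.

Lemma diam_tt_linr (H F G K : C) (p : P F K) :
  linear (fun q : Q K G => pure (tstr P H p) (tstr Q H q)).
Proof. exact: linear_comp (pure_linr _) (@tstr_lin _ _ _ _ _ _). Qed.

Lemma diam_tt_dinat (H F G K K' : C) (h : hom K K') (p : P F K) (q : Q K' G) :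
  pure (tstr P H (pmap (idm F) h p)) (tstr Q H q)
  = pure (tstr P H p) (tstr Q H (pmap h (idm G) q)).
Proof. by rewrite !tstr_nat !tensm1 pure_dinat. Qed.

Lemma diam_tt_pure (H F G K : C) (p : P F K) (q : Q K G) :
  diam_tt H (pure p q) = pure (tstr P H p) (tstr Q H q).
Proof.
apply: clift_pure.
- by move=> *; exact: diam_tt_linl.
- by move=> *; exact: diam_tt_linr.
- by move=> *; exact: diam_tt_dinat.
Qed.

Lemma diam_tt_lin (H F G : C) : linear (@diam_tt H F G).
Proof.
apply: clift_lin.
- by move=> *; exact: diam_tt_linl.
- by move=> *; exact: diam_tt_linr.
- by move=> *; exact: diam_tt_dinat.
Qed.

Definition diam : tamb C.
Proof.
exists diam_prof diam_tt => /=.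
- exact: diam_tt_lin.
- move=> H F F' G G' f g.
  apply: coend_ext.
  + exact: linear_comp (@diam_tt_lin _ _ _) (diam_pmap_lin _ _).
  + exact: linear_comp (diam_pmap_lin _ _) (@diam_tt_lin _ _ _).
  by move=> K p q; rewrite !(diam_pmap_pure, diam_tt_pure) !tstr_nat !tensm1.
- move=> H H' F G h.
  apply: coend_ext.
  + exact: linear_comp (diam_pmap_lin _ _) (@diam_tt_lin _ _ _).
  + exact: linear_comp (diam_pmap_lin _ _) (@diam_tt_lin _ _ _).
  move=> K p q; rewrite !diam_tt_pure !diam_pmap_pure !pmap1.
  by rewrite tstr_extra -pure_dinat tstr_extra.
- move=> H K F G.
  apply: coend_ext; first exact: diam_tt_lin.
    apply: linear_comp (diam_pmap_lin _ _) _.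
    exact: linear_comp (@diam_tt_lin _ _ _) (@diam_tt_lin _ _ _).
  move=> L p q; rewrite !diam_tt_pure diam_pmap_pure !tstr_assoc.
  rewrite -(pmap_rl _ (assoc H K F)) pure_dinat -(pmap_lr _ (assoc H K L)) pmap_compl.
  by rewrite (assocK _ _ _).2 pmap1.
- move=> F G.
  apply: coend_ext; first exact: diam_tt_lin.
    exact: diam_pmap_lin.
  move=> L p q; rewrite !diam_tt_pure diam_pmap_pure !tstr_unit.
  rewrite -(pmap_rl _ (lunit F)) pure_dinat -(pmap_lr _ (lunit L)) pmap_compl.
  by rewrite (lunitK _).2 pmap1.
Defined.

End Objects.

Notation "P ◇ Q" := (diam P Q) : kcat_scope.

Section Morphisms.
Variables (P P' Q Q' : tamb C) (u : tmor P P') (v : tmor Q Q').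

Definition diam_map (F G : C) : coend P Q F G -> coend P' Q' F G :=
  clift (fun H p q => pure (u _ _ p) (v _ _ q)).

Lemma diam_map_linl (F G H : C) (q : Q H G) :
  linear (fun p : P F H => pure (u _ _ p) (v _ _ q)).
Proof. exact: linear_comp (pure_linl _) (@tfun_lin _ _ _ _ _ _ _). Qed.

Lemma diam_map_linr (F G H : C) (p : P F H) :
  linear (fun q : Q H G => pure (u _ _ p) (v _ _ q)).
Proof. exact: linear_comp (pure_linr _) (@tfun_lin _ _ _ _ _ _ _). Qed.

Lemma diam_map_dinat (F G H H' : C) (h : hom H H') (p : P F H) (q : Q H' G) :
  pure (u _ _ (pmap (idm F) h p)) (v _ _ q) = pure (u _ _ p) (v _ _ (pmap h (idm G) q)).
Proof. by rewrite !tfun_nat pure_dinat. Qed.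

Lemma diam_map_pure (F G H : C) (p : P F H) (q : Q H G) :
  diam_map (pure p q) = pure (u _ _ p) (v _ _ q).
Proof.
apply: clift_pure.
- by move=> *; exact: diam_map_linl.
- by move=> *; exact: diam_map_linr.
- by move=> *; exact: diam_map_dinat.
Qed.

Lemma diam_map_lin (F G : C) : linear (@diam_map F G).
Proof.
apply: clift_lin.
- by move=> *; exact: diam_map_linl.
- by move=> *; exact: diam_map_linr.
- by move=> *; exact: diam_map_dinat.
Qed.

Definition diam_mor : tmor (P ◇ Q) (P' ◇ Q').
Proof.
exists diam_map => /=.
- exact: diam_map_lin.
- move=> F F' G G' f g; apply: coend_ext.
  + exact: linear_comp (@diam_map_lin _ _) (diam_pmap_lin _ _).
  + exact: linear_comp (diam_pmap_lin _ _) (@diam_map_lin _ _).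
  by move=> H p q; rewrite !(diam_pmap_pure, diam_map_pure) !tfun_nat.
- move=> H F G; apply: coend_ext.
  + exact: linear_comp (@diam_map_lin _ _) (@diam_tt_lin _ _ _ _ _).
  + exact: linear_comp (@diam_tt_lin _ _ _ _ _) (@diam_map_lin _ _).
  by move=> K p q; rewrite /= !(diam_tt_pure, diam_map_pure) !tfun_tt.
Defined.

Lemma diam_morE (F G H : C) (p : P F H) (q : Q H G) :
  diam_mor F G (pure p q) = pure (u F H p) (v H G q).
Proof. exact: diam_map_pure. Qed.
End Morphisms.

Section FromDiamond.
Variables (P Q R : tamb C) (b : forall F H G : C, P F H -> Q H G -> R F G).
Hypothesis b_linl : forall F H G (q : Q H G), linear (fun p : P F H => b p q).
Hypothesis b_linr : forall F H G (p : P F H), linear (fun q : Q H G => b p q).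
Hypothesis b_dinat : forall F G H H' (h : hom H H') (p : P F H) (q : Q H' G),
  b (pmap (idm F) h p) q = b p (pmap h (idm G) q).
Hypothesis b_nat : forall F F' G G' H (f : hom F' F) (g : hom G G')
  (p : P F H) (q : Q H G),
  b (pmap f (idm H) p) (pmap (idm H) g q) = pmap f g (b p q).
Hypothesis b_tt : forall F H G K (p : P F H) (q : Q H G),
  b (tstr P K p) (tstr Q K q) = tstr R K (b p q).

Definition diam_lift_fun (F G : C) : coend P Q F G -> R F G :=
  clift (fun H p q => b p q).

Lemma diam_lift_pure (F G H : C) (p : P F H) (q : Q H G) :
  diam_lift_fun (pure p q) = b p q.
Proof.
apply: clift_pure.
- by move=> *; exact: b_linl.
- by move=> *; exact: b_linr.
- by move=> *; exact: b_dinat.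
Qed.

Lemma diam_lift_lin (F G : C) : linear (@diam_lift_fun F G).
Proof.
apply: clift_lin.
- by move=> *; exact: b_linl.
- by move=> *; exact: b_linr.
- by move=> *; exact: b_dinat.
Qed.

Definition diam_lift : tmor (P ◇ Q) R.
Proof.
exists diam_lift_fun => /=.
- exact: diam_lift_lin.
- move=> F F' G G' f g; apply: coend_ext.
  + exact: linear_comp (@diam_lift_lin _ _) (diam_pmap_lin _ _).
  + exact: linear_comp (pmap_lin _ _ _) (@diam_lift_lin _ _).
  by move=> H p q; rewrite diam_pmap_pure !diam_lift_pure b_nat.
- move=> H F G; apply: coend_ext.
  + exact: linear_comp (@diam_lift_lin _ _) (@diam_tt_lin _ _ _ _ _).
  + exact: linear_comp (@tstr_lin _ _ _ _ _ _) (@diam_lift_lin _ _).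
  by move=> K p q; rewrite /= diam_tt_pure !diam_lift_pure b_tt.
Defined.
End FromDiamond.

Lemma diam_ext (P Q R : tamb C) (u v : tmor (P ◇ Q) R) :
  (forall F H G (p : P F H) (q : Q H G), u F G (pure p q) = v F G (pure p q)) ->
  u = v.
Proof.
move=> uv; apply: tmor_eq => F G.
apply: (coend_ext (f := u F G) (g := v F G)) => [||H p q].
- exact: (@tfun_lin _ _ _ _ u).
- exact: (@tfun_lin _ _ _ _ v).
- exact: uv.
Qed.

Definition hom_prof : prof C.
Proof.
exists (fun F G : C => hom F G) (fun F F' G G' f g x => g ∘ x ∘ f).
- by move=> F F' G G' f g a x y; rewrite comp_linr comp_linl.
- by move=> F F' G G' g x a f f'; rewrite comp_linr.
- by move=> F F' G G' f x a g g'; rewrite !comp_linl.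
- by move=> F G x; rewrite comp1m compm1.
- by move=> F F' F'' G G' G'' f' f g' g x; rewrite !compA.
Defined.

Definition tone : tamb C.
Proof.
exists hom_prof (fun H F G (x : hom F G) => idm H ⊠ x) => /=.
- by move=> H F G; exact: tensm_linr.
- by move=> H F F' G G' f g x; rewrite -!tensmM !comp1m.
- by move=> H H' F G h x; rewrite comp1m compm1 -!tensmM !comp1m !compm1.
- move=> H K F G x; rewrite -compA -assoc_nat compA (assocK _ _ _).1 comp1m.
  by rewrite tensm1.
- by move=> F G x; rewrite -compA -lunit_nat compA (lunitK _).1 comp1m.
Defined.

Definition diam_lunit (P : tamb C) : tmor (tone ◇ P) P.
Proof.
apply: (@diam_lift tone P P (fun F H G (f : hom F H) p => pmap f (idm G) p)).
- by move=> F H G p; exact: pmap_linl.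
- by move=> F H G f; exact: pmap_lin.
- by move=> F G H H' h p q /=; rewrite compm1 pmap_compl.
- by move=> F F' G G' H f g p q /=; rewrite comp1m -!pmapM comp1m compm1 comp1m.
- by move=> F H G K p q /=; rewrite tstr_nat tensm1.
Defined.

Definition diam_runit (P : tamb C) : tmor (P ◇ tone) P.
Proof.
apply: (@diam_lift P tone P (fun F H G p (g : hom H G) => pmap (idm F) g p)).
- by move=> F H G g; exact: pmap_lin.
- by move=> F H G p; exact: pmap_linr.
- by move=> F G H H' h p q /=; rewrite comp1m pmap_compr.
- by move=> F F' G G' H f g p q /=; rewrite compm1 -!pmapM compm1 compm1 comp1m.
- by move=> F H G K p q /=; rewrite tstr_nat tensm1.
Defined.

Lemma diam_lunitE (P : tamb C) (F H G : C) (f : hom F H) (p : P H G) :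
  diam_lunit P F G (pure (P := tone) (f : tone F H) p) = pmap f (idm G) p.
Proof.
rewrite /= diam_lift_pure //.
- by move=> *; exact: pmap_linl.
- by move=> *; exact: pmap_lin.
- by move=> F' G' H' H'' h q r /=; rewrite compm1 pmap_compl.
Qed.

Lemma diam_runitE (P : tamb C) (F H G : C) (p : P F H) (g : hom H G) :
  diam_runit P F G (pure (Q := tone) p (g : tone H G)) = pmap (idm F) g p.
Proof.
rewrite /= diam_lift_pure //.
- by move=> *; exact: pmap_lin.
- by move=> *; exact: pmap_linr.
- by move=> F' G' H' H'' h q r /=; rewrite comp1m pmap_compr.
Qed.

Section Associator.
Variables P Q R : tamb C.

Definition diam_assoc_fun (F K G : C) (v : (P ◇ Q) F K) (r : R K G) :
    (P ◇ (Q ◇ R)) F G :=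
  clift (fun H (p : P F H) (q : Q H K) =>
           pure (Q := Q ◇ R) p (pure q r : (Q ◇ R) H G)) v.

Lemma assoc_linl (F K G : C) (r : R K G) H (q : Q H K) :
  linear (fun p : P F H => pure (Q := Q ◇ R) p (pure q r : (Q ◇ R) H G)).
Proof. exact: pure_linl. Qed.

Lemma assoc_linr (F K G : C) (r : R K G) H (p : P F H) :
  linear (fun q : Q H K => pure (Q := Q ◇ R) p (pure q r : (Q ◇ R) H G)).
Proof.
exact: (linear_comp (pure_linr (Q := Q ◇ R) p) (pure_linl (P := Q) r)).
Qed.

Lemma assoc_dinat (F K G : C) (r : R K G) H H' (h : hom H H') (p : P F H) (q : Q H' K) :
  pure (Q := Q ◇ R) (pmap (idm F) h p) (pure q r : (Q ◇ R) H' G)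
  = pure (Q := Q ◇ R) p (pure (pmap h (idm K) q) r : (Q ◇ R) H G).
Proof. by rewrite pure_dinat /= diam_pmap_pure pmap1. Qed.

Lemma diam_assoc_pure (F H K G : C) (p : P F H) (q : Q H K) (r : R K G) :
  diam_assoc_fun (pure p q) r = pure (Q := Q ◇ R) p (pure q r : (Q ◇ R) H G).
Proof.
apply: (clift_pure (b := fun H (p : P F H) (q : Q H K) =>
           pure (Q := Q ◇ R) p (pure q r : (Q ◇ R) H G))).
- by move=> *; exact: assoc_linl.
- by move=> *; exact: assoc_linr.
- by move=> *; exact: assoc_dinat.
Qed.

Lemma diam_assoc_linl (F K G : C) (r : R K G) :
  linear (fun v : (P ◇ Q) F K => diam_assoc_fun v r).
Proof.
apply: (clift_lin (b := fun H (p : P F H) (q : Q H K) =>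
           pure (Q := Q ◇ R) p (pure q r : (Q ◇ R) H G))).
- by move=> *; exact: assoc_linl.
- by move=> *; exact: assoc_linr.
- by move=> *; exact: assoc_dinat.
Qed.

Lemma diam_assoc_linr (F K G : C) (v : (P ◇ Q) F K) :
  linear (fun r : R K G => diam_assoc_fun v r).
Proof.
move=> a r r'; move: v; apply: coend_ext.
- exact: diam_assoc_linl.
- move=> b x y /=; rewrite !diam_assoc_linl !scalerDr !scalerA (mulrC a b) -!scalerA.
  by rewrite addrACA.
- by move=> H p q; rewrite !diam_assoc_pure pure_linr (pure_linr (Q := Q ◇ R)).
Qed.

Lemma diam_assoc_dinat (F G K K' : C) (h : hom K K') (v : (P ◇ Q) F K) (r : R K' G) :
  diam_assoc_fun (pmap (idm F) h v) r = diam_assoc_fun v (pmap h (idm G) r).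
Proof.
move: v; apply: coend_ext.
- exact: linear_comp (diam_assoc_linl _) (diam_pmap_lin _ _).
- exact: diam_assoc_linl.
- by move=> H p q; rewrite /= diam_pmap_pure pmap1 !diam_assoc_pure pure_dinat.
Qed.

Definition diam_assoc : tmor ((P ◇ Q) ◇ R) (P ◇ (Q ◇ R)).
Proof.
apply: (@diam_lift (P ◇ Q) R (P ◇ (Q ◇ R)) diam_assoc_fun).
- by move=> F K G r; exact: diam_assoc_linl.
- by move=> F K G v; exact: diam_assoc_linr.
- by move=> F G K K' h v r; exact: diam_assoc_dinat.
- move=> F F' G G' K f g v r; move: v; apply: coend_ext.
  + exact: linear_comp (diam_assoc_linl _) (diam_pmap_lin _ _).
  + exact: linear_comp (diam_pmap_lin _ _) (diam_assoc_linl _).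
  move=> H p q; rewrite /= diam_pmap_pure pmap1 !diam_assoc_pure.
  by rewrite (diam_pmap_pure (Q := Q ◇ R)) /= diam_pmap_pure pmap1.
- move=> F K G L v r; move: v; apply: coend_ext.
  + exact: linear_comp (diam_assoc_linl _) (@diam_tt_lin _ _ _ _ _).
  + exact: linear_comp (@diam_tt_lin P (Q ◇ R) _ _ _) (diam_assoc_linl _).
  move=> H p q; rewrite /= diam_tt_pure !diam_assoc_pure.
  by rewrite (diam_tt_pure (Q := Q ◇ R)) /= diam_tt_pure.
Defined.

Lemma diam_assocE (F H K G : C) (p : P F H) (q : Q H K) (r : R K G) :
  diam_assoc F G (pure (P := P ◇ Q) (pure p q : (P ◇ Q) F K) r)
  = pure (Q := Q ◇ R) p (pure q r : (Q ◇ R) H G).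
Proof.
rewrite /= diam_lift_pure ?diam_assoc_pure //.
- by move=> *; exact: diam_assoc_linl.
- by move=> *; exact: diam_assoc_linr.
- by move=> *; exact: diam_assoc_dinat.
Qed.

Lemma diam_ext3 S (u v : tmor ((P ◇ Q) ◇ R) S) :
  (forall F H K G (p : P F H) (q : Q H K) (r : R K G),
    u F G (pure (P := P ◇ Q) (pure p q : (P ◇ Q) F K) r)
    = v F G (pure (P := P ◇ Q) (pure p q : (P ◇ Q) F K) r)) ->
  u = v.
Proof.
move=> uv; apply: diam_ext => F K G x r; move: x; apply: coend_ext.
- exact: (linear_comp (@tfun_lin _ _ _ _ u F G) (pure_linl (P := P ◇ Q) r)).
- exact: (linear_comp (@tfun_lin _ _ _ _ v F G) (pure_linl (P := P ◇ Q) r)).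
- by move=> H p q; exact: uv.
Qed.
End Associator.
End Diamond.

Notation "P ◇ Q" := (diam P Q) : kcat_scope.
Arguments tone {k} C.

Record tmonoid k (C : kmoncat k) := TMonoid {
  tmcar :> tamb C;
  tmul : tmor (tmcar ◇ tmcar) tmcar;
  tunit : tmor (tone C) tmcar;
  tmulA : tmul ∘t diam_mor tmul (tid tmcar)
          = tmul ∘t diam_mor (tid tmcar) tmul ∘t diam_assoc tmcar tmcar tmcar;
  tmul1l : tmul ∘t diam_mor tunit (tid tmcar) = diam_lunit tmcar;
  tmul1r : tmul ∘t diam_mor (tid tmcar) tunit = diam_runit tmcar
}.

Record bimod k (C : kmoncat k) (A B : tmonoid C) := Bimod {
  bmcar :> tamb C;
  lact : tmor (A ◇ bmcar) bmcar;
  ract : tmor (bmcar ◇ B) bmcar;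
  lactA : lact ∘t diam_mor (tmul A) (tid bmcar)
          = lact ∘t diam_mor (tid A) lact ∘t diam_assoc A A bmcar;
  lact1 : lact ∘t diam_mor (tunit A) (tid bmcar) = diam_lunit bmcar;
  ractA : ract ∘t diam_mor ract (tid B)
          = ract ∘t diam_mor (tid bmcar) (tmul B) ∘t diam_assoc bmcar B B;
  ract1 : ract ∘t diam_mor (tid bmcar) (tunit B) = diam_runit bmcar;
  lractA : ract ∘t diam_mor lact (tid B)
           = lact ∘t diam_mor (tid A) ract ∘t diam_assoc A bmcar B
}.

Definition regular k (C : kmoncat k) (A : tmonoid C) : bimod A A :=
  Bimod (tmulA A) (tmul1l A) (tmulA A) (tmul1r A) (tmulA A).

Definition is_bimod_mor k (C : kmoncat k) (A B : tmonoid C) (P Q : bimod A B)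
    (u : tmor P Q) : Prop :=
  u ∘t lact P = lact Q ∘t diam_mor (tid A) u /\
  u ∘t ract P = ract Q ∘t diam_mor u (tid B).

Definition is_bimod_iso k (C : kmoncat k) (A B : tmonoid C) (P Q : bimod A B)
    (u : tmor P Q) : Prop :=
  is_bimod_mor u /\
  exists v : tmor Q P, [/\ is_bimod_mor v, v ∘t u = tid P & u ∘t v = tid Q].

Definition is_bimod_mono k (C : kmoncat k) (A B : tmonoid C) (P Q : bimod A B)
    (u : tmor P Q) : Prop :=
  is_bimod_mor u /\
  forall (S : bimod A B) (v w : tmor S P),
    is_bimod_mor v -> is_bimod_mor w -> u ∘t v = u ∘t w -> v = w.

Definition is_zero_tamb k (C : kmoncat k) (P : tamb C) : Prop :=
  forall (F G : C) (x : P F G), x = 0.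

Definition simple_monoid k (C : kmoncat k) (A : tmonoid C) : Prop :=
  forall (S : bimod A A) (u : tmor S (regular A)),
    is_bimod_mono u -> is_bimod_iso u \/ is_zero_tamb S.

Definition is_coequalizer k (C : kmoncat k) (P Q R : tamb C) (u v : tmor P Q)
    (q : tmor Q R) : Prop :=
  q ∘t u = q ∘t v /\
  forall (S : tamb C) (h : tmor Q S), h ∘t u = h ∘t v ->
    exists! w : tmor R S, w ∘t q = h.

(** [P] is the bimodule M ⊗_B N: the coequalizer of M ◇ B ◇ N ⇉ M ◇ N, with the
  outer actions induced from those of M and N. *)
Definition is_reltensor k (C : kmoncat k) (A B D : tmonoid C)
    (M : bimod A B) (N : bimod B D) (P : bimod A D) : Prop :=
  exists q : tmor (M ◇ N) P,
  [/\ is_coequalizer (diam_mor (ract M) (tid N))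
        (diam_mor (tid M) (lact N) ∘t diam_assoc M B N) q,
      lact P ∘t diam_mor (tid A) q ∘t diam_assoc A M N
        = q ∘t diam_mor (lact M) (tid N)
    & ract P ∘t diam_mor q (tid D)
        = q ∘t diam_mor (tid M) (ract N) ∘t diam_assoc M N D].

Definition reltensor_iso k (C : kmoncat k) (A B D : tmonoid C)
    (M : bimod A B) (N : bimod B D) (Q : bimod A D) : Prop :=
  exists2 P : bimod A D, is_reltensor M N P & exists u : tmor P Q, is_bimod_iso u.

Definition morita_equiv k (C : kmoncat k) (A B : tmonoid C) : Prop :=
  exists (M : bimod A B) (N : bimod B A),
    reltensor_iso M N (regular A) /\ reltensor_iso N M (regular B).

Record smonoid k (C : kmoncat k) := SMonoid {
  smon :> tmonoid C;
  smon_simple : simple_monoid smon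
}.

(** [end_monoid X] is the monoid [X,X]. *)

Section End.
Variables (k : fieldType) (C : kmoncat k) (M : modcat C) (X : M).

Definition end_prof : prof C.
Proof.
exists (fun F G : C => hom (mact M F X) (mact M G X))
       (fun F F' G G' f g x => mact2 g X ∘ x ∘ mact2 f X).
- by move=> F F' G G' f g a x y; rewrite comp_linr comp_linl.
- by move=> F F' G G' g x a f f'; rewrite mact2_lin comp_linr.
- by move=> F F' G G' f x a g g'; rewrite mact2_lin !comp_linl.
- by move=> F G x; rewrite !mact2_1 comp1m compm1.
- by move=> F F' F'' G G' G'' f' f g' g x; rewrite !mact2_M !compA.
Defined.

Definition end_tt (H F G : C) (x : hom (mact M F X) (mact M G X)) :
    hom (mact M (H ⊗ F) X) (mact M (H ⊗ G) X) :=
  mmu H G X ∘ fmor (mact M H) x ∘ mmu' H F X.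

Lemma end_tt_mu (H F G : C) (x : hom (mact M F X) (mact M G X)) :
  end_tt H x ∘ mmu H F X = mmu H G X ∘ fmor (mact M H) x.
Proof. by rewrite /end_tt -compA (mmuK H F X).1 compm1. Qed.

Lemma mmu_epi (H F : C) Y (x y : hom (mact M (H ⊗ F) X) Y) :
  x ∘ mmu H F X = y ∘ mmu H F X -> x = y.
Proof.
by move=> e; rewrite -[x]compm1 -[y]compm1 -(mmuK H F X).2 !compA e.
Qed.

Lemma mmu_natr (H G G' : C) (g : hom G G') :
  mact2 (idm H ⊠ g) X ∘ mmu H G X = mmu H G' X ∘ fmor (mact M H) (mact2 g X).
Proof. by rewrite -mmu_nat2 mact2_1 compm1. Qed.

Lemma mmu_natl (H H' G : C) (h : hom H H') :
  mact2 (h ⊠ idm G) X ∘ mmu H G X = mmu H' G X ∘ mact2 h (mact M G X).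
Proof. by rewrite -mmu_nat2 mact2_1 fmor1 comp1m. Qed.

Definition end_tamb : tamb C.
Proof.
exists end_prof end_tt => /=.
- by move=> H F G a x y; rewrite /end_tt fmor_lin comp_linr comp_linl.
- move=> H F F' G G' f g x; apply: mmu_epi.
  rewrite end_tt_mu -(compA _ _ (mmu _ _ _)) mmu_natr.
  rewrite -(compA _ (end_tt H x)) (compA (end_tt H x)) end_tt_mu.
  by rewrite !compA mmu_natr !fmorM !compA.
- move=> H H' F G h x; apply: mmu_epi.
  rewrite !mact2_1 compm1 comp1m -(compA _ _ (mmu _ _ _)) end_tt_mu compA mmu_natl.
  by rewrite -compA mact2_nat compA -end_tt_mu -!compA mmu_natl.
- move=> H K F G x.
  have aF : mact2 (assoc H K F) X ∘ (mmu (H ⊗ K) F X ∘ mmu H K (mact M F X))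
    = mmu H (K ⊗ F) X ∘ fmor (mact M H) (mmu K F X) := mmuA H K F X.
  apply: mmu_epi; rewrite end_tt_mu.
  have epi Y (u v : hom (mact M (H ⊗ K) (mact M F X)) Y) :
      u ∘ mmu H K _ = v ∘ mmu H K _ -> u = v.
    by move=> e; rewrite -[u]compm1 -[v]compm1 -(mmuK H K (mact M F X)).2 !compA e.
  apply: epi; move: (end_tt_mu H (end_tt K x)) (end_tt_mu K x).
  move: (end_tt H (end_tt K x)) => E; move: (end_tt K x) => e eH eK.
  rewrite -!compA aF (compA E) eH -(compA (mmu _ _ _)) -fmorM eK fmorM.
  rewrite (compA (mmu H _ _)) -mmuA -!compA mmu_nat (compA (mact2 _ _)) -mact2_M.
  by rewrite (assocK H K G).1 mact2_1 comp1m.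
- move=> F G x; apply: mmu_epi; rewrite end_tt_mu.
  have epi Y (u v : hom (mact M (munit C) (mact M F X)) Y) :
      u ∘ meta _ = v ∘ meta _ -> u = v.
    by move=> e; rewrite -[u]compm1 -[v]compm1 -(metaK (mact M F X)).2 !compA e.
  apply: epi; rewrite -!compA mmu1l compm1 -meta_nat !compA.
  have e : mmu (munit C) G X ∘ meta (mact M G X) = mact2 (lunit' G) X.
    rewrite -[LHS]comp1m -mact2_1 -(lunitK G).1 mact2_M -compA.
    by rewrite mmu1l compm1.
  by rewrite e.
Defined.

Lemma end_comp_tt (H F G K : C) (x : hom (mact M F X) (mact M G X))
    (y : hom (mact M G X) (mact M K X)) :
  end_tt H y ∘ end_tt H x = end_tt H (y ∘ x).
Proof.
apply: mmu_epi; rewrite -compA !end_tt_mu compA end_tt_mu -compA -fmorM.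
by [].
Qed.

Definition end_mul : tmor (end_tamb ◇ end_tamb) end_tamb.
Proof.
apply: (@diam_lift _ _ end_tamb end_tamb end_tamb
  (fun F H G (b : hom (mact M F X) (mact M H X)) (c : hom (mact M H X) (mact M G X))
   => c ∘ b)).
- by move=> F H G c; exact: comp_linr.
- by move=> F H G b; exact: comp_linl.
- by move=> F G H H' h b c /=; rewrite !mact2_1 compm1 comp1m compA.
- by move=> F F' G G' H f g b c /=; rewrite !mact2_1 compm1 comp1m !compA.
- by move=> F H G K b c /=; exact: end_comp_tt.
Defined.

Definition end_unit : tmor (tone C) end_tamb.
Proof.
exists (fun F G (f : hom F G) => mact2 f X) => /=.
- by move=> F G; exact: mact2_lin.
- by move=> F F' G G' f g x; rewrite !mact2_M.
- by move=> H F G f; apply: mmu_epi; rewrite end_tt_mu mmu_natr.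
Defined.


Lemma end_mul_pure (F H G : C) (b : end_tamb F H) (c : end_tamb H G) :
  end_mul F G (pure b c) = (c : hom (mact M H X) (mact M G X)) ∘ b.
Proof.
rewrite /= diam_lift_pure //.
- by move=> *; exact: comp_linr.
- by move=> *; exact: comp_linl.
- by move=> F' G' H' H'' h b' c' /=; rewrite !mact2_1 compm1 comp1m compA.
Qed.

Definition end_monoid : tmonoid C.
Proof.
exists end_tamb end_mul end_unit.
- apply: diam_ext3 => F H K G b c d.
  rewrite !tcompE diam_assocE !diam_morE (end_mul_pure (F := F) (H := K)).
  rewrite (end_mul_pure (F := F) (H := H) (G := G)).
  by rewrite (end_mul_pure b c) (end_mul_pure c d) compA.
- apply: diam_ext => F H G f c.
  by rewrite tcompE diam_morE end_mul_pure diam_lunitE /= mact2_1 comp1m.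
- apply: diam_ext => F H G b g.
  by rewrite tcompE diam_morE end_mul_pure diam_runitE /= mact2_1 compm1.
Defined.
End End.

(** Equivalence classes, as predicates; meaningful when [R] is an equivalence. *)

Definition Quot T (R : T -> T -> Prop) : Type :=
  {S : T -> Prop | exists x, S = R x}.

Definition cls T (R : T -> T -> Prop) (x : T) : Quot R :=
  exist _ (R x) (ex_intro _ x erefl).

Definition stmodcat_equiv k (C : kmoncat k) (M N : stmodcat C) : Prop :=
  modcat_equiv M N.

Definition smonoid_morita k (C : kmoncat k) (A B : smonoid C) : Prop :=
  morita_equiv A B.

(* Main.v *)
From HB Require Import structures.
From Stdlib Require Import RelationClasses.
From mathcomp Require Import all_boot all_algebra.
From mathcomp Require Import boolp.
Require Import Defs.

(** Both sides of the bijection are compared with pairs of a module category and a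
  generator. Two facts carry the proof.

  First, a Cauchy complete module category M is determined by the monoid [X,X] of a
  generator X ([matched_total]). Every object Y is the image of an idempotent matrix with
  entries in [X,X], maps are matrices absorbed by the idempotents, and the structure maps
  of the action can be expressed by the Tambara structure and the multiplication of
  [X,X]. Hence an isomorphism of monoids [X,X] = [X',X'] identifies M and M'. Conversely
  every monoid A is of the form [X,X] ([monoid_realized]): the objects of C with maps
  A(F,G) form a module category, generated by the unit object, and one takes its Cauchy
  completion.

  Secondly, A and B are Morita equivalent if and only if they are isomorphic to [X,X] and
  [Y,Y] for two generators X and Y of one Cauchy complete module category. Given the
  generators, the bimodules [X,Y] and [Y,X] with composition as pairings do it: writing
  the identity of X as a sum of maps factoring through objects F.Y shows that composition
  exhibits [X,X] as a relative tensor product ([generators_morita]). Given bimodules M and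
  N, the two isomorphisms M ⊗_B N = A and N ⊗_A M = B need not be compatible, but they
  become so after one of them is corrected by an automorphism of M; then A, B, M, N are
  the maps of a category with two objects, enriched in Tambara modules, and the Cauchy
  completion of its module category has the two generators ([morita_generators]).

  Morita equivalence and equivalence of module categories thereby translate into each
  other, and transitivity of the former follows from that of the latter. Equivalences of
  module categories are handled through correspondences ([modcat_equivP]), for which
  symmetry and transitivity are evident.

  Finally, ideals of M restrict to sub-bimodules of [X,X], bijectively because X
  generates, and sub-bimodules are the subobjects of the regular bimodule. So M is simple
  transitive exactly when [X,X] is simple ([end_simple], [simple_end]). In a simple
  transitive M every non-zero object generates, since the maps that factor through its
  translates form an ideal ([stmodcat_generator]). *)

Set Implicit Arguments.
Unset Strict Implicit.
Unset Printing Implicit Defensive.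

Import GRing.Theory.
Local Open Scope ring_scope.
Local Open Scope quotient_scope.
Local Open Scope kcat_scope.
(** * Vector spaces *)

Lemma lin_sum (k : fieldType) (U V : lmodType k) (f : U -> V) : linear f ->
  forall (I : Type) (s : seq I) (u : I -> U),
  f (\sum_(i <- s) u i) = \sum_(i <- s) f (u i).
Proof.
move=> fl I s u; elim: s => [|i s IH]; first by rewrite !big_nil linear_0.
by rewrite !big_cons linear_D // IH.
Qed.

Lemma linear_B (k : fieldType) (U V : lmodType k) (f : U -> V) : linear f ->
  forall u v, f (u - v) = f u - f v.
Proof. by move=> fl u v; rewrite -scaleN1r addrC fl scaleN1r addrC. Qed.

Section DependentProduct.
Variables (k : fieldType) (I : Type) (V : I -> lmodType k).

Definition dprod : Type := forall i, V i.
HB.instance Definition _ := gen_eqMixin dprod.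
HB.instance Definition _ := gen_choiceMixin dprod.

Let dadd (x y : dprod) : dprod := fun i => x i + y i.
Let dopp (x : dprod) : dprod := fun i => - x i.
Let dscale a (x : dprod) : dprod := fun i => a *: x i.

Fact daddA : associative dadd.
Proof. by move=> x y z; apply: functional_extensionality_dep => i; exact: addrA. Qed.
Fact daddC : commutative dadd.
Proof. by move=> x y; apply: functional_extensionality_dep => i; exact: addrC. Qed.
Fact dadd0 : left_id (fun _ => 0) dadd.
Proof. by move=> x; apply: functional_extensionality_dep => i; exact: add0r. Qed.
Fact daddN : left_inverse (fun _ => 0) dopp dadd.
Proof. by move=> x; apply: functional_extensionality_dep => i; exact: addNr. Qed.
HB.instance Definition _ := GRing.isZmodule.Build dprod daddA daddC dadd0 daddN.

Fact dscaleA a b x : dscale a (dscale b x) = dscale (a * b) x.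
Proof. by apply: functional_extensionality_dep => i; exact: scalerA. Qed.
Fact dscale1 : left_id 1 dscale.
Proof. by move=> x; apply: functional_extensionality_dep => i; exact: scale1r. Qed.
Fact dscaleDr : right_distributive dscale +%R.
Proof. by move=> a x y; apply: functional_extensionality_dep => i; exact: scalerDr. Qed.
Fact dscaleDl x : {morph dscale^~ x : a b / a + b}.
Proof. by move=> a b; apply: functional_extensionality_dep => i; exact: scalerDl. Qed.
HB.instance Definition _ :=
  GRing.Zmodule_isLmodule.Build k dprod dscaleA dscale1 dscaleDr dscaleDl.
End DependentProduct.

Record subspace (k : fieldType) (V : lmodType k) (P : V -> Prop) : Prop := Subspace {
  sub0 : P 0;
  sub_lin : forall a u v, P u -> P v -> P (a *: u + v)
}.

Lemma subD (k : fieldType) (V : lmodType k) (P : V -> Prop) : subspace P ->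
  forall u v, P u -> P v -> P (u + v).
Proof. by move=> hP u v Pu Pv; rewrite -[u]scale1r; exact: (sub_lin hP). Qed.

Lemma subZ (k : fieldType) (V : lmodType k) (P : V -> Prop) : subspace P ->
  forall a u, P u -> P (a *: u).
Proof. by move=> hP a u Pu; rewrite -[_ *: _]addr0; exact: (sub_lin hP) Pu (sub0 hP). Qed.

Lemma subN (k : fieldType) (V : lmodType k) (P : V -> Prop) : subspace P ->
  forall u, P u -> P (- u).
Proof. by move=> hP u Pu; rewrite -scaleN1r; exact: subZ. Qed.

Lemma sub_sum (k : fieldType) (V : lmodType k) (P : V -> Prop) : subspace P ->
  forall (I : Type) (s : seq I) (u : I -> V), (forall i, P (u i)) ->
  P (\sum_(i <- s) u i).
Proof. by move=> hP I s u Pu; elim/big_ind: _ => //; [exact: sub0|exact: subD]. Qed.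

Section SubspaceType.
Variables (k : fieldType) (V : lmodType k) (P : V -> Prop) (hP : subspace P).

(** The closure proof is an argument of the type: the vector space structure below is
  inferred from it. *)
Definition subl of subspace P : Type := {x : V | P x}.
Notation W := (subl hP).
HB.instance Definition _ := gen_eqMixin W.
HB.instance Definition _ := gen_choiceMixin W.

Definition subl_val (x : W) : V := proj1_sig x.
Definition subl_mk (x : V) (Px : P x) : W := exist _ x Px.

Lemma subl_inj : injective subl_val.
Proof. by case=> x Px [y Py] /= e; subst y; congr exist; exact: Prop_irrelevance. Qed.

Let wadd (x y : W) : W := subl_mk (subD hP (proj2_sig x) (proj2_sig y)).
Let wopp (x : W) : W := subl_mk (subN hP (proj2_sig x)).
Let wscale a (x : W) : W := subl_mk (subZ hP a (proj2_sig x)).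

Fact waddA : associative wadd.
Proof. by move=> x y z; apply: subl_inj; exact: addrA. Qed.
Fact waddC : commutative wadd.
Proof. by move=> x y; apply: subl_inj; exact: addrC. Qed.
Fact wadd0 : left_id (subl_mk (sub0 hP)) wadd.
Proof. by move=> x; apply: subl_inj; exact: add0r. Qed.
Fact waddN : left_inverse (subl_mk (sub0 hP)) wopp wadd.
Proof. by move=> x; apply: subl_inj; exact: addNr. Qed.
HB.instance Definition _ := GRing.isZmodule.Build W waddA waddC wadd0 waddN.

Fact wscaleA a b x : wscale a (wscale b x) = wscale (a * b) x.
Proof. by apply: subl_inj; exact: scalerA. Qed.
Fact wscale1 : left_id 1 wscale.
Proof. by move=> x; apply: subl_inj; exact: scale1r. Qed.
Fact wscaleDr : right_distributive wscale +%R.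
Proof. by move=> a x y; apply: subl_inj; exact: scalerDr. Qed.
Fact wscaleDl x : {morph wscale^~ x : a b / a + b}.
Proof. by move=> a b; apply: subl_inj; exact: scalerDl. Qed.
HB.instance Definition _ :=
  GRing.Zmodule_isLmodule.Build k W wscaleA wscale1 wscaleDr wscaleDl.

End SubspaceType.

Section QuotientSpace.
Variables (k : fieldType) (V : lmodType k) (P : V -> Prop) (hP : subspace P).

(** As for [subl], the closure proof is carried by the relation, hence by the quotient. *)
Definition qrel of subspace P := fun x y : V => `[< P (x - y) >].

Fact qrel_refl : reflexive (qrel hP).
Proof. by move=> x; apply/asboolP; rewrite subrr; exact: sub0. Qed.
Fact qrel_sym : symmetric (qrel hP).
Proof. by move=> x y; apply/asboolP/asboolP => /(subN hP); rewrite opprB. Qed.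
Fact qrel_trans : transitive (qrel hP).
Proof.
move=> y x z /asboolP xy /asboolP yz; apply/asboolP.
by have := subD hP xy yz; rewrite addrA subrK.
Qed.

Canonical qrel_equiv := EquivRel (qrel hP) qrel_refl qrel_sym qrel_trans.
Definition quotl : Type := {eq_quot (qrel hP)}.
HB.instance Definition _ : EqQuotient V (qrel hP) quotl := EqQuotient.on quotl.
HB.instance Definition _ := Choice.on quotl.

Definition qpi (x : V) : quotl := \pi_quotl x.

Lemma qpiP x y : qpi x = qpi y <-> P (x - y).
Proof. by split=> [/eqmodP/asboolP|] // xy; apply/eqmodP/asboolP. Qed.

Lemma qrepr x : P (repr (qpi x) - x).
Proof. by apply/qpiP; rewrite /qpi reprK. Qed.

Definition qadd (u v : quotl) : quotl := locked (qpi (repr u + repr v)).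
Definition qopp (u : quotl) : quotl := locked (qpi (- repr u)).
Definition qscale a (u : quotl) : quotl := locked (qpi (a *: repr u)).

Lemma qadd_pi x y : qadd (qpi x) (qpi y) = qpi (x + y).
Proof.
rewrite /qadd -lock; apply/qpiP; rewrite opprD addrACA.
by apply: subD => //; exact: qrepr.
Qed.
Lemma qopp_pi x : qopp (qpi x) = qpi (- x).
Proof.
rewrite /qopp -lock; apply/qpiP; rewrite -opprD.
by apply: subN => //; exact: qrepr.
Qed.
Lemma qscale_pi a x : qscale a (qpi x) = qpi (a *: x).
Proof.
rewrite /qscale -lock; apply/qpiP; rewrite -scalerBr.
by apply: subZ => //; exact: qrepr.
Qed.

Lemma qind (S : quotl -> Prop) : (forall x, S (qpi x)) -> forall u, S u.
Proof. by move=> Sx; elim/quotW. Qed.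

Fact qaddA : associative qadd.
Proof. by do 3 elim/qind => ?; rewrite !qadd_pi addrA. Qed.
Fact qaddC : commutative qadd.
Proof. by do 2 elim/qind => ?; rewrite !qadd_pi addrC. Qed.
Fact qadd0 : left_id (qpi 0) qadd.
Proof. by elim/qind => ?; rewrite !qadd_pi add0r. Qed.
Fact qaddN : left_inverse (qpi 0) qopp qadd.
Proof. by elim/qind => ?; rewrite qopp_pi !qadd_pi addNr. Qed.
HB.instance Definition _ := GRing.isZmodule.Build quotl qaddA qaddC qadd0 qaddN.

Fact qscaleA a b v : qscale a (qscale b v) = qscale (a * b) v.
Proof. by move: v; elim/qind => ?; rewrite !qscale_pi scalerA. Qed.
Fact qscale1 : left_id 1 qscale.
Proof. by elim/qind => ?; rewrite !qscale_pi scale1r. Qed.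
Fact qscaleDr : right_distributive qscale +%R.
Proof.
by move=> a; do 2 elim/qind => ?; rewrite [_ + _]qadd_pi !qscale_pi [RHS]qadd_pi scalerDr.
Qed.
Fact qscaleDl v : {morph qscale^~ v : a b / a + b}.
Proof. by move: v; elim/qind => x a b; rewrite !qscale_pi [RHS]qadd_pi scalerDl. Qed.
HB.instance Definition _ :=
  GRing.Zmodule_isLmodule.Build k quotl qscaleA qscale1 qscaleDr qscaleDl.

Lemma qpi_lin : linear (qpi : V -> (quotl : lmodType k)).
Proof. by move=> a x y; rewrite [_ *: qpi _]qscale_pi [RHS]qadd_pi. Qed.

Lemma qpi_eq0 x : qpi x = 0 <-> P x.
Proof. by rewrite -{2}[x]subr0; exact: qpiP. Qed.

End QuotientSpace.
(** * Linear categories and finite sums of maps *)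

Section CategoryBasics.
Variables (k : fieldType) (C : kcat k).
Implicit Types X Y Z W : C.

Lemma comp0m X Y Z (f : hom X Y) : (0 : hom Y Z) ∘ f = 0.
Proof. exact: (linear_0 (comp_linl f)). Qed.
Lemma compm0 X Y Z (g : hom Y Z) : g ∘ (0 : hom X Y) = 0.
Proof. exact: (linear_0 (comp_linr g)). Qed.
Lemma compDm X Y Z (g g' : hom Y Z) (f : hom X Y) : (g + g') ∘ f = g ∘ f + g' ∘ f.
Proof. exact: (linear_D (comp_linl f)). Qed.
Lemma compmD X Y Z (g : hom Y Z) (f f' : hom X Y) : g ∘ (f + f') = g ∘ f + g ∘ f'.
Proof. exact: (linear_D (comp_linr g)). Qed.
Lemma compZm X Y Z a (g : hom Y Z) (f : hom X Y) : (a *: g) ∘ f = a *: (g ∘ f).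
Proof. exact: (linear_Z (comp_linl f)). Qed.
Lemma compmZ X Y Z a (g : hom Y Z) (f : hom X Y) : g ∘ (a *: f) = a *: (g ∘ f).
Proof. exact: (linear_Z (comp_linr g)). Qed.
Lemma comp_suml X Y Z (I : Type) (s : seq I) (g : I -> hom Y Z) (f : hom X Y) :
  (\sum_(i <- s) g i) ∘ f = \sum_(i <- s) g i ∘ f.
Proof. exact: (lin_sum (comp_linl f)). Qed.
Lemma comp_sumr X Y Z (I : Type) (s : seq I) (g : hom Y Z) (f : I -> hom X Y) :
  g ∘ (\sum_(i <- s) f i) = \sum_(i <- s) g ∘ f i.
Proof. exact: (lin_sum (comp_linr g)). Qed.

(** Inserting a resolution of an identity into a composite. *)
Lemma comp_resolve X Y Z (I : Type) (s : seq I) (M : I -> C)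
    (b : forall i, hom (M i) Y) (a : forall i, hom Y (M i)) (g : hom Y Z) (f : hom X Y) :
  \sum_(i <- s) b i ∘ a i = idm Y ->
  \sum_(i <- s) (g ∘ b i) ∘ (a i ∘ f) = g ∘ f.
Proof.
move=> e; rewrite -[in RHS](compm1 g) -e comp_sumr comp_suml.
by apply: eq_bigr => i _; rewrite !compA.
Qed.
End CategoryBasics.

Lemma fmor_sum (k : fieldType) (C D : kcat k) (F : kfunctor C D) X Y (I : Type)
    (s : seq I) (f : I -> hom X Y) :
  fmor F (\sum_(i <- s) f i) = \sum_(i <- s) fmor F (f i).
Proof. exact: (lin_sum (@fmor_lin _ _ _ F X Y)). Qed.

Section ModuleBasics.
Variables (k : fieldType) (C : kmoncat k) (M : modcat C).
Implicit Types X Y Z : M.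

Lemma mmu'_nat (G F : C) X Y (x : hom X Y) :
  mmu' G F Y ∘ fmor (mact M (G ⊗ F)) x
  = fmor (mact M G) (fmor (mact M F) x) ∘ mmu' G F X.
Proof.
apply: mmu_epi; rewrite -!compA (mmuK G F X).1 compm1 -mmu_nat compA.
by rewrite (mmuK G F Y).1 comp1m.
Qed.

Lemma meta'_nat X Y (x : hom X Y) :
  meta' Y ∘ fmor (mact M (munit C)) x = x ∘ meta' X.
Proof.
rewrite -[LHS]compm1 -(metaK X).2 compA -(compA (meta' Y)) -meta_nat compA.
by rewrite (metaK Y).1 comp1m.
Qed.

Lemma mmu_meta (F : C) X : mmu (munit C) F X ∘ meta (mact M F X) = mact2 (lunit' F) X.
Proof.
rewrite -[LHS]comp1m -mact2_1 -(lunitK F).1 mact2_M -compA.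
by rewrite mmu1l compm1.
Qed.

Lemma mmu_assoc' (H G F : C) X :
  mmu (H ⊗ G) F X ∘ mmu H G (mact M F X)
  = mact2 (assoc' H G F) X ∘ (mmu H (G ⊗ F) X ∘ fmor (mact M H) (mmu G F X)).
Proof. by rewrite -mmuA compA -mact2_M (assocK H G F).1 mact2_1 comp1m. Qed.

(** The four sandwich identities express the structure of M, read between objects F.X,
  through the operations of the monoid [X,X] alone. They are the reason why an
  isomorphism [X,X] = [X',X'] transports the action of C, and not only the maps. *)
Lemma sandwich_act (H F G : C) X Y (x : hom (mact M F X) Y) (y : hom Y (mact M G X)) :
  (mmu H G X ∘ fmor (mact M H) y) ∘ (fmor (mact M H) x ∘ mmu' H F X)
  = end_tt H (y ∘ x).
Proof. by rewrite /end_tt fmorM !compA. Qed.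

Lemma sandwich_act2 (H H' F G : C) (h : hom H H') X Y
    (x : hom (mact M F X) Y) (y : hom Y (mact M G X)) :
  (mmu H' G X ∘ fmor (mact M H') y) ∘ (mact2 h Y ∘ (fmor (mact M H) x ∘ mmu' H F X))
  = end_tt H' (y ∘ x) ∘ mact2 (h ⊠ idm F) X.
Proof.
have -> : mact2 (h ⊠ idm F) X = mmu H' F X ∘ mact2 h (mact M F X) ∘ mmu' H F X.
  by rewrite -mmu_natl -compA (mmuK H F X).2 compm1.
by rewrite (compA (mact2 h Y)) mact2_nat !compA end_tt_mu fmorM !compA.
Qed.

Lemma sandwich_mu (H K F G : C) X Y (x : hom (mact M F X) Y) (y : hom Y (mact M G X)) :
  (mmu (H ⊗ K) G X ∘ fmor (mact M (H ⊗ K)) y)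
    ∘ (mmu H K Y ∘ (fmor (mact M H) (fmor (mact M K) x ∘ mmu' K F X) ∘ mmu' H (K ⊗ F) X))
  = mact2 (assoc' H K G) X ∘ end_tt H (end_tt K (y ∘ x)).
Proof.
rewrite -(compA (mmu (H ⊗ K) G X)) (compA _ (mmu H K Y)) -mmu_nat -!compA.
rewrite (compA (mmu (H ⊗ K) G X)) mmu_assoc' /end_tt !fmorM !compA.
by rewrite -?compA.
Qed.

Lemma sandwich_eta (F G : C) X Y (x : hom (mact M F X) Y) (y : hom Y (mact M G X)) :
  (mmu (munit C) G X ∘ fmor (mact M (munit C)) y) ∘ (meta Y ∘ x)
  = mact2 (lunit' G) X ∘ (y ∘ x).
Proof.
by rewrite -(compA (mmu _ _ _)) (compA _ (meta Y)) -meta_nat -!compA compA mmu_meta compA.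
Qed.

(** Generation is expressed by maps instead of direct sums. This makes sense in module
  categories that are not Cauchy complete, and it is preserved by anything that
  transports maps. *)
Inductive thru X Y Z : hom Y Z -> Prop :=
| thru0 : thru X 0
| thruD F (a : hom Y (mact M F X)) (b : hom (mact M F X) Z) f :
    thru X f -> thru X (b ∘ a + f).

Definition gen X : Prop := forall Y, thru X (idm Y).

Lemma thru1 X Y Z F (a : hom Y (mact M F X)) (b : hom (mact M F X) Z) : thru X (b ∘ a).
Proof. by rewrite -[_ ∘ _]addr0; apply: thruD; exact: thru0. Qed.

Lemma thru_add X Y Z (f g : hom Y Z) : thru X f -> thru X g -> thru X (f + g).
Proof.
by move=> tf tg; elim: tf => [|F a b h _ IH]; rewrite ?add0r // -addrA; exact: thruD.
Qed.

Lemma thru_comp X Y Z Y' Z' (f : hom Y Z) (g : hom Y' Y) (h : hom Z Z') :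
  thru X f -> thru X (h ∘ f ∘ g).
Proof.
elim=> [|F a b f' _ IH]; first by rewrite compm0 comp0m; exact: thru0.
by rewrite compmD compDm compA -compA; apply: thru_add; first exact: thru1.
Qed.

Lemma thru_scale X Y Z c (f : hom Y Z) : thru X f -> thru X (c *: f).
Proof.
elim=> [|F a b f' _ IH]; first by rewrite scaler0; exact: thru0.
by rewrite scalerDr -compZm; apply: thru_add; first exact: thru1.
Qed.

(** F.(G.X) is isomorphic to (F ⊗ G).X. *)
Lemma thru_act X Y Z F (f : hom Y Z) : thru X f -> thru X (fmor (mact M F) f).
Proof.
elim=> [|G a b f' _ IH]; first by rewrite (linear_0 (@fmor_lin _ _ _ _ _ _)); exact: thru0.
rewrite (linear_D (@fmor_lin _ _ _ _ _ _)); apply: thru_add => //.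
rewrite fmorM -[fmor _ a]comp1m -(mmuK F G X).1 -(compA (mmu' _ _ _)) compA.
exact: thru1.
Qed.

Lemma thru_trans X Y : thru X (idm Y) -> forall Z, thru Y (idm Z) -> thru X (idm Z).
Proof.
move=> tY Z; elim=> [|F a b f _ IH]; first exact: thru0.
apply: thru_add => //; rewrite -[b]compm1 -fmor1; apply: thru_comp.
exact: thru_act.
Qed.

Lemma thru_self X : thru X (idm X).
Proof. by rewrite -(metaK X).1; exact: thru1. Qed.

Lemma thruP X Y Z (f : hom Y Z) : thru X f ->
  exists n (Fs : 'I_n -> C) (a : forall i, hom Y (mact M (Fs i) X))
    (b : forall i, hom (mact M (Fs i) X) Z), f = \sum_(i < n) b i ∘ a i.
Proof.
move=> tf.
have [s ->] : exists s : seq {F : C & (hom Y (mact M F X) * hom (mact M F X) Z)%type},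
    f = \sum_(t <- s) (projT2 t).2 ∘ (projT2 t).1.
  elim: tf => [|F a b g _ [s ->]]; first by exists [::]; rewrite big_nil.
  by exists (existT _ F (a, b) :: s); rewrite big_cons.
exists (size s), (fun i => projT1 (tnth (in_tuple s) i)).
exists (fun i => (projT2 (tnth (in_tuple s) i)).1).
exists (fun i => (projT2 (tnth (in_tuple s) i)).2).
by rewrite big_tnth.
Qed.

Lemma thru_sum X Y Z n (Fs : 'I_n -> C) (a : forall i, hom Y (mact M (Fs i) X))
    (b : forall i, hom (mact M (Fs i) X) Z) :
  thru X (\sum_(i < n) b i ∘ a i).
Proof.
elim/big_ind: _ => [|f g|i _]; [exact: thru0|exact: thru_add|exact: thru1].
Qed.
End ModuleBasics.

(** * Direct sums and split idempotents *)

Section OrdinalCases.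
Variables (n : nat) (D : 'I_n.+1 -> Type) (x : D ord0) (y : forall j, D (lift ord0 j)).

(** Dependent case analysis on an ordinal. It defines the injections and projections of a
  sum of n+1 objects from those of a sum of n objects; as ordinals carry proofs, the two
  computation rules only hold propositionally. *)
Definition ord_cases (i : 'I_n.+1) : D i :=
  match unliftP ord0 i with
  | UnliftSome j e => eq_rect_r D (y j) e
  | UnliftNone e => eq_rect_r D x e
  end.

Lemma ord_cases0 : ord_cases ord0 = x.
Proof.
rewrite /ord_cases; case: (unliftP ord0 ord0) => [j e|e].
  by exfalso; have := neq_lift ord0 j; rewrite -{1}e eqxx.
by rewrite (eq_irrelevance e erefl).
Qed.

Lemma ord_casesS j : ord_cases (lift ord0 j) = y j.
Proof.
rewrite /ord_cases; case: (unliftP ord0 (lift ord0 j)) => [j' e|e].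
  have ej := lift_inj e; subst j'; by rewrite (eq_irrelevance e erefl).
by exfalso; have := neq_lift ord0 j; rewrite e eqxx.
Qed.
End OrdinalCases.

Section Cauchy.
Variables (k : fieldType) (N : kcat k).

Lemma direct_sum2P (X Y P : N) : is_direct_sum (pairf X Y) P <->
  exists (iX : hom X P) (iY : hom Y P) (pX : hom P X) (pY : hom P Y),
  [/\ pX ∘ iX = idm X, pY ∘ iY = idm Y, pY ∘ iX = 0, pX ∘ iY = 0
    & iX ∘ pX + iY ∘ pY = idm P].
Proof.
split=> [[inj [prj [h1 h2 h3]]]|[iX [iY [pX [pY [hX hY hYX hXY hP]]]]]].
  exists (inj ord0), (inj (lift ord0 ord0)), (prj ord0), (prj (lift ord0 ord0)).
  split; [exact: (h1 ord0)|exact: (h1 (lift ord0 ord0))|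
    exact: (h2 ord0 (lift ord0 ord0))|exact: (h2 (lift ord0 ord0) ord0)|].
  by rewrite -h3 big_ord_recl big_ord1.
exists (fun i => if i == ord0 as b return hom (if b then X else Y) P then iX else iY).
exists (fun i => if i == ord0 as b return hom P (if b then X else Y) then pX else pY).
rewrite /pairf; split.
- by move=> i; case: (i == ord0).
- have ij0 (i j : 'I_2) : i != j -> (i == ord0) = ~~ (j == ord0).
    by case: i j => [[|[|i]] // pi] [[|[|j]] // pj].
  by move=> i j /ij0; case: (i == ord0); case: (j == ord0).
- by rewrite big_ord_recl big_ord1.
Qed.

Hypothesis ccN : cauchy_complete N.

Lemma direct_sum_exists n (Xs : 'I_n -> N) : exists P, is_direct_sum Xs P.
Proof.
elim: n Xs => [|n IH] Xs.
  have [Z zZ] := cc_zero ccN; exists Z.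
  exists (fun i => (0 : hom (Xs i) Z)), (fun i => (0 : hom Z (Xs i))); split; try by case.
  by rewrite big_ord0; exact/esym/(zZ Z).1.
have [P' [inj [prj [h1 h2 h3]]]] := IH (fun j => Xs (lift ord0 j)).
have [P /direct_sum2P[iX [iY [pX [pY [hX hY hYX hXY hP]]]]]] := cc_sum ccN (Xs ord0) P'.
exists P, (ord_cases (D := fun i => hom (Xs i) P) iX (fun j => iY ∘ inj j)).
exists (ord_cases (D := fun i => hom P (Xs i)) pX (fun j => prj j ∘ pY)); split.
- move=> i; case: (unliftP ord0 i) => [j|] ->; last by rewrite !ord_cases0.
  by rewrite !ord_casesS !compA -(compA (prj j)) hY compm1 h1.
- move=> i i'; case: (unliftP ord0 i) => [j|] ->; case: (unliftP ord0 i') => [j'|] ->.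
  + rewrite (inj_eq lift_inj) => jj'.
    by rewrite !ord_casesS !compA -(compA (prj j')) hY compm1 h2.
  + by rewrite ord_casesS ord_cases0 compA hXY comp0m.
  + by rewrite ord_casesS ord_cases0 -compA hYX compm0.
  + by rewrite eqxx.
- rewrite big_ord_recl !ord_cases0 -hP; congr (_ + _).
  under eq_bigr => j _ do rewrite !ord_casesS -compA (compA (inj j)).
  by rewrite -comp_sumr -comp_suml h3 comp1m.
Qed.

(** An idempotent matrix is an idempotent of the direct sum, so it splits in a Cauchy
  complete category. *)
Lemma split_matrix n (Zs : 'I_n -> N) (e : forall i j, hom (Zs i) (Zs j)) :
  (forall i l, \sum_(j < n) e j l ∘ e i j = e i l) ->
  exists (Y : N) (a : forall i, hom Y (Zs i)) (b : forall i, hom (Zs i) Y),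
    \sum_(i < n) b i ∘ a i = idm Y /\ forall i j, a j ∘ b i = e i j.
Proof.
move=> ee; have [P [inj [prj [h1 h2 h3]]]] := direct_sum_exists Zs.
pose E : hom P P := \sum_(i < n) \sum_(j < n) inj j ∘ e i j ∘ prj i.
have Einj i : E ∘ inj i = \sum_(j < n) inj j ∘ e i j.
  rewrite comp_suml (bigD1 i) //= [X in _ + X]big1 ?addr0 => [|i' ii'].
    rewrite comp_suml; apply: eq_bigr => j _; by rewrite -compA h1 compm1.
  rewrite comp_suml big1 // => j _.
  by rewrite -!compA h2 1?eq_sym // !compm0.
have prjS i (J : 'I_n -> N) (Y : N) (x : forall j, hom Y (Zs j)) :
    prj i ∘ (\sum_(j < n) inj j ∘ x j) = x i.
  rewrite comp_sumr (bigD1 i) //= compA h1 comp1m big1 ?addr0 // => j ji.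
  by rewrite compA h2 // comp0m.
have prjE i j : prj j ∘ E ∘ inj i = e i j by rewrite -compA Einj prjS.
have EE : E ∘ E = E.
  rewrite {2 3}/E comp_sumr; apply: eq_bigr => i _; rewrite comp_sumr.
  under eq_bigr => j _ do rewrite !compA Einj.
  rewrite -comp_suml -[RHS]comp_suml; congr (_ ∘ _).
  under eq_bigr => j _ do rewrite comp_suml.
  rewrite exchange_big; apply: eq_bigr => l _ /=; rewrite -ee comp_sumr.
  by apply: eq_bigr => j _; rewrite compA.
have [Y [r [s [rs sr]]]] := cc_split ccN EE.
exists Y, (fun i => prj i ∘ s), (fun i => r ∘ inj i); split=> [|i j].
  under eq_bigr => i _ do rewrite -compA (compA (inj i)).
  by rewrite -comp_sumr -comp_suml h3 comp1m.
by rewrite -prjE -sr !compA.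
Qed.
End Cauchy.

Section Generators.
Variables (k : fieldType) (C : kmoncat k) (N : modcat C).

Lemma cyclic_gen (X : N) : cyclic_generator X -> gen X.
Proof.
move=> cX Y; have [n [Fs [P [Q [[inj [prj [_ _ h3]]]]]]]] := cX Y.
move=> /direct_sum2P[i [_ [p [_ [pi _ _ _ _]]]]].
rewrite -pi -[i]comp1m -h3 comp_suml comp_sumr.
by under eq_bigr => j _ do rewrite -compA compA; exact: thru_sum.
Qed.

(** A resolution of the identity of Y makes Y a retract of the sum P of the F_i.X; the
  complement of Y is obtained by splitting the complementary idempotent. *)
Lemma gen_cyclic (X : N) : cauchy_complete N -> gen X -> cyclic_generator X.
Proof.
move=> ccN gX Y; have [n [Fs [a [b e]]]] := thruP (gX Y).
have [P [inj [prj [h1 h2 h3]]]] := direct_sum_exists ccN (fun i => mact N (Fs i) X).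
pose s := \sum_(i < n) inj i ∘ a i; pose r := \sum_(i < n) b i ∘ prj i.
have rs : r ∘ s = idm Y.
  rewrite e comp_suml; apply: eq_bigr => i _; rewrite comp_sumr (bigD1 i) //=.
  rewrite big1 ?addr0 => [|j ji]; first by rewrite -compA (compA (prj i)) h1 comp1m.
  by rewrite -compA (compA (prj i)) h2 // comp0m compm0.
have sr2 : s ∘ r ∘ (s ∘ r) = s ∘ r by rewrite compA -(compA s) rs compm1.
have [|Q [r' [s' [rs' sr']]]] := cc_split ccN (e := idm P + (-1) *: (s ∘ r)).
  rewrite compDm !compmD !compZm !compmZ sr2 !comp1m compm1 scalerA mulrNN mulr1.
  by rewrite scale1r scaleN1r addNr addr0.
have sr'0 : s' ∘ r' ∘ s = 0.
  by rewrite sr' compDm compZm comp1m -compA rs compm1 scaleN1r subrr.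
have rsr'0 : r ∘ (s' ∘ r') = 0.
  by rewrite sr' compmD compmZ compm1 compA rs comp1m scaleN1r subrr.
exists n, Fs, P, Q; split; first by exists inj, prj.
apply/direct_sum2P; exists s, s', r, r'; split=> //.
- by rewrite -[r']comp1m -rs' -compA -compA (compA s') sr'0 compm0.
- by rewrite -[s']compm1 -rs' (compA s') compA rsr'0 comp0m.
- by rewrite sr' addrC scaleN1r subrK.
Qed.

Lemma thru_is_ideal (X : N) : is_ideal (fun Y Z (f : hom Y Z) => thru X f).
Proof.
split.
- by move=> Y Z; exact: thru0.
- by move=> Y Z a f g tf tg; apply: thru_add => //; exact: thru_scale.
- by move=> Y Z W V h g f tg; exact: thru_comp.
- by move=> F Y Z f; exact: thru_act.
Qed.
End Generators.

(** The maps that factor through sums of objects F.X form an ideal containing the identity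
  of X. If X is not zero, this ideal is everything, and X generates. *)
Lemma stmodcat_generator (k : fieldType) (C : kmoncat k) (M : stmodcat C) :
  exists X : M, cyclic_generator X.
Proof.
have [[X X0]|all0] := pselect (exists X : M, idm X <> 0).
  exists X; apply: gen_cyclic; first exact: stm_cauchy.
  move=> Y; have [t0|//] := stm_simple (thru_is_ideal X).
  by case: X0; apply/t0; exact: thru_self.
have [Z _] := cc_zero (stm_cauchy M).
exists Z; apply: gen_cyclic; first exact: stm_cauchy.
move=> Y; suff -> : idm Y = 0 by exact: thru0.
by apply: contra_notP all0 => Y0; exists Y.
Qed.

(** * Correspondences of module categories *)

(** Equivalences of module categories without choices of images: objects Y and Y' may be
  related in many ways, and each pair of relations identifies the spaces of maps,
  compatibly with composition and action. An equivalence Phi relates Y to Y' by the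
  isomorphisms Phi Y = Y'; conversely any choice of related objects gives a module
  functor. Unlike equivalences, correspondences are visibly symmetric and transitive. *)
Record corr (k : fieldType) (C : kmoncat k) (M N : modcat C) := Corr {
  corel : M -> N -> Type;
  cfwd : forall Y Y' Z Z', corel Y Y' -> corel Z Z' -> hom Y Z -> hom Y' Z';
  cbwd : forall Y Y' Z Z', corel Y Y' -> corel Z Z' -> hom Y' Z' -> hom Y Z;
  cfwdK : forall Y Y' Z Z' (u : corel Y Y') (v : corel Z Z'), cancel (cfwd u v) (cbwd u v);
  cbwdK : forall Y Y' Z Z' (u : corel Y Y') (v : corel Z Z'), cancel (cbwd u v) (cfwd u v);
  cfwd_lin : forall Y Y' Z Z' (u : corel Y Y') (v : corel Z Z'), linear (cfwd u v);
  cfwd1 : forall Y Y' (u : corel Y Y'), cfwd u u (idm Y) = idm Y';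
  cfwdM : forall Y Y' Z Z' W W' (u : corel Y Y') (v : corel Z Z') (w : corel W W')
    (g : hom Z W) (f : hom Y Z), cfwd u w (g ∘ f) = cfwd v w g ∘ cfwd u v f;
  cact : forall (F : C) Y Y', corel Y Y' -> corel (mact M F Y) (mact N F Y');
  cfwd_act : forall (F : C) Y Y' Z Z' (u : corel Y Y') (v : corel Z Z') (f : hom Y Z),
    cfwd (cact F u) (cact F v) (fmor (mact M F) f) = fmor (mact N F) (cfwd u v f);
  cfwd_act2 : forall (F G : C) (h : hom F G) Y Y' (u : corel Y Y'),
    cfwd (cact F u) (cact G u) (mact2 h Y) = mact2 h Y';
  cfwd_mu : forall (G F : C) Y Y' (u : corel Y Y'),
    cfwd (cact G (cact F u)) (cact (G ⊗ F) u) (mmu G F Y) = mmu G F Y';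
  cfwd_eta : forall Y Y' (u : corel Y Y'),
    cfwd u (cact (munit C) u) (meta Y) = meta Y'
}.

Definition ctotal k (C : kmoncat k) (M N : modcat C) (W : corr M N) : Prop :=
  (forall Y, exists Y', inhabited (corel W Y Y')) /\
  (forall Y', exists Y, inhabited (corel W Y Y')).

Section CorrTheory.
Variables (k : fieldType) (C : kmoncat k) (M N : modcat C) (W : corr M N).

Lemma cbwd_lin Y Y' Z Z' (u : corel W Y Y') (v : corel W Z Z') : linear (cbwd u v).
Proof. by move=> a f g; apply: (can_inj (cfwdK u v)); rewrite cfwd_lin !cbwdK. Qed.
Lemma cbwd1 Y Y' (u : corel W Y Y') : cbwd u u (idm Y') = idm Y.
Proof. by apply: (can_inj (cfwdK u u)); rewrite cbwdK cfwd1. Qed.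
Lemma cbwdM Y Y' Z Z' V V' (u : corel W Y Y') (v : corel W Z Z') (w : corel W V V')
  (g : hom Z' V') (f : hom Y' Z') : cbwd u w (g ∘ f) = cbwd v w g ∘ cbwd u v f.
Proof. by apply: (can_inj (cfwdK u w)); rewrite (cfwdM u v w) !cbwdK. Qed.
Lemma cbwd_act (F : C) Y Y' Z Z' (u : corel W Y Y') (v : corel W Z Z') (f : hom Y' Z') :
  cbwd (cact F u) (cact F v) (fmor (mact N F) f) = fmor (mact M F) (cbwd u v f).
Proof. by apply: (can_inj (cfwdK (cact F u) (cact F v))); rewrite cfwd_act !cbwdK. Qed.
Lemma cbwd_act2 (F G : C) (h : hom F G) Y Y' (u : corel W Y Y') :
  cbwd (cact F u) (cact G u) (mact2 h Y') = mact2 h Y.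
Proof. by apply: (can_inj (cfwdK (cact F u) (cact G u))); rewrite cfwd_act2 !cbwdK. Qed.
Lemma cbwd_mu (G F : C) Y Y' (u : corel W Y Y') :
  cbwd (cact G (cact F u)) (cact (G ⊗ F) u) (mmu G F Y') = mmu G F Y.
Proof. by apply: (can_inj (cfwdK (cact G (cact F u)) (cact (G ⊗ F) u))); rewrite cfwd_mu !cbwdK. Qed.
Lemma cbwd_eta Y Y' (u : corel W Y Y') : cbwd u (cact (munit C) u) (meta Y') = meta Y.
Proof. by apply: (can_inj (cfwdK u (cact (munit C) u))); rewrite cfwd_eta !cbwdK. Qed.

Definition corr_sym : corr N M.
Proof.
exists (fun Y' Y => corel W Y Y') (fun _ _ _ _ u v => cbwd u v)
  (fun _ _ _ _ u v => cfwd u v) (fun F _ _ u => cact F u) => /=.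
- by move=> *; exact: cbwdK.
- by move=> *; exact: cfwdK.
- by move=> *; exact: cbwd_lin.
- by move=> *; exact: cbwd1.
- by move=> *; exact: cbwdM.
- by move=> *; exact: cbwd_act.
- by move=> *; exact: cbwd_act2.
- by move=> *; exact: cbwd_mu.
- by move=> *; exact: cbwd_eta.
Defined.

Lemma cfwd_mu' (G F : C) Y Y' (u : corel W Y Y') :
  cfwd (cact (G ⊗ F) u) (cact G (cact F u)) (mmu' G F Y) = mmu' G F Y'.
Proof.
apply: mmu_epi; rewrite -(cfwd_mu G F u) -cfwdM (mmuK G F Y).1 cfwd1.
by rewrite cfwd_mu (mmuK G F Y').1.
Qed.

Lemma cfwd_end_tt (H F G : C) X X' (u : corel W X X')
    (x : hom (mact M F X) (mact M G X)) :
  cfwd (cact (H ⊗ F) u) (cact (H ⊗ G) u) (end_tt H x)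
  = end_tt H (cfwd (cact F u) (cact G u) x).
Proof.
rewrite /end_tt (cfwdM _ (cact H (cact F u))) cfwd_mu' (cfwdM _ (cact H (cact G u))).
by rewrite cfwd_mu cfwd_act.
Qed.

Lemma thru_cfwd X X' Y Y' Z Z' (w : corel W X X') (u : corel W Y Y') (v : corel W Z Z')
    (f : hom Y Z) : thru X f -> thru X' (cfwd u v f).
Proof.
elim=> [|F a b g _ IH]; first by rewrite (linear_0 (cfwd_lin u v)); exact: thru0.
rewrite (linear_D (cfwd_lin u v)) (cfwdM u (cact F w)).
by apply: thru_add; first exact: thru1.
Qed.

Lemma gen_cfwd X X' (w : corel W X X') : ctotal W -> gen X -> gen X'.
Proof.
move=> [_ tW] gX Y'; have [Y [u]] := tW Y'.
by rewrite -(cfwd1 u); exact: (thru_cfwd w).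
Qed.

End CorrTheory.

Section CorrFunctor.
Variables (k : fieldType) (C : kmoncat k) (M N : modcat C) (W : corr M N).
Variables (f : M -> N) (w : forall Y, corel W Y (f Y)).

Definition corr_fun : kfunctor M N.
Proof.
exists f (fun X Y => cfwd (w X) (w Y)).
- by move=> X; exact: cfwd1.
- by move=> X Y Z g h; exact: cfwdM.
- by move=> X Y; exact: cfwd_lin.
Defined.

Lemma cfwd_iso Y Y' Y'' (u : corel W Y Y') (v : corel W Y Y'') : is_iso (cfwd u v (idm Y)).
Proof. by exists (cfwd v u (idm Y)); split; rewrite -cfwdM comp1m cfwd1. Qed.

(** The chosen image of F.Y and the image under F of the chosen image of Y are both related
  to F.Y, hence isomorphic through the transported identity. All coherence laws are
  instances of functoriality of the transport. *)
Definition corr_modfunctor : modfunctor M N.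
Proof.
exists corr_fun (fun F Y => cfwd (cact F (w Y)) (w (mact M F Y)) (idm (mact M F Y))) => /=.
- by move=> F X; exact: cfwd_iso.
- by move=> F X Y x; rewrite -cfwd_act -!cfwdM comp1m compm1.
- by move=> F G h X; rewrite -(cfwd_act2 h (w X)) -!cfwdM comp1m compm1.
- move=> G F X; rewrite -(cfwd_mu G F (w X)) -cfwd_act -!cfwdM comp1m fmor1.
  by rewrite !compm1.
- by move=> X; rewrite -(cfwd_eta (w X)) -cfwdM comp1m.
Defined.
End CorrFunctor.

Section CorrEquivalence.
Variables (k : fieldType) (C : kmoncat k).

Lemma corr_modcat_equiv (M N : modcat C) (W : corr M N) : ctotal W -> modcat_equiv M N.
Proof.
move=> [tl tr].
have /choice[f w] Y : exists Y', inhabited (corel W Y Y') by exact: tl.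
have /choice[g v] Y' : exists Y, inhabited (corel W Y Y') by exact: tr.
pose wW Y : corel W Y (f Y) := inhabited_witness (w Y).
pose vW Y : corel W (g Y) Y := inhabited_witness (v Y).
exists (corr_modfunctor wW), (corr_fun (W := corr_sym W) vW).
exists (fun X => cbwd (wW X) (vW (f X)) (idm (f X))).
exists (fun Y => cfwd (wW (g Y)) (vW Y) (idm (g Y))); split=> /=.
- by move=> X; exact: (cfwd_iso (W := corr_sym W) (wW X) (vW (f X))).
- by move=> Y; exact: cfwd_iso.
- by move=> X X' x; rewrite -{1}(cfwdK (wW X) (wW X') x) -!cbwdM comp1m compm1.
- by move=> Y Y' y; rewrite -{2}(cbwdK (vW Y) (vW Y') y) -!cfwdM comp1m compm1.
Qed.

Definition corr_trans (L M N : modcat C) (U : corr L M) (W : corr M N) : corr L N.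
Proof.
exists (fun X Z => {Y : M & (corel U X Y * corel W Y Z)%type})
  (fun _ _ _ _ u v f => cfwd (projT2 u).2 (projT2 v).2 (cfwd (projT2 u).1 (projT2 v).1 f))
  (fun _ _ _ _ u v f => cbwd (projT2 u).1 (projT2 v).1 (cbwd (projT2 u).2 (projT2 v).2 f))
  (fun F _ _ u => existT _ (mact M F (projT1 u)) (cact F (projT2 u).1, cact F (projT2 u).2)).
- by move=> Y Y' Z Z' [Y1 [u u']] [Z1 [v v']] f /=; rewrite !cfwdK.
- by move=> Y Y' Z Z' [Y1 [u u']] [Z1 [v v']] f /=; rewrite !cbwdK.
- by move=> Y Y' Z Z' [Y1 [u u']] [Z1 [v v']] a f g /=; rewrite !cfwd_lin.
- by move=> Y Y' [Y1 [u u']] /=; rewrite !cfwd1.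
- by move=> Y Y' Z Z' V V' [Y1 [u u']] [Z1 [v v']] [V1 [w w']] g f /=; rewrite -!cfwdM.
- by move=> F Y Y' Z Z' [Y1 [u u']] [Z1 [v v']] f /=; rewrite !cfwd_act.
- by move=> F G h Y Y' [Y1 [u u']] /=; rewrite !cfwd_act2.
- by move=> G F Y Y' [Y1 [u u']] /=; rewrite !cfwd_mu.
- by move=> Y Y' [Y1 [u u']] /=; rewrite !cfwd_eta.
Defined.

Lemma ctotal_sym (M N : modcat C) (W : corr M N) : ctotal W -> ctotal (corr_sym W).
Proof. by case. Qed.

Lemma ctotal_trans (L M N : modcat C) (U : corr L M) (W : corr M N) :
  ctotal U -> ctotal W -> ctotal (corr_trans U W).
Proof.
move=> [Ul Ur] [Wl Wr]; split.
  move=> X; have [Y [u]] := Ul X; have [Z [w]] := Wl Y.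
  by exists Z; split; exists Y.
move=> Z; have [Y [w]] := Wr Z; have [X [u]] := Ur Y.
by exists X; split; exists Y.
Qed.

Section FromEquivalence.
Variables (M N : modcat C) (Phi : modfunctor M N) (G : kfunctor N M).
Variables (eta : forall X, hom X (G (Phi X))) (eps : forall Y, hom (Phi (G Y)) Y).
Hypothesis (eta_iso : forall X, is_iso (eta X)) (eps_iso : forall Y, is_iso (eps Y)).
Hypothesis eta_nat : forall X X' (f : hom X X'), eta X' ∘ f = fmor G (fmor Phi f) ∘ eta X.
Hypothesis eps_nat : forall Y Y' (g : hom Y Y'), eps Y' ∘ fmor Phi (fmor G g) = g ∘ eps Y.

Let eta' X : hom (G (Phi X)) X := projT1 (cid (eta_iso X)).
Let eta'E X : mutually_inverse (eta X) (eta' X) := projT2 (cid (eta_iso X)).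
Let s' F X : hom (Phi (mact M F X)) (mact N F (Phi X)) := projT1 (cid (mfs_iso Phi F X)).
Let s'E F X : mutually_inverse (mfs Phi F X) (s' F X) := projT2 (cid (mfs_iso Phi F X)).

Record over (X : M) (Y : N) := Over {
  oto : hom (Phi X) Y;
  ofrom : hom Y (Phi X);
  overK : mutually_inverse oto ofrom
}.

(* An equivalence is fully faithful, without triangle identities: G is faithful because
   eps is invertible, and then fullness of Phi can be checked after applying G. *)
Let G_faithful Y Y' (g h : hom Y Y') : fmor G g = fmor G h -> g = h.
Proof.
move=> e; have [q [_ qe]] := eps_iso Y.
by rewrite -[g]compm1 -[h]compm1 -qe !compA -!eps_nat e.
Qed.

Let full X X' (h : hom (Phi X) (Phi X')) : fmor Phi (eta' X' ∘ fmor G h ∘ eta X) = h.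
Proof.
apply: G_faithful; rewrite -[LHS]compm1 -(eta'E X).2 compA -eta_nat.
by rewrite !compA (eta'E X').2 comp1m -compA (eta'E X).2 compm1.
Qed.

Let over_act F X Y (u : over X Y) : over (mact M F X) (mact N F Y).
Proof.
exists (fmor (mact N F) (oto u) ∘ s' F X) (mfs Phi F X ∘ fmor (mact N F) (ofrom u)).
split; rewrite -!compA.
  rewrite (compA (fmor _ (ofrom u))) -fmorM (overK u).1 fmor1 comp1m.
  exact: (s'E F X).2.
by rewrite (compA (s' F X)) (s'E F X).1 comp1m -fmorM (overK u).2 fmor1.
Defined.

Definition equiv_corr : corr M N.
Proof.
exists over (fun X Y X' Y' u v f => oto v ∘ fmor Phi f ∘ ofrom u)
  (fun X Y X' Y' u v g => eta' X' ∘ fmor G (ofrom v ∘ g ∘ oto u) ∘ eta X)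
  over_act.
- move=> X Y X' Y' u v f /=; rewrite !compA (overK v).1 comp1m -!compA (overK u).1.
  by rewrite compm1 -eta_nat compA (eta'E X').1 comp1m.
- move=> X Y X' Y' u v g /=; rewrite full !compA (overK v).2 comp1m -compA (overK u).2.
  by rewrite compm1.
- by move=> X Y X' Y' u v a f g; rewrite fmor_lin comp_linr comp_linl.
- by move=> X Y u; rewrite fmor1 compm1 (overK u).2.
- move=> X Y X' Y' X'' Y'' u v w g f; rewrite fmorM -!compA (compA (ofrom v)).
  by rewrite (overK v).1 comp1m.
- move=> F X Y X' Y' u v f /=; rewrite !fmorM -!compA (compA (fmor Phi _)) -mfs_nat.
  by rewrite -compA (compA (s' F X')) (s'E F X').1 comp1m.
- move=> F H h X Y u /=; rewrite -!compA (compA (fmor Phi _)) -mfs_nat2.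
  rewrite -compA (compA (s' H X)) (s'E H X).1 comp1m mact2_nat compA -fmorM.
  by rewrite (overK u).2 fmor1 comp1m.
- move=> H F X Y u /=.
  rewrite fmorM -!compA (compA (mfs Phi H _)) (compA (fmor Phi _)) -mfs_mu.
  rewrite -(compA (mfs _ _ _)) (compA (s' _ _)) (s'E _ X).1 comp1m mmu_nat compA.
  by rewrite -fmorM (overK u).2 fmor1 comp1m.
- move=> X Y u /=; rewrite -mfs_eta !compA -(compA _ (s' _ X)) (s'E _ X).1 compm1.
  by rewrite -meta_nat -compA (overK u).2 compm1.
Defined.

Lemma equiv_corr_total : ctotal equiv_corr.
Proof.
split=> [X|Y].
  exists (Phi X); split; exists (idm (Phi X)) (idm (Phi X)).
  by split; rewrite comp1m.
have [q qe] := eps_iso Y.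
by exists (G Y); split; exists (eps Y) q.
Qed.
End FromEquivalence.

(** Correspondences are symmetric and compose by construction, so this criterion
  makes equivalence of module categories an equivalence relation. *)
Lemma modcat_equivP (M N : modcat C) :
  modcat_equiv M N <-> exists W : corr M N, ctotal W.
Proof.
split=> [[Phi [G [eta [eps [e1 e2 e3 e4]]]]]|[W]]; last exact: corr_modcat_equiv.
by exists (equiv_corr e1 e2 e3 e4); exact: equiv_corr_total.
Qed.

Lemma modcat_equiv_refl (M : modcat C) : modcat_equiv M M.
Proof.
have lI (X Y : M) : linear (fun f : hom X Y => f) by [].
pose I := @KFunctor k M M id (fun _ _ f => f) (fun _ => erefl) (fun _ _ _ _ _ => erefl) lI.
have iso1 (X : M) : is_iso (idm X) by exists (idm X); split; rewrite comp1m.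
have Phi : {Phi : modfunctor M M | mffun Phi = I}.
  unshelve eexists (@ModFunctor k C M M I (fun F X => idm (mact M F X)) _ _ _ _ _) => //=.
  - by move=> F X Y x; rewrite comp1m compm1.
  - by move=> F G f X; rewrite comp1m compm1.
  - by move=> G F X; rewrite fmor1 !compm1 comp1m.
  - by move=> X; rewrite comp1m.
case: Phi => Phi e; exists Phi; rewrite e.
exists I, (fun X => idm X), (fun X => idm X); split=> //=.
- by move=> X X' f; rewrite comp1m compm1.
- by move=> X X' f; rewrite comp1m compm1.
Qed.

Lemma stmodcat_equivalence : Equivalence (@stmodcat_equiv k C).
Proof.
split=> [M|M N /modcat_equivP[W tW]|L M N /modcat_equivP[U tU] /modcat_equivP[W tW]].
- exact: modcat_equiv_refl.
- by apply/modcat_equivP; exists (corr_sym W); exact: ctotal_sym.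
- by apply/modcat_equivP; exists (corr_trans U W); exact: ctotal_trans.
Qed.
End CorrEquivalence.

(** * Monoids in terms of elements *)

Lemma tmor_congr (k : fieldType) (C : kmoncat k) (P Q : tamb C) (u v : tmor P Q) :
  u = v -> forall (F G : C) (x : P F G), u F G x = v F G x.
Proof. by move=> ->. Qed.

Section Amul.
Variables (k : fieldType) (C : kmoncat k) (A : tmonoid C).

Definition amul (F H G : C) (a : A F H) (b : A H G) : A F G := tmul A F G (pure a b).
Definition aunit (F G : C) (f : hom F G) : A F G := tunit A F G f.

Lemma amulA (F H K G : C) (a : A F H) (b : A H K) (c : A K G) :
  amul (amul a b) c = amul a (amul b c).
Proof.
have := tmor_congr (tmulA A) (pure (P := A ◇ A) (pure a b : (A ◇ A) F K) c : ((A ◇ A) ◇ A) F G).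
by rewrite !tcompE diam_assocE !diam_morE.
Qed.

Lemma aunit_mul (F H G : C) (f : hom F H) (a : A H G) :
  amul (aunit f) a = pmap f (idm G) a.
Proof.
have := tmor_congr (tmul1l A) (pure (P := tone C) (f : tone C F H) a : (tone C ◇ A) F G).
by rewrite !tcompE diam_lunitE !diam_morE.
Qed.

Lemma amul_unit (F H G : C) (a : A F H) (g : hom H G) :
  amul a (aunit g) = pmap (idm F) g a.
Proof.
have := tmor_congr (tmul1r A) (pure (Q := tone C) a (g : tone C H G) : (A ◇ tone C) F G).
by rewrite !tcompE diam_runitE !diam_morE.
Qed.

Lemma amul_linl (F H G : C) (b : A H G) : linear (fun a : A F H => amul a b).
Proof. exact: (linear_comp (@tfun_lin _ _ _ _ (tmul A) F G) (pure_linl b)). Qed.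
Lemma amul_linr (F H G : C) (a : A F H) : linear (fun b : A H G => amul a b).
Proof. exact: (linear_comp (@tfun_lin _ _ _ _ (tmul A) F G) (pure_linr a)). Qed.

Lemma amul_tt (K F H G : C) (a : A F H) (b : A H G) :
  amul (tstr A K a) (tstr A K b) = tstr A K (amul a b).
Proof. by rewrite /amul -tfun_tt /= diam_tt_pure. Qed.

Lemma amul1 (F G : C) (a : A F G) : amul a (aunit (idm G)) = a.
Proof. by rewrite amul_unit pmap1. Qed.
Lemma amul1l (F G : C) (a : A F G) : amul (aunit (idm F)) a = a.
Proof. by rewrite aunit_mul pmap1. Qed.

Lemma aunit_tt (H F G : C) (f : hom F G) : tstr A H (aunit f) = aunit (idm H ⊠ f).
Proof. by rewrite /aunit -tfun_tt. Qed.

Lemma amul_pmap (F F' G G' : C) (f : hom F' F) (g : hom G G') (a : A F G) :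
  pmap f g a = amul (aunit f) (amul a (aunit g)).
Proof. by rewrite amul_unit aunit_mul pmap_lr. Qed.
End Amul.

Arguments aunit {k C} A {F G} f.

Lemma end_amul (k : fieldType) (C : kmoncat k) (M : modcat C) (X : M) (F H G : C)
    (b : end_monoid X F H) (c : end_monoid X H G) :
  amul b c = (c : hom (mact M H X) (mact M G X)) ∘ b.
Proof. exact: end_mul_pure. Qed.

(** Naturality in F and G follows from compatibility with the unit and the multiplication,
  see [mfwd_pmap]. *)
Record miso (k : fieldType) (C : kmoncat k) (A B : tmonoid C) := Miso {
  mfwd : forall F G, A F G -> B F G;
  mbwd : forall F G, B F G -> A F G;
  mfwdK : forall F G, cancel (@mfwd F G) (@mbwd F G);
  mbwdK : forall F G, cancel (@mbwd F G) (@mfwd F G);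
  mfwd_lin : forall F G, linear (@mfwd F G);
  mfwd_mul : forall F H G (a : A F H) (b : A H G),
    mfwd (amul a b) = amul (mfwd a) (mfwd b);
  mfwd_unit : forall F G (f : hom F G), mfwd (aunit A f) = aunit B f;
  mfwd_tt : forall H F G (a : A F G), mfwd (tstr A H a) = tstr B H (mfwd a)
}.

Section MisoTheory.
Variables (k : fieldType) (C : kmoncat k).

Definition miso_refl (A : tmonoid C) : miso A A.
Proof. by exists (fun _ _ a => a) (fun _ _ a => a). Defined.

Definition miso_sym (A B : tmonoid C) (u : miso A B) : miso B A.
Proof.
exists (mbwd u) (mfwd u).
- by move=> F G; exact: mbwdK.
- by move=> F G; exact: mfwdK.
- by move=> F G a x y; apply: (can_inj (@mfwdK _ _ _ _ u F G)); rewrite mfwd_lin !mbwdK.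
- by move=> F H G a b; apply: (can_inj (@mfwdK _ _ _ _ u F G)); rewrite mfwd_mul !mbwdK.
- by move=> F G f; apply: (can_inj (@mfwdK _ _ _ _ u F G)); rewrite mfwd_unit !mbwdK.
- by move=> H F G a; apply: (can_inj (@mfwdK _ _ _ _ u _ _)); rewrite mfwd_tt !mbwdK.
Defined.

Definition miso_trans (A B D : tmonoid C) (u : miso A B) (v : miso B D) : miso A D.
Proof.
exists (fun F G a => mfwd v (mfwd u a)) (fun F G a => mbwd u (mbwd v a)).
- by move=> F G a; rewrite !mfwdK.
- by move=> F G a; rewrite !mbwdK.
- by move=> F G a x y; rewrite !mfwd_lin.
- by move=> *; rewrite !mfwd_mul.
- by move=> *; rewrite !mfwd_unit.
- by move=> *; rewrite !mfwd_tt.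
Defined.

Lemma mfwd_pmap (A B : tmonoid C) (u : miso A B) (F F' G G' : C) (f : hom F' F)
    (g : hom G G') (a : A F G) : mfwd u (pmap f g a) = pmap f g (mfwd u a).
Proof. by rewrite !amul_pmap !mfwd_mul !mfwd_unit. Qed.

Definition corr_miso (M N : modcat C) (W : corr M N) (X : M) (X' : N) (u : corel W X X') :
  miso (end_monoid X) (end_monoid X').
Proof.
exists (fun F G (x : end_monoid X F G) => cfwd (cact F u) (cact G u) x : end_monoid X' F G)
       (fun F G x => cbwd (cact F u) (cact G u) x) => /=.
- by move=> F G; exact: cfwdK.
- by move=> F G; exact: cbwdK.
- by move=> F G; exact: cfwd_lin.
- by move=> F H G a b; rewrite !end_amul; exact: cfwdM.
- by move=> F G f; exact: cfwd_act2.
- by move=> H F G a; exact: cfwd_end_tt.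
Defined.
End MisoTheory.

(** * Reconstruction of a module category from the monoid of a generator *)

Section Reconstruction.
Variables (k : fieldType) (C : kmoncat k).

Section Matching.
Variables (M N : modcat C) (X : M) (X' : N) (th : miso (end_monoid X) (end_monoid X')).

Let thc (F G : C) (x : hom (mact M F X) (mact M G X)) : hom (mact N F X') (mact N G X') :=
  mfwd th (x : end_monoid X F G).

Lemma miso_comp (F H G : C) (x : hom (mact M F X) (mact M H X))
    (y : hom (mact M H X) (mact M G X)) : thc (y ∘ x) = thc y ∘ thc x.
Proof. by rewrite /thc -!end_amul mfwd_mul. Qed.

Lemma miso_end_tt (H F G : C) (x : hom (mact M F X) (mact M G X)) :
  thc (end_tt H x) = end_tt H (thc x).
Proof. exact: (mfwd_tt th H (x : end_monoid X F G)). Qed.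

Lemma miso_mact2 (F G : C) (f : hom F G) : thc (mact2 f X) = mact2 f X'.
Proof. exact: (mfwd_unit th f). Qed.

(** Objects Y and Y' match when they are retracts of sums of the F_i.X and of the F_i.X',
  for the same F_i, cut out by idempotent matrices that correspond under th. Maps between
  matching objects are then absorbed matrices over [X,X] and over [X',X']. *)
Record matched (Y : M) (Y' : N) := Matched {
  midx : nat;
  mF : 'I_midx -> C;
  msec : forall i, hom Y (mact M (mF i) X);
  mret : forall i, hom (mact M (mF i) X) Y;
  msec' : forall i, hom Y' (mact N (mF i) X');
  mret' : forall i, hom (mact N (mF i) X') Y';
  mid : \sum_i mret i ∘ msec i = idm Y;
  mid' : \sum_i mret' i ∘ msec' i = idm Y';
  mmatch : forall i j, mfwd th (msec j ∘ mret i : end_monoid X _ _) = msec' j ∘ mret' i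
}.

Arguments mF {Y Y'} m i.
Arguments msec {Y Y'} m i.
Arguments mret {Y Y'} m i.
Arguments msec' {Y Y'} m i.
Arguments mret' {Y Y'} m i.
Arguments mmatch {Y Y'} m i j.

Definition transfer Y Y' Z Z' (u : matched Y Y') (v : matched Z Z') (f : hom Y Z) :
    hom Y' Z' :=
  \sum_i \sum_j mret' v j
    ∘ (mfwd th (msec v j ∘ f ∘ mret u i : end_monoid X _ _) : hom (mact N _ X') (mact N _ X'))
    ∘ msec' u i.

(** Together with [matched_ext] this characterizes the transferred map by its matrix
  entries; every property of [transfer] is proved by comparing entries. *)
Lemma transfer_spec Y Y' Z Z' (u : matched Y Y') (v : matched Z Z') (f : hom Y Z) i j :
  msec' v j ∘ transfer u v f ∘ mret' u i = mfwd th (msec v j ∘ f ∘ mret u i : end_monoid X _ _).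
Proof.
rewrite /transfer comp_sumr comp_suml.
under eq_bigr => i' _.
  rewrite comp_sumr comp_suml.
  under eq_bigr => j' _.
    rewrite !compA -mmatch -(compA _ (msec' u i')) -mmatch.
    rewrite -(compA (mfwd th _)) -!end_amul -!mfwd_mul !end_amul.
    over.
  rewrite -(lin_sum (@mfwd_lin _ _ _ _ th _ _)).
  over.
rewrite -(lin_sum (@mfwd_lin _ _ _ _ th _ _)); congr (mfwd th _).
transitivity (\sum_i' (\sum_j' msec v j ∘ mret v j' ∘ (msec v j' ∘ (f ∘ mret u i' ∘ (msec u i' ∘ mret u i))))).
  by apply: eq_bigr => i' _; apply: eq_bigr => j' _; rewrite -!compA.
under eq_bigr => i' _ do rewrite (comp_resolve _ _ (mid v)) -compA (compA (mret u i')).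
by rewrite -comp_sumr -comp_sumr -comp_suml mid comp1m compA.
Qed.

Lemma matched_ext Y Y' Z Z' (u : matched Y Y') (v : matched Z Z') (g h : hom Y' Z') :
  (forall i j, msec' v j ∘ g ∘ mret' u i = msec' v j ∘ h ∘ mret' u i) -> g = h.
Proof.
move=> e; rewrite -[g]comp1m -[h]comp1m -(mid' v) !comp_suml; apply: eq_bigr => j _.
rewrite -[LHS]compm1 -[RHS]compm1 -(mid' u) !comp_sumr; apply: eq_bigr => i _.
rewrite -!compA (compA g) (compA (msec' v j) (g ∘ mret' u i)) (compA (msec' v j) g) e.
by rewrite !compA.
Qed.

Definition matched_act (F : C) Y Y' (u : matched Y Y') :
  matched (mact M F Y) (mact N F Y').
Proof.
exists (midx u) (fun i => F ⊗ mF u i)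
  (fun i => mmu F (mF u i) X ∘ fmor (mact M F) (msec u i))
  (fun i => fmor (mact M F) (mret u i) ∘ mmu' F (mF u i) X)
  (fun i => mmu F (mF u i) X' ∘ fmor (mact N F) (msec' u i))
  (fun i => fmor (mact N F) (mret' u i) ∘ mmu' F (mF u i) X').
- under eq_bigr => i _.
    by rewrite -compA (compA (mmu' _ _ _)) (mmuK _ _ _).1 comp1m -fmorM; over.
  by rewrite -fmor_sum mid fmor1.
- under eq_bigr => i _.
    by rewrite -compA (compA (mmu' _ _ _)) (mmuK _ _ _).1 comp1m -fmorM; over.
  by rewrite -fmor_sum mid' fmor1.
- by move=> i j; rewrite !sandwich_act -mmatch; exact: miso_end_tt.
Defined.

End Matching.

Arguments mF {M N X X' th Y Y'} m i.
Arguments msec {M N X X' th Y Y'} m i.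
Arguments mret {M N X X' th Y Y'} m i.
Arguments msec' {M N X X' th Y Y'} m i.
Arguments mret' {M N X X' th Y Y'} m i.
Arguments mmatch {M N X X' th Y Y'} m i j.
Arguments matched_ext {M N X X' th Y Y' Z Z'} u v {g h} _.


Section MatchingCorr.
Variables (M N : modcat C) (X : M) (X' : N) (th : miso (end_monoid X) (end_monoid X')).

Definition matched_flip Y Y' (u : matched th Y Y') : matched (miso_sym th) Y' Y.
Proof.
exists (midx u) (mF u) (msec' u) (mret' u) (msec u) (mret u).
- exact: mid'.
- exact: mid.
- move=> i j; rewrite -(mmatch u i j); exact: mfwdK.
Defined.

Lemma transferK Y Y' Z Z' (u : matched th Y Y') (v : matched th Z Z') :
  cancel (transfer u v) (transfer (matched_flip u) (matched_flip v)).
Proof.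
move=> f; apply: (matched_ext (matched_flip u) (matched_flip v)) => i j.
by rewrite transfer_spec /= transfer_spec mfwdK.
Qed.

Lemma transferVK Y Y' Z Z' (u : matched th Y Y') (v : matched th Z Z') :
  cancel (transfer (matched_flip u) (matched_flip v)) (transfer u v).
Proof.
move=> f; apply: (matched_ext u v) => i j; rewrite transfer_spec.
by rewrite (@transfer_spec _ _ _ _ (miso_sym th) _ _ _ _ (matched_flip u) (matched_flip v)) mbwdK.
Qed.

Definition matched_corr : corr M N.
Proof.
exists (matched th) (@transfer M N X X' th)
  (fun _ _ _ _ u v g => transfer (matched_flip u) (matched_flip v) g)
  (@matched_act M N X X' th).
- by move=> *; exact: transferK.
- by move=> *; exact: transferVK.
- move=> Y Y' Z Z' u v a f g; apply: (matched_ext u v) => i j.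
  rewrite transfer_spec comp_linr !comp_linl comp_linr mfwd_lin -!transfer_spec.
  by rewrite comp_linl.
- move=> Y Y' u; apply: (matched_ext u u) => i j.
  by rewrite transfer_spec !compm1 mmatch.
- move=> Y Y' Z Z' V V' u v w g f; apply: (matched_ext u w) => i l.
  rewrite transfer_spec -!compA (compA (msec' w l)) -(comp_resolve _ _ (mid' v)).
  under eq_bigr => j _.
    rewrite (compA (msec' v j)) !transfer_spec -end_amul -mfwd_mul end_amul.
    rewrite -(compA (msec v j)); over.
  rewrite -(lin_sum (@mfwd_lin _ _ _ _ th _ _)) (comp_resolve _ _ (mid v)).
  by rewrite !compA.
- move=> F Y Y' Z Z' u v f; apply: (matched_ext (matched_act F u) (matched_act F v)) => i j.
  rewrite transfer_spec /= -(compA (mmu _ _ _)) -fmorM sandwich_act.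
  rewrite -(compA (mmu _ _ X')) -fmorM sandwich_act transfer_spec.
  exact: miso_end_tt.
- move=> F G h Y Y' u; apply: (matched_ext (matched_act F u) (matched_act G u)) => i j.
  rewrite transfer_spec /= -!(compA _ (mact2 h _)) !sandwich_act2 -mmatch.
  by rewrite miso_comp miso_end_tt miso_mact2.
- move=> G F Y Y' u.
  apply: (matched_ext (matched_act G (matched_act F u)) (matched_act (G ⊗ F) u)) => i j.
  rewrite transfer_spec /= -!(compA _ (mmu G F _)) !sandwich_mu -mmatch.
  by rewrite miso_comp !miso_end_tt miso_mact2.
- move=> Y Y' u; apply: (matched_ext u (matched_act (munit C) u)) => i j.
  rewrite transfer_spec /= -!(compA _ (meta _)) !sandwich_eta -mmatch.
  by rewrite miso_comp miso_mact2.
Defined.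

(** Y' is the image of the idempotent matrix that presents Y, read in N through th. *)
Lemma matched_exists Y : gen X -> cauchy_complete N ->
  exists Y', inhabited (matched th Y Y').
Proof.
move=> gX ccN; have [n [Fs [a [b e]]]] := thruP (gX Y).
pose E i j : hom (mact N (Fs i) X') (mact N (Fs j) X') :=
  mfwd th (a j ∘ b i : end_monoid X _ _).
have [|Y' [a' [b' [ab' E']]]] := split_matrix ccN (e := E).
  move=> i l; rewrite /E.
  under eq_bigr => j _ do rewrite -miso_comp -compA.
  rewrite -(lin_sum (@mfwd_lin _ _ _ _ th _ _)) -comp_sumr; congr (mfwd th (_ ∘ _)).
  by under eq_bigr => j _ do rewrite compA; rewrite -comp_suml -e comp1m.
exists Y'; split; exists n Fs a b a' b' => // i j; by rewrite E'.
Qed.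
End MatchingCorr.

Lemma matched_total (M N : modcat C) (X : M) (X' : N)
    (th : miso (end_monoid X) (end_monoid X')) :
  cauchy_complete M -> cauchy_complete N -> gen X -> gen X' -> ctotal (matched_corr th).
Proof.
move=> ccM ccN gX gX'; split=> [Y|Y']; first exact: matched_exists.
have [Y [u]] := matched_exists (miso_sym th) Y' gX' ccM; exists Y; split.
exists (midx u) (mF u) (msec' u) (mret' u) (msec u) (mret u).
- exact: mid'.
- exact: mid.
- by move=> i j; rewrite -(mmatch u i j); exact: mbwdK.
Qed.

End Reconstruction.

(** * The Cauchy completion *)

Section CauchyCompletion.
Variables (k : fieldType) (N : kcat k).

(** Formal images of idempotent matrices. Maps are the matrices absorbed by the idempotents
  on both sides, so the identity is the idempotent itself. The indices form a list in a
  set, instead of an ordinal, so that direct sums are indexed by disjoint unions. *)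
Record cauob := CauOb {
  cI : Set;
  cs : seq cI;
  cY : cI -> N;
  ce : forall i j, hom (cY i) (cY j);
  ceK : forall i l, \sum_(j <- cs) ce j l ∘ ce i j = ce i l
}.

Definition cmatrix (A B : cauob) : lmodType k :=
  dprod (fun i : cI A => dprod (fun j : cI B => hom (cY i) (cY j)) : lmodType k).

Definition absorbed (A B : cauob) (x : cmatrix A B) : Prop :=
  (forall i l, \sum_(j <- cs A) x j l ∘ ce i j = x i l) /\
  (forall i l, \sum_(j <- cs B) ce j l ∘ x i j = x i l).

Lemma absorbed_subspace A B : subspace (@absorbed A B).
Proof.
split.
  split=> i l; under eq_bigr => j _ do rewrite ?comp0m ?compm0.
    by rewrite big1.
  by rewrite big1.
move=> a x y [xR xL] [yR yL]; split=> i l /=.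
  under eq_bigr => j _ do rewrite [X in X ∘ _](_ : _ = a *: x j l + y j l) // comp_linl.
  by rewrite big_split -scaler_sumr xR yR.
under eq_bigr => j _ do rewrite [X in _ ∘ X](_ : _ = a *: x i j + y i j) // comp_linr.
by rewrite big_split -scaler_sumr xL yL.
Qed.

Definition chom (A B : cauob) : lmodType k := subl (absorbed_subspace A B).
Definition cval (A B : cauob) (x : chom A B) i j : hom (cY i) (cY j) := subl_val x i j.

Lemma chom_ext A B (x y : chom A B) : (forall i j, cval x i j = cval y i j) -> x = y.
Proof.
by move=> e; apply: subl_inj; do 2 apply: functional_extensionality_dep => ?; exact: e.
Qed.

Lemma cval_lin A B i j : linear (fun x : chom A B => cval x i j).
Proof. by []. Qed.

Lemma chomR A B (x : chom A B) i l : \sum_(j <- cs A) cval x j l ∘ ce i j = cval x i l.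
Proof. exact: (proj2_sig x).1. Qed.
Lemma chomL A B (x : chom A B) i l : \sum_(j <- cs B) ce j l ∘ cval x i j = cval x i l.
Proof. exact: (proj2_sig x).2. Qed.

Lemma cid_absorbed A : absorbed (@ce A : cmatrix A A).
Proof. by split=> i l; exact: ceK. Qed.
Definition cidm A : chom A A := subl_mk _ (cid_absorbed A).

Definition ccomp_mx A B D (y : chom B D) (x : chom A B) : cmatrix A D :=
  fun i l => \sum_(j <- cs B) cval y j l ∘ cval x i j.

Lemma ccomp_absorbed A B D (y : chom B D) (x : chom A B) : absorbed (ccomp_mx y x).
Proof.
split=> i l; rewrite /ccomp_mx.
  under eq_bigr => j _ do rewrite comp_suml.
  rewrite exchange_big; apply: eq_bigr => m _ /=.
  under eq_bigr => j _ do rewrite -compA.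
  by rewrite -comp_sumr chomR.
under eq_bigr => j _ do rewrite comp_sumr.
rewrite exchange_big; apply: eq_bigr => m _ /=.
under eq_bigr => j _ do rewrite compA.
by rewrite -comp_suml chomL.
Qed.
Definition ccomp A B D (y : chom B D) (x : chom A B) : chom A D :=
  subl_mk _ (ccomp_absorbed y x).

Lemma ccompE A B D (y : chom B D) (x : chom A B) i l :
  cval (ccomp y x) i l = \sum_(j <- cs B) cval y j l ∘ cval x i j.
Proof. by []. Qed.

Definition cauchy : kcat k.
Proof.
exists cauob chom cidm ccomp.
- by move=> A B f; apply: chom_ext => i l; exact: chomL.
- by move=> A B f; apply: chom_ext => i l; exact: chomR.
- move=> A B D E h g f; apply: chom_ext => i l; rewrite !ccompE.
  under eq_bigr => j _ do rewrite ccompE comp_sumr.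
  under [RHS]eq_bigr => j _ do rewrite ccompE comp_suml.
  rewrite exchange_big; apply: eq_bigr => j _ /=; apply: eq_bigr => m _.
  by rewrite compA.
- move=> A B D f a g g'; apply: chom_ext => i l; rewrite cval_lin !ccompE.
  rewrite scaler_sumr -big_split; apply: eq_bigr => j _.
  by rewrite cval_lin comp_linl.
- move=> A B D g a f f'; apply: chom_ext => i l; rewrite cval_lin !ccompE.
  rewrite scaler_sumr -big_split; apply: eq_bigr => j _.
  by rewrite cval_lin comp_linr.
Defined.

Lemma cauchy_compE (A B D : cauchy) (y : hom B D) (x : hom A B) i l :
  cval (y ∘ x) i l = \sum_(j <- cs B) cval y j l ∘ cval x i j.
Proof. by []. Qed.

Lemma cval1 (A : cauchy) i j : cval (idm A) i j = ce i j.
Proof. by []. Qed.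

Lemma cvalD (A B : cauchy) (x y : hom A B) i j : cval (x + y) i j = cval x i j + cval y i j.
Proof. by []. Qed.

Definition cau_zero : cauob.
Proof.
by apply: (@CauOb Empty_set [::] (fun i => match i with end) (fun i => match i with end)); case.
Defined.

Section CauSum.
Variables A B : cauob.

Definition csum_ob (i : cI A + cI B) : N := match i with inl a => cY a | inr b => cY b end.

Definition csum_ce (i j : cI A + cI B) : hom (csum_ob i) (csum_ob j) :=
  match i, j with
  | inl a, inl a' => ce a a'
  | inr b, inr b' => ce b b'
  | _, _ => 0
  end.

Definition cau_sum : cauob.
Proof.
apply: (@CauOb (cI A + cI B)%type ([seq inl i | i <- cs A] ++ [seq inr i | i <- cs B])
  csum_ob csum_ce).
move=> [i|i] [l|l]; rewrite big_cat !big_map /=.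
- by rewrite ceK big1 ?addr0 // => j _; rewrite comp0m.
- by rewrite !big1 ?addr0 // => j _; rewrite ?comp0m ?compm0.
- by rewrite !big1 ?addr0 // => j _; rewrite ?comp0m ?compm0.
- by rewrite ceK big1 ?add0r // => j _; rewrite comp0m.
Defined.

Let inA : cmatrix A cau_sum :=
  fun i j => match j return hom (cY i) (csum_ob j) with inl a => ce i a | inr _ => 0 end.
Let inB : cmatrix B cau_sum :=
  fun i j => match j return hom (cY i) (csum_ob j) with inr b => ce i b | inl _ => 0 end.
Let prA : cmatrix cau_sum A :=
  fun j i => match j return hom (csum_ob j) (cY i) with inl a => ce a i | inr _ => 0 end.
Let prB : cmatrix cau_sum B :=
  fun j i => match j return hom (csum_ob j) (cY i) with inr b => ce b i | inl _ => 0 end.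

Lemma cau_sumP : is_direct_sum (pairf (A : cauchy) (B : cauchy)) (cau_sum : cauchy).
Proof.
have h1 : absorbed inA.
  split=> i [l|l]; rewrite /= ?big_cat ?big_map /= ?ceK //.
  - by rewrite big1 // => j _; rewrite comp0m.
  - by rewrite big1 ?addr0 // => j _; rewrite comp0m.
  - by rewrite !big1 ?addr0 // => j _; rewrite ?comp0m ?compm0.
have h2 : absorbed inB.
  split=> i [l|l]; rewrite /= ?big_cat ?big_map /= ?ceK //.
  - by rewrite big1 // => j _; rewrite comp0m.
  - by rewrite !big1 ?addr0 // => j _; rewrite ?comp0m ?compm0.
  - by rewrite big1 ?add0r // => j _; rewrite comp0m.
have h3 : absorbed prA.
  split=> [[i|i] l|[i|i] l]; rewrite /= ?big_cat ?big_map /= ?ceK //.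
  - by rewrite big1 ?addr0 // => j _; rewrite comp0m.
  - by rewrite !big1 ?addr0 // => j _; rewrite ?comp0m ?compm0.
  - by rewrite big1 // => j _; rewrite compm0.
have h4 : absorbed prB.
  split=> [[i|i] l|[i|i] l]; rewrite /= ?big_cat ?big_map /= ?ceK //.
  - by rewrite !big1 ?addr0 // => j _; rewrite ?comp0m ?compm0.
  - by rewrite big1 ?add0r // => j _; rewrite comp0m.
  - by rewrite big1 // => j _; rewrite compm0.
apply/direct_sum2P.
exists (subl_mk _ h1), (subl_mk _ h2), (subl_mk _ h3), (subl_mk _ h4).
split; apply: chom_ext => i l; rewrite ?cauchy_compE.
- by rewrite /= big_cat !big_map /= ceK big1 ?addr0 // => j _; rewrite comp0m.
- by rewrite /= big_cat !big_map /= ceK big1 ?add0r // => j _; rewrite comp0m.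
- by rewrite /= big_cat !big_map /= !big1 ?addr0 // => j _; rewrite ?comp0m ?compm0.
- by rewrite /= big_cat !big_map /= !big1 ?addr0 // => j _; rewrite ?comp0m ?compm0.
- rewrite cvalD !cauchy_compE; case: i l => [i|i] [l|l] /=; rewrite /cval /= ?ceK.
  + by rewrite big1 ?addr0 // => j _; rewrite comp0m.
  + by rewrite !big1 ?addr0 // => j _; rewrite ?comp0m ?compm0.
  + by rewrite !big1 ?addr0 // => j _; rewrite ?comp0m ?compm0.
  + by rewrite big1 ?add0r // => j _; rewrite comp0m.
Qed.
End CauSum.

Lemma cauchyP : cauchy_complete cauchy.
Proof.
split.
- exists cau_zero => A; split=> f; apply: chom_ext; first by move=> i [].
  by case.
- by move=> A B; exists (cau_sum A B); exact: cau_sumP.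
- move=> A e ee.
  have ceE i l : \sum_(j <- cs A) cval e j l ∘ cval e i j = cval e i l.
    by rewrite -cauchy_compE ee.
  pose B : cauob := CauOb ceE.
  have hr : absorbed (subl_val e : cmatrix A B) by split=> i l; [exact: (chomR e)|exact: ceE].
  have hs : absorbed (subl_val e : cmatrix B A) by split=> i l; [exact: ceE|exact: (chomL e)].
  exists B, (subl_mk _ hr), (subl_mk _ hs); split; apply: chom_ext => i l;
    rewrite cauchy_compE; exact: ceE.
Qed.
End CauchyCompletion.

Section CauchyFunctor.
Variables (k : fieldType) (N : kcat k).

Definition cau_app_ob (P : kfunctor N N) (A : cauob N) : cauob N.
Proof.
apply: (@CauOb _ N (cI A) (cs A) (fun i => P (cY i)) (fun i j => fmor P (ce i j))).
by move=> i l; under eq_bigr => j _ do rewrite -fmorM; rewrite -fmor_sum ceK.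
Defined.

Lemma cau_app_absorbed (P : kfunctor N N) (A B : cauob N) (x : chom A B) :
  absorbed (A := cau_app_ob P A) (B := cau_app_ob P B) (fun i j => fmor P (cval x i j)).
Proof.
split=> i l /=.
  by under eq_bigr => j _ do rewrite -fmorM; rewrite -fmor_sum chomR.
by under eq_bigr => j _ do rewrite -fmorM; rewrite -fmor_sum chomL.
Qed.

Definition cau_app (P : kfunctor N N) : kfunctor (cauchy N) (cauchy N).
Proof.
exists (cau_app_ob P) (fun A B x => subl_mk _ (cau_app_absorbed P x)).
- by move=> A; apply: chom_ext.
- move=> A B D g f; apply: chom_ext => i l.
  transitivity (fmor P (cval (g ∘ f) i l)) => //.
  rewrite !cauchy_compE fmor_sum; apply: eq_bigr => j _; exact: fmorM.
- by move=> A B a x y; apply: chom_ext => i l; exact: fmor_lin.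
Defined.

Lemma cau_appE (P : kfunctor N N) (A B : cauchy N) (x : hom A B) i j :
  cval (fmor (cau_app P) x) i j = fmor P (cval x i j).
Proof. by []. Qed.

(** A family of maps t_i that commutes with the idempotents, made into a map by
  absorbing the idempotent of the target. The reindexing c will always be the
  identity; it only spares the equality of index sets. *)
Section Diagonal.
Variables (A B : cauchy N) (c : cI A -> cI B) (hc : cs B = map c (cs A)).
Variable t : forall i, hom (cY i) (cY (c i)).
Hypothesis ht : forall i j, ce (c i) (c j) ∘ t i = t j ∘ ce i j.

Lemma cdiag_absorbed : absorbed (A := A) (B := B) (fun i l => ce (c i) l ∘ t i).
Proof.
split=> i l.
  under eq_bigr => j _ do rewrite -compA -ht compA.
  by rewrite -comp_suml -(big_map c xpredT (fun j => ce j l ∘ ce (c i) j)) -hc ceK.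
under eq_bigr => j _ do rewrite compA.
by rewrite -comp_suml ceK.
Qed.

Definition cdiag : hom A B := subl_mk _ cdiag_absorbed.

Lemma cdiagE i l : cval cdiag i l = ce (c i) l ∘ t i.
Proof. by []. Qed.

Lemma comp_cdiag (D : cauchy N) (y : hom B D) i l :
  cval (y ∘ cdiag) i l = cval y (c i) l ∘ t i.
Proof.
rewrite cauchy_compE; under eq_bigr => j _ do rewrite cdiagE compA.
by rewrite -comp_suml chomR.
Qed.

Lemma cdiag_comp (D : cauchy N) (x : hom D A) i l :
  cval (cdiag ∘ x) i (c l) = t l ∘ cval x i l.
Proof.
rewrite cauchy_compE; under eq_bigr => j _ do rewrite cdiagE ht -compA.
by rewrite -comp_sumr chomL.
Qed.
End Diagonal.
End CauchyFunctor.

Section CauchyModule.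
Variables (k : fieldType) (C : kmoncat k) (N : modcat C).

Let cact (F : C) := cau_app (mact N F).

Definition cau_act2 (F G : C) (f : hom F G) (A : cauchy N) : hom (cact F A) (cact G A).
Proof.
refine (@cdiag k N (cact F A) (cact G A) (fun i : cI A => i) (esym (map_id _)) 
  (fun i => mact2 f (cY (c := A) i)) _).
by move=> i j; rewrite /= mact2_nat.
Defined.

Definition cau_mu (G F : C) (A : cauchy N) : hom (cact G (cact F A)) (cact (G ⊗ F) A).
Proof.
refine (@cdiag k N (cact G (cact F A)) (cact (G ⊗ F) A) (fun i : cI A => i) (esym (map_id _))
  (fun i => mmu G F (cY (c := A) i)) _).
by move=> i j; rewrite /= mmu_nat.
Defined.

Definition cau_mu' (G F : C) (A : cauchy N) : hom (cact (G ⊗ F) A) (cact G (cact F A)).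
Proof.
refine (@cdiag k N (cact (G ⊗ F) A) (cact G (cact F A)) (fun i : cI A => i) (esym (map_id _))
  (fun i => mmu' G F (cY (c := A) i)) _).
by move=> i j; rewrite /= mmu'_nat.
Defined.

Definition cau_eta (A : cauchy N) : hom A (cact (munit C) A).
Proof.
refine (@cdiag k N (A) (cact (munit C) A) (fun i : cI A => i) (esym (map_id _))
  (fun i => meta (cY (c := A) i)) _).
by move=> i j; rewrite /= meta_nat.
Defined.

Definition cau_eta' (A : cauchy N) : hom (cact (munit C) A) A.
Proof.
refine (@cdiag k N (cact (munit C) A) (A) (fun i : cI A => i) (esym (map_id _))
  (fun i => meta' (cY (c := A) i)) _).
by move=> i j; rewrite /= meta'_nat.
Defined.

Lemma cau_act2E F G (f : hom F G) (A : cauchy N) i j :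
  cval (cau_act2 f A) i j = fmor (mact N G) (ce (c := A) i j) ∘ mact2 f (cY (c := A) i).
Proof. by []. Qed.
Lemma cau_muE G F (A : cauchy N) i j :
  cval (cau_mu G F A) i j = fmor (mact N (G ⊗ F)) (ce (c := A) i j) ∘ mmu G F (cY (c := A) i).
Proof. by []. Qed.
Lemma cau_etaE (A : cauchy N) i j :
  cval (cau_eta A) i j = fmor (mact N (munit C)) (ce (c := A) i j) ∘ meta (cY (c := A) i).
Proof. by []. Qed.

Lemma comp_act2 F G (f : hom F G) (A D : cauchy N) (y : hom (cact G A) D) i l :
  cval (y ∘ cau_act2 f A) i l = cval y i l ∘ mact2 f (cY (c := A) i).
Proof. exact: comp_cdiag. Qed.
Lemma act2_comp F G (f : hom F G) (A D : cauchy N) (x : hom D (cact F A)) i l :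
  cval (cau_act2 f A ∘ x) i l = mact2 f (cY (c := A) l) ∘ cval x i l.
Proof. exact: (@cdiag_comp _ _ (cact F A) (cact G A)). Qed.
Lemma comp_mu G F (A D : cauchy N) (y : hom (cact (G ⊗ F) A) D) i l :
  cval (y ∘ cau_mu G F A) i l = cval y i l ∘ mmu G F (cY (c := A) i).
Proof. exact: comp_cdiag. Qed.
Lemma mu_comp G F (A D : cauchy N) (x : hom D (cact G (cact F A))) i l :
  cval (cau_mu G F A ∘ x) i l = mmu G F (cY (c := A) l) ∘ cval x i l.
Proof. exact: (@cdiag_comp _ _ (cact G (cact F A)) (cact (G ⊗ F) A)). Qed.
Lemma comp_mu' G F (A D : cauchy N) (y : hom (cact G (cact F A)) D) i l :
  cval (y ∘ cau_mu' G F A) i l = cval y i l ∘ mmu' G F (cY (c := A) i).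
Proof. exact: comp_cdiag. Qed.
Lemma comp_eta (A D : cauchy N) (y : hom (cact (munit C) A) D) i l :
  cval (y ∘ cau_eta A) i l = cval y i l ∘ meta (cY (c := A) i).
Proof. exact: comp_cdiag. Qed.
Lemma eta_comp (A D : cauchy N) (x : hom D A) i l :
  cval (cau_eta A ∘ x) i l = meta (cY (c := A) l) ∘ cval x i l.
Proof. exact: (@cdiag_comp _ _ A (cact (munit C) A)). Qed.

Definition cauchy_mod : modcat C.
Proof.
exists (cauchy N) cact cau_act2 cau_mu cau_mu' cau_eta cau_eta'.
- move=> F G f A B x; apply: chom_ext => i l.
  rewrite act2_comp comp_act2 !cau_appE; exact: mact2_nat.
- by move=> F A; apply: chom_ext => i l; rewrite cau_act2E mact2_1 compm1.
- move=> F G H g f A; apply: chom_ext => i l.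
  by rewrite act2_comp !cau_act2E mact2_M !compA mact2_nat.
- move=> F G A a f g; apply: chom_ext => i l.
  by rewrite cval_lin !cau_act2E mact2_lin comp_linr.
- move=> G F A; split; apply: chom_ext => i l.
    by rewrite comp_mu cdiagE -compA (mmuK _ _ _).1 compm1.
  by rewrite mu_comp cdiagE /= -mmu'_nat compA (mmuK _ _ _).2 comp1m.
- move=> G F A B x; apply: chom_ext => i l.
  rewrite mu_comp comp_mu !cau_appE; exact: mmu_nat.
- move=> G G' F F' g f A; apply: chom_ext => i l.
  rewrite mu_comp comp_act2 comp_mu cau_act2E cau_appE cau_act2E -compA -mmu_nat2.
  by rewrite !fmorM !compA mmu_nat.
- move=> A; split; apply: chom_ext => i l.
    by rewrite comp_eta cdiagE -compA (metaK _).1 compm1.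
  by rewrite eta_comp cdiagE -meta'_nat compA (metaK _).2 comp1m.
- move=> A B x; apply: chom_ext => i l.
  rewrite eta_comp comp_eta !cau_appE; exact: meta_nat.
- move=> H G F A; apply: chom_ext => i l.
  rewrite act2_comp !mu_comp cau_appE !cau_muE /= -!mmu_nat fmorM !compA.
  by congr (_ ∘ _); rewrite -compA mmuA.
- move=> F A; apply: chom_ext => i l.
  rewrite act2_comp mu_comp cau_etaE /= -meta_nat !compA -(compA (mact2 _ _)).
  by rewrite mmu1l comp1m.
- move=> F A; apply: chom_ext => i l.
  rewrite act2_comp mu_comp cau_appE cau_etaE /= -meta_nat fmorM !compA.
  by rewrite -(compA (mact2 _ _)) mmu1r comp1m.
Defined.

Section Embedding.
Variable X : N.

Definition cau_emb : cauchy_mod.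
Proof.
apply: (@CauOb k N unit [:: tt] (fun _ => X) (fun _ _ => idm X)).
by move=> _ _; rewrite big_seq1 comp1m.
Defined.

Lemma cau_emb_absorbed (F G : C) (x : hom (mact N F X) (mact N G X)) :
  absorbed (A := mact cauchy_mod F cau_emb) (B := mact cauchy_mod G cau_emb) (fun _ _ => x).
Proof. by split=> i l; rewrite big_seq1 /= fmor1 ?compm1 ?comp1m. Qed.

Definition cau_emb_hom (F G : C) (x : hom (mact N F X) (mact N G X)) :
    hom (mact cauchy_mod F cau_emb) (mact cauchy_mod G cau_emb) :=
  subl_mk _ (cau_emb_absorbed x).

Definition cau_emb_miso : miso (end_monoid X) (end_monoid cau_emb).
Proof.
exists (fun F G (x : end_monoid X F G) => cau_emb_hom x : end_monoid cau_emb F G)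
  (fun F G (y : end_monoid cau_emb F G) => cval y tt tt : end_monoid X F G).
- by [].
- by move=> F G y; apply: chom_ext => [[] []].
- by move=> F G a x y; apply: chom_ext => [[] []].
- move=> F H G a b; apply: chom_ext => [[] []]; rewrite !end_amul.
  by rewrite cauchy_compE big_seq1.
- move=> F G f; apply: chom_ext => [[] []].
  by rewrite [RHS](_ : _ = fmor (mact N G) (idm X) ∘ mact2 f X) // fmor1 comp1m.
- move=> H F G x; apply: chom_ext => [[] []]; symmetry.
  apply: (etrans (comp_mu' (A := cau_emb) (cau_mu H G cau_emb ∘ fmor (cact H) (cau_emb_hom x)) tt tt)).
  by congr (_ ∘ _); rewrite mu_comp cau_appE.
Defined.

(** The identity of the image of an idempotent matrix e is e, which is the sum over i of
  its products e(i,-) e(-,i); each of these factors through the object Y_i, so through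
  sums of objects F.X. *)
Lemma gen_cau_emb : gen X -> gen cau_emb.
Proof.
move=> gX A.
have col_absorbed F (i : cI A) (a : hom (cY i) (mact N F X)) :
    absorbed (A := A) (B := mact cauchy_mod F cau_emb) (fun j _ => a ∘ ce j i).
  split=> j l /=; last by rewrite big_seq1 fmor1 comp1m.
  by under eq_bigr => m _ do rewrite -compA; rewrite -comp_sumr ceK.
have row_absorbed F (i : cI A) (b : hom (mact N F X) (cY i)) :
    absorbed (A := mact cauchy_mod F cau_emb) (B := A) (fun _ j => ce i j ∘ b).
  split=> j l /=; first by rewrite big_seq1 fmor1 compm1.
  by under eq_bigr => m _ do rewrite compA; rewrite -comp_suml ceK.
have corner_absorbed i (f : hom (cY (c := A) i) (cY i)) :
    absorbed (A := A) (B := A) (fun j l => ce i l ∘ f ∘ ce j i).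
  split=> j l /=.
    by under eq_bigr => m _ do rewrite -compA; rewrite -comp_sumr ceK.
  by under eq_bigr => m _ do rewrite -compA compA; rewrite -comp_suml ceK compA.
pose corner i f : hom A A := subl_mk _ (corner_absorbed i f).
have corner_thru i f : thru X f -> thru cau_emb (corner i f).
  elim=> [|F a b g _ IH].
    rewrite (_ : corner i 0 = 0); first exact: thru0.
    by apply: chom_ext => j l; rewrite /cval /= compm0 comp0m.
  pose row : hom (mact cauchy_mod F cau_emb) A := subl_mk _ (row_absorbed F i b).
  pose col : hom A (mact cauchy_mod F cau_emb) := subl_mk _ (col_absorbed F i a).
  rewrite (_ : corner i _ = row ∘ col + corner i g); first exact: thruD.
  apply: chom_ext => j l; rewrite cvalD cauchy_compE big_seq1 /cval /=.
  by rewrite compmD compDm !compA.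
rewrite (_ : idm A = \sum_(i <- cs A) corner i (idm (cY i))).
  elim/big_ind: _ => [|f g|i _]; [exact: thru0|exact: thru_add|].
  by apply: corner_thru; exact: gX.
apply: chom_ext => j l; rewrite (lin_sum (@cval_lin _ _ A A j l)) cval1 -ceK.
by apply: eq_bigr => i _; rewrite /cval /= compm1.
Qed.
End Embedding.
End CauchyModule.

(** * Bimodules in terms of elements *)

Section BimoduleElements.
Variables (k : fieldType) (C : kmoncat k) (A B : tmonoid C) (P : bimod A B).

Definition lmul (F H G : C) (a : A F H) (p : P H G) : P F G := lact P F G (pure a p).
Definition rmul (F H G : C) (p : P F H) (b : B H G) : P F G := ract P F G (pure p b).

Lemma lmul_linl (F H G : C) (p : P H G) : linear (fun a : A F H => lmul a p).
Proof. exact: (linear_comp (@tfun_lin _ _ _ _ (lact P) F G) (pure_linl p)). Qed.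
Lemma lmul_linr (F H G : C) (a : A F H) : linear (fun p : P H G => lmul a p).
Proof. exact: (linear_comp (@tfun_lin _ _ _ _ (lact P) F G) (pure_linr a)). Qed.
Lemma rmul_linl (F H G : C) (b : B H G) : linear (fun p : P F H => rmul p b).
Proof. exact: (linear_comp (@tfun_lin _ _ _ _ (ract P) F G) (pure_linl b)). Qed.
Lemma rmul_linr (F H G : C) (p : P F H) : linear (fun b : B H G => rmul p b).
Proof. exact: (linear_comp (@tfun_lin _ _ _ _ (ract P) F G) (pure_linr p)). Qed.

Lemma lmulA (F H K G : C) (a : A F H) (a' : A H K) (p : P K G) :
  lmul (amul a a') p = lmul a (lmul a' p).
Proof.
have := tmor_congr (lactA P) (pure (P := A ◇ A) (pure a a' : (A ◇ A) F K) p : ((A ◇ A) ◇ P) F G).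
by rewrite !tcompE diam_assocE !diam_morE.
Qed.

Lemma rmulA (F H K G : C) (p : P F H) (b : B H K) (b' : B K G) :
  rmul (rmul p b) b' = rmul p (amul b b').
Proof.
have := tmor_congr (ractA P) (pure (P := P ◇ B) (pure p b : (P ◇ B) F K) b' : ((P ◇ B) ◇ B) F G).
by rewrite !tcompE diam_assocE !diam_morE.
Qed.

Lemma lrmulA (F H K G : C) (a : A F H) (p : P H K) (b : B K G) :
  rmul (lmul a p) b = lmul a (rmul p b).
Proof.
have := tmor_congr (lractA P) (pure (P := A ◇ P) (pure a p : (A ◇ P) F K) b : ((A ◇ P) ◇ B) F G).
by rewrite !tcompE diam_assocE !diam_morE.
Qed.

Lemma aunit_lmul (F H G : C) (f : hom F H) (p : P H G) :
  lmul (aunit A f) p = pmap f (idm G) p.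
Proof.
have := tmor_congr (lact1 P) (pure (P := tone C) (f : tone C F H) p : (tone C ◇ P) F G).
by rewrite !tcompE diam_lunitE !diam_morE.
Qed.

Lemma rmul_unit (F H G : C) (p : P F H) (g : hom H G) :
  rmul p (aunit B g) = pmap (idm F) g p.
Proof.
have := tmor_congr (ract1 P) (pure (Q := tone C) p (g : tone C H G) : (P ◇ tone C) F G).
by rewrite !tcompE diam_runitE !diam_morE.
Qed.

Lemma lmul1 (F G : C) (p : P F G) : lmul (aunit A (idm F)) p = p.
Proof. by rewrite aunit_lmul pmap1. Qed.
Lemma rmul1 (F G : C) (p : P F G) : rmul p (aunit B (idm G)) = p.
Proof. by rewrite rmul_unit pmap1. Qed.

Lemma lmul_tt (K F H G : C) (a : A F H) (p : P H G) :
  lmul (tstr A K a) (tstr P K p) = tstr P K (lmul a p).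
Proof. by rewrite /lmul -tfun_tt /= diam_tt_pure. Qed.
Lemma rmul_tt (K F H G : C) (p : P F H) (b : B H G) :
  rmul (tstr P K p) (tstr B K b) = tstr P K (rmul p b).
Proof. by rewrite /rmul -tfun_tt /= diam_tt_pure. Qed.

Lemma bimod_pmap (F F' G G' : C) (f : hom F' F) (g : hom G G') (p : P F G) :
  pmap f g p = lmul (aunit A f) (rmul p (aunit B g)).
Proof. by rewrite rmul_unit aunit_lmul pmap_lr. Qed.
End BimoduleElements.

Lemma lmul_regular k (C : kmoncat k) (A : tmonoid C) (F H G : C) (a : A F H) (b : A H G) :
  lmul (P := regular A) a b = amul a b.
Proof. by []. Qed.
Lemma rmul_regular k (C : kmoncat k) (A : tmonoid C) (F H G : C) (a : A F H) (b : A H G) :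
  rmul (P := regular A) a b = amul a b.
Proof. by []. Qed.

Section BimoduleMorphisms.
Variables (k : fieldType) (C : kmoncat k) (A B : tmonoid C) (P Q : bimod A B).

Lemma bimod_morP (u : tmor P Q) : is_bimod_mor u <->
  (forall (F H G : C) (a : A F H) (p : P H G), u F G (lmul a p) = lmul a (u H G p)) /\
  (forall (F H G : C) (p : P F H) (b : B H G), u F G (rmul p b) = rmul (u F H p) b).
Proof.
split=> [[e e']|[e e']]; split.
- move=> F H G a p; have := tmor_congr e (pure a p : (A ◇ P) F G).
  by rewrite !tcompE diam_morE.
- move=> F H G p b; have := tmor_congr e' (pure p b : (P ◇ B) F G).
  by rewrite !tcompE diam_morE.
- by apply: diam_ext => F H G a p; rewrite !tcompE diam_morE; exact: e.
- by apply: diam_ext => F H G p b; rewrite !tcompE diam_morE; exact: e'.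
Qed.

(** A bimodule map is automatically natural, so only linearity, compatibility with the
  actions and with the Tambara structures have to be provided. *)
Definition bimod_tmor (u : forall F G : C, P F G -> Q F G)
    (ul : forall F G, linear (u F G))
    (uL : forall (F H G : C) (a : A F H) (p : P H G), u F G (lmul a p) = lmul a (u H G p))
    (uR : forall (F H G : C) (p : P F H) (b : B H G), u F G (rmul p b) = rmul (u F H p) b)
    (ut : forall (H F G : C) (p : P F G), u _ _ (tstr P H p) = tstr Q H (u F G p)) :
  tmor P Q.
Proof.
exists u => //.
by move=> F F' G G' f g p; rewrite !bimod_pmap uL uR.
Defined.

End BimoduleMorphisms.

Lemma bijective_bimod_iso (k : fieldType) (C : kmoncat k) (A B : tmonoid C)
    (P Q : bimod A B) (u : tmor P Q) : is_bimod_mor u ->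
  (forall F G : C, injective (u F G)) -> (forall (F G : C) q, exists p, u F G p = q) ->
  is_bimod_iso u.
Proof.
move=> mu inju surju; split=> //; have [uL uR] := (bimod_morP u).1 mu.
pose v (F G : C) (q : Q F G) : P F G := projT1 (cid (surju F G q)).
have uv F G q : u F G (v F G q) = q := projT2 (cid (surju F G q)).
have vl F G : linear (v F G).
  by move=> a x y; apply: (inju F G); rewrite (@tfun_lin _ _ _ _ u F G) !uv.
have vL F H G (a : A F H) (q : Q H G) : v F G (lmul a q) = lmul a (v H G q).
  by apply: (inju F G); rewrite uL !uv.
have vR F H G (q : Q F H) (b : B H G) : v F G (rmul q b) = rmul (v F H q) b.
  by apply: (inju F G); rewrite uR !uv.
have vt H F G (q : Q F G) : v _ _ (tstr Q H q) = tstr P H (v F G q).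
  by apply: inju; rewrite tfun_tt !uv.
exists (bimod_tmor vl vL vR vt); split; first exact/bimod_morP.
  by apply: tmor_eq => F G x; apply: (inju F G); rewrite tcompE; exact: uv.
by apply: tmor_eq => F G x; rewrite tcompE; exact: uv.
Qed.

(** Dinaturality and naturality of the two actions follow from the unit laws, because
  C-morphisms act through the units of A and B. *)
Section BimoduleConstruction.
Variables (k : fieldType) (C : kmoncat k) (A B : tmonoid C) (P : tamb C).
Variable l : forall F H G : C, A F H -> P H G -> P F G.
Variable r : forall F H G : C, P F H -> B H G -> P F G.
Hypothesis l_linl : forall F H G (p : P H G), linear (fun a : A F H => l a p).
Hypothesis l_linr : forall F H G (a : A F H), linear (fun p : P H G => l a p).
Hypothesis r_linl : forall F H G (b : B H G), linear (fun p : P F H => r p b).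
Hypothesis r_linr : forall F H G (p : P F H), linear (fun b : B H G => r p b).
Hypothesis lA : forall F H K G (a : A F H) (a' : A H K) (p : P K G),
  l (amul a a') p = l a (l a' p).
Hypothesis rA : forall F H K G (p : P F H) (b : B H K) (b' : B K G),
  r (r p b) b' = r p (amul b b').
Hypothesis lrA : forall F H K G (a : A F H) (p : P H K) (b : B K G),
  r (l a p) b = l a (r p b).
Hypothesis l_unit : forall F H G (f : hom F H) (p : P H G),
  l (aunit A f) p = pmap f (idm G) p.
Hypothesis r_unit : forall F H G (p : P F H) (g : hom H G),
  r p (aunit B g) = pmap (idm F) g p.
Hypothesis l_tt : forall K F H G (a : A F H) (p : P H G),
  l (tstr A K a) (tstr P K p) = tstr P K (l a p).
Hypothesis r_tt : forall K F H G (p : P F H) (b : B H G),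
  r (tstr P K p) (tstr B K b) = tstr P K (r p b).

Let l_dinat F G H H' (h : hom H H') (a : A F H) (p : P H' G) :
  l (pmap (idm F) h a) p = l a (pmap h (idm G) p).
Proof. by rewrite -amul_unit lA l_unit. Qed.
Let r_dinat F G H H' (h : hom H H') (p : P F H) (b : B H' G) :
  r (pmap (idm F) h p) b = r p (pmap h (idm G) b).
Proof. by rewrite -r_unit rA aunit_mul. Qed.
Let l_nat F F' G G' H (f : hom F' F) (g : hom G G') (a : A F H) (p : P H G) :
  l (pmap f (idm H) a) (pmap (idm H) g p) = pmap f g (l a p).
Proof. by rewrite -aunit_mul lA l_unit -r_unit -lrA r_unit pmap_lr. Qed.
Let r_nat F F' G G' H (f : hom F' F) (g : hom G G') (p : P F H) (b : B H G) :
  r (pmap f (idm H) p) (pmap (idm H) g b) = pmap f g (r p b).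
Proof. by rewrite -amul_unit -rA r_unit -l_unit lrA l_unit pmap_rl. Qed.

Let Lact : tmor (A ◇ P) P := diam_lift l_linl l_linr l_dinat l_nat (fun F H G K => @l_tt K F H G).
Let Ract : tmor (P ◇ B) P := diam_lift r_linl r_linr r_dinat r_nat (fun F H G K => @r_tt K F H G).

Let LactE F H G (a : A F H) (p : P H G) : Lact F G (pure a p) = l a p.
Proof. by rewrite /= diam_lift_pure. Qed.
Let RactE F H G (p : P F H) (b : B H G) : Ract F G (pure p b) = r p b.
Proof. by rewrite /= diam_lift_pure. Qed.

Definition mk_bimod : bimod A B.
Proof.
exists P Lact Ract.
- by apply: diam_ext3 => *; rewrite !tcompE diam_assocE !diam_morE !LactE -lA.
- by apply: diam_ext => *; rewrite !tcompE diam_lunitE !diam_morE !LactE -l_unit.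
- by apply: diam_ext3 => *; rewrite !tcompE diam_assocE !diam_morE !RactE rA.
- by apply: diam_ext => *; rewrite !tcompE diam_runitE !diam_morE !RactE -r_unit.
- by apply: diam_ext3 => *; rewrite !tcompE diam_assocE !diam_morE !(RactE, LactE) -lrA.
Defined.

Lemma lmul_mk F H G (a : A F H) (p : P H G) : lmul (P := mk_bimod) a p = l a p.
Proof. exact: LactE. Qed.
Lemma rmul_mk F H G (p : P F H) (b : B H G) : rmul (P := mk_bimod) p b = r p b.
Proof. exact: RactE. Qed.
End BimoduleConstruction.

(** * Sub-bimodules and simple monoids *)

Section SubBimodule.
Variables (k : fieldType) (C : kmoncat k) (A B : tmonoid C) (S : bimod A B).

Record sub_bimod (K : forall F G : C, S F G -> Prop) : Prop := SubBimod {
  sbS : forall F G, subspace (K F G);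
  sbL : forall (F H G : C) (a : A F H) (x : S H G), K H G x -> K F G (lmul a x);
  sbR : forall (F H G : C) (x : S F H) (b : B H G), K F H x -> K F G (rmul x b);
  sbT : forall (H F G : C) (x : S F G), K F G x -> K _ _ (tstr S H x)
}.

Variables (K : forall F G : C, S F G -> Prop) (hK : sub_bimod K).

Let sub F G : lmodType k := subl (sbS hK F G).
Let mk F G (x : S F G) (Kx : K x) : sub F G := subl_mk (sbS hK F G) Kx.

Lemma sb_pmap (F F' G G' : C) (f : hom F' F) (g : hom G G') (x : S F G) :
  K x -> K (pmap f g x).
Proof. by move=> Kx; rewrite bimod_pmap; apply: (sbL hK); exact: (sbR hK). Qed.

Definition sub_prof : prof C.
Proof.
exists sub (fun F F' G G' f g (x : sub F G) => mk (sb_pmap f g (proj2_sig x))).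
- by move=> F F' G G' f g a x y; apply: subl_inj; exact: pmap_lin.
- by move=> F F' G G' g x a f f'; apply: subl_inj; exact: pmap_linl.
- by move=> F F' G G' f x a g g'; apply: subl_inj; exact: pmap_linr.
- by move=> F G x; apply: subl_inj; exact: pmap1.
- by move=> *; apply: subl_inj; exact: pmapM.
Defined.

Definition sub_tamb : tamb C.
Proof.
exists sub_prof (fun H F G (x : sub F G) => mk (sbT hK H (proj2_sig x))) => /=.
- by move=> H F G a x y; apply: subl_inj; exact: tstr_lin.
- by move=> *; apply: subl_inj; exact: tstr_nat.
- by move=> *; apply: subl_inj; exact: tstr_extra.
- by move=> *; apply: subl_inj; exact: tstr_assoc.
- by move=> *; apply: subl_inj; exact: tstr_unit.
Defined.

Definition sub_bim : bimod A B.
Proof.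
apply: (@mk_bimod k C A B sub_tamb
  (fun F H G a (x : sub H G) => mk (sbL hK a (proj2_sig x)))
  (fun F H G (x : sub F H) b => mk (sbR hK b (proj2_sig x)))).
- by move=> F H G x c a a'; apply: subl_inj; exact: lmul_linl.
- by move=> F H G a c x x'; apply: subl_inj; exact: lmul_linr.
- by move=> F H G b c x x'; apply: subl_inj; exact: rmul_linl.
- by move=> F H G x c b b'; apply: subl_inj; exact: rmul_linr.
- by move=> *; apply: subl_inj; exact: lmulA.
- by move=> *; apply: subl_inj; exact: rmulA.
- by move=> *; apply: subl_inj; exact: lrmulA.
- by move=> *; apply: subl_inj; exact: aunit_lmul.
- by move=> *; apply: subl_inj; exact: rmul_unit.
- by move=> *; apply: subl_inj; exact: lmul_tt.
- by move=> *; apply: subl_inj; exact: rmul_tt.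
Defined.

Definition sub_incl : tmor sub_bim S.
Proof. by exists (fun F G (x : sub F G) => subl_val x). Defined.

Lemma sub_incl_mor : is_bimod_mor sub_incl.
Proof. by apply/bimod_morP; split=> *; rewrite ?lmul_mk ?rmul_mk. Qed.

Lemma sub_incl_mono : is_bimod_mono sub_incl.
Proof.
split=> [|T v w _ _ e]; first exact: sub_incl_mor.
by apply: tmor_eq => F G x; apply: subl_inj; have := tmor_congr e x.
Qed.
End SubBimodule.

Definition tzero k (C : kmoncat k) (P Q : tamb C) : tmor P Q.
Proof.
exists (fun F G _ => 0).
- by move=> F G a x y; rewrite scaler0 addr0.
- by move=> *; rewrite (linear_0 (pmap_lin _ _ _)).
- by move=> H F G x; rewrite (linear_0 (@tstr_lin _ _ Q H F G)).
Defined.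

Lemma tzero_bimod k (C : kmoncat k) (A B : tmonoid C) (P Q : bimod A B) :
  is_bimod_mor (tzero P Q).
Proof.
apply/bimod_morP; split=> * /=.
  by rewrite (linear_0 (lmul_linr _)).
by rewrite (linear_0 (rmul_linl _)).
Qed.

(** The inclusion of the kernel and the zero map have the same composite with u. *)
Lemma bimod_mono_inj k (C : kmoncat k) (A B : tmonoid C) (P Q : bimod A B) (u : tmor P Q) :
  is_bimod_mono u -> forall (F G : C) (x : P F G), u F G x = 0 -> x = 0.
Proof.
move=> [mu uinj] F G x ux; have [uL uR] := (bimod_morP u).1 mu.
have hK : sub_bimod (fun F G (x : P F G) => u F G x = 0).
  split.
  - move=> F' G'; split; first exact: (linear_0 (@tfun_lin _ _ _ _ u F' G')).
    by move=> a y z ey ez; rewrite (@tfun_lin _ _ _ _ u) ey ez scaler0 addr0.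
  - by move=> F' H G' a y ey; rewrite uL ey (linear_0 (lmul_linr _)).
  - by move=> F' H G' y b ey; rewrite uR ey (linear_0 (rmul_linl _)).
  - by move=> H F' G' y ey; rewrite tfun_tt ey (linear_0 (@tstr_lin _ _ Q H F' G')).
have e : sub_incl hK = tzero _ _.
  apply: uinj; [exact: sub_incl_mor|exact: tzero_bimod|].
  apply: tmor_eq => F' G' y; rewrite !tcompE (linear_0 (@tfun_lin _ _ _ _ u F' G')).
  exact: (proj2_sig y).
exact: (tmor_congr e (subl_mk (sbS hK F G) ux)).
Qed.

(** Subobjects of the regular bimodule are its sub-bimodules: a sub-bimodule is the source
  of a monomorphism, and a monomorphism is determined by its image because it is
  injective. *)
Lemma simple_monoidP k (C : kmoncat k) (A : tmonoid C) : simple_monoid A <->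
  forall K : (forall F G : C, A F G -> Prop), sub_bimod (S := regular A) K ->
    (forall F G x, K F G x -> x = 0) \/ (forall F G x, K F G x).
Proof.
split=> [sA K hK|sA S u mu].
  have [[_ [v [_ _ uv]]]|S0] := sA _ _ (sub_incl_mono hK).
    right=> F G x; rewrite -[x](tmor_congr uv x) tcompE.
    exact: (proj2_sig (v F G x)).
  left=> F G x Kx; have := S0 F G (subl_mk (sbS hK F G) Kx).
  exact: (congr1 (@subl_val _ _ _ _)).
have [uL uR] := (bimod_morP u).1 mu.1.
have hK : sub_bimod (S := regular A) (fun F G x => exists y, u F G y = x).
  split.
  - move=> F G; split; first by exists 0; exact: (linear_0 (@tfun_lin _ _ _ _ u F G)).
    by move=> a _ _ [y <-] [z <-]; exists (a *: y + z); exact: (@tfun_lin _ _ _ _ u).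
  - by move=> F H G a _ [y <-]; exists (lmul a y).
  - by move=> F H G _ b [y <-]; exists (rmul y b).
  - by move=> H F G _ [y <-]; exists (tstr S H y); rewrite tfun_tt.
have [K0|K1] := sA _ hK; [right|left].
  by move=> F G x; apply: (bimod_mono_inj mu); apply: K0; exists x.
apply: bijective_bimod_iso => // [|F G x y e]; first by case: mu.
apply/eqP; rewrite -subr_eq0; apply/eqP; apply: (bimod_mono_inj mu).
by rewrite (linear_B (@tfun_lin _ _ _ _ u F G)) e subrr.
Qed.

Lemma miso_simple k (C : kmoncat k) (A B : tmonoid C) : miso A B ->
  simple_monoid A -> simple_monoid B.
Proof.
move=> th /simple_monoidP sA; apply/simple_monoidP => K hK.
have hK' : sub_bimod (S := regular A) (fun F G x => K F G (mfwd th x)).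
  split.
  - move=> F G; split; first by rewrite (linear_0 (@mfwd_lin _ _ _ _ th F G)); exact: sub0 (sbS hK F G).
    by move=> a x y Kx Ky; rewrite mfwd_lin; exact: (sub_lin (sbS hK F G)).
  - by move=> F H G a x Kx; rewrite lmul_regular mfwd_mul; exact: (sbL hK (mfwd th a)).
  - by move=> F H G x b Kx; rewrite rmul_regular mfwd_mul; exact: (sbR hK (mfwd th b)).
  - by move=> H F G x Kx; rewrite mfwd_tt; exact: (sbT hK H Kx).
have [K0|K1] := sA _ hK'; [left|right] => F G x.
  move=> Kx; rewrite -[x](mbwdK th) (K0 _ _ (mbwd th x)) ?mbwdK //.
  exact: (linear_0 (@mfwd_lin _ _ _ _ th F G)).
by rewrite -[x](mbwdK th).
Qed.

(** * Simple transitive module categories and simple monoids *)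

Section SimpleTransitive.
Variables (k : fieldType) (C : kmoncat k) (M : modcat C) (X : M).
Hypothesis gX : gen X.

(** Ideals of M correspond to sub-bimodules of [X,X]. The ideal of K consists of the maps
  all of whose restrictions to objects F.X, followed by maps to objects G.X, lie in K.
  That C preserves it uses the generator: a map is a sum of maps that factor through
  its restrictions. *)
Lemma end_simple : simple_transitive M -> simple_monoid (end_monoid X).
Proof.
move=> sM; apply/simple_monoidP => K hK.
have KL F H G (a : hom (mact M F X) (mact M H X)) (x : hom (mact M H X) (mact M G X)) :
    K H G x -> K F G (x ∘ a).
  by move=> Kx; rewrite -end_amul; exact: (sbL hK (a : end_monoid X F H) Kx).
have KR F H G (x : hom (mact M F X) (mact M H X)) (b : hom (mact M H X) (mact M G X)) :
    K F H x -> K F G (b ∘ x).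
  by move=> Kx; rewrite -end_amul; exact: (sbR hK (b : end_monoid X H G) Kx).
pose I Y Z (f : hom Y Z) := forall F G (a : hom (mact M F X) Y) (b : hom Z (mact M G X)),
  K F G (b ∘ f ∘ a).
have hI : is_ideal I.
  split.
  - by move=> Y Z F G a b; rewrite compm0 comp0m; exact: sub0 (sbS hK F G).
  - move=> Y Z c f g If Ig F G a b; rewrite comp_linr comp_linl.
    exact: (sub_lin (sbS hK F G)).
  - by move=> Y Z W V h g f Ig F G a b; rewrite !compA -(compA _ f); exact: Ig.
  - move=> H Y Z f If F G a b.
    have [n [Fs [p [i e]]]] := thruP (gX Y).
    have [m [Gs [q [j d]]]] := thruP (gX Z).
    (* H.f is the sum of the H.(j q f i p), and q f i lies in K *)
    rewrite -[f]compm1 e -[f]comp1m d comp_sumr fmor_sum comp_sumr comp_suml.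
    apply: (sub_sum (sbS hK F G)) => x; rewrite !comp_suml fmor_sum comp_sumr comp_suml.
    apply: (sub_sum (sbS hK F G)) => y.
    have Ky := sbT hK H (If _ _ (i x) (q y)).
    have -> : b ∘ fmor (mact M H) (j y ∘ q y ∘ f ∘ (i x ∘ p x)) ∘ a
      = (b ∘ fmor (mact M H) (j y) ∘ mmu' H (Gs y) X) ∘ end_tt H (q y ∘ f ∘ i x)
        ∘ (mmu H (Fs x) X ∘ fmor (mact M H) (p x) ∘ a).
      have eE := end_tt_mu H (q y ∘ f ∘ i x); move: (end_tt H _) eE => E eE.
      rewrite !compA -(compA _ E) eE !compA -(compA _ (mmu' _ _ _)) (mmuK _ _ _).1 compm1.
      by rewrite !fmorM !compA.
    by apply: KL; exact: KR.
have [I0|I1] := sM I hI; [left|right] => F G x.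
  by move=> Kx; apply/I0 => F' G' a b; apply: KL; exact: KR.
by rewrite -[x]comp1m -[_ ∘ x]compm1; exact: (I1 _ _ (x : hom (mact M F X) (mact M G X))).
Qed.

(** Restricting an ideal to the objects F.X gives a sub-bimodule. If the latter is zero, so
  is the ideal; if it contains the identities of the F.X, the ideal contains all maps. *)
Lemma simple_end : simple_monoid (end_monoid X) -> simple_transitive M.
Proof.
move=> /simple_monoidP sX I hI.
have ID Y Z (f g : hom Y Z) : I Y Z f -> I Y Z g -> I Y Z (f + g).
  by move=> If Ig; rewrite -[f]scale1r; exact: (ideal_lin hI).
have Isum Y Z n (f : 'I_n -> hom Y Z) : (forall i, I Y Z (f i)) -> I Y Z (\sum_(i < n) f i).
  by move=> If; elim/big_ind: _ => //; [exact: (ideal0 hI)|exact: ID].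
have hK : sub_bimod (S := regular (end_monoid X))
    (fun F G (x : hom (mact M F X) (mact M G X)) => I _ _ x).
  split.
  - by move=> F G; split; [exact: (ideal0 hI)|exact: (ideal_lin hI)].
  - move=> F H G a x Ix; rewrite lmul_regular end_amul -[X in I _ _ (X ∘ _)]comp1m.
    exact: (ideal_comp hI).
  - move=> F H G x b Ix; rewrite rmul_regular end_amul -[X in I _ _ X]compm1.
    exact: (ideal_comp hI).
  - by move=> H F G x Ix; apply: (ideal_comp hI); exact: (ideal_act hI).
have [K0|K1] := sX _ hK; [left|right] => Y Z f; have [n [Fs [p [i e]]]] := thruP (gX Y).
  have [m [Gs [q [j d]]]] := thruP (gX Z).
  split=> [If|->]; last exact: (ideal0 hI).
  rewrite -[f]compm1 e -[f]comp1m d comp_sumr big1 // => x _.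
  rewrite !comp_suml big1 // => y _.
  have q0 : q y ∘ f ∘ i x = 0 by apply: K0; exact: (ideal_comp hI).
  by rewrite compA -!(compA (j y)) q0 comp0m compm0.
rewrite -[f]compm1 e comp_sumr; apply: Isum => x.
by rewrite -[i x]compm1 !compA; apply: (ideal_comp hI); exact: K1.
Qed.
End SimpleTransitive.

(** * Coherence of the unit constraints *)

Section Coherence.
Variables (k : fieldType) (C : kmoncat k).
Implicit Types F G H : C.

Lemma tens_munit_faithful F G (f g : hom F G) : idm (munit C) ⊠ f = idm (munit C) ⊠ g -> f = g.
Proof.
move=> e; rewrite -[f]compm1 -[g]compm1 -(lunitK F).2 !compA -!lunit_nat.
by rewrite e.
Qed.

Lemma munit_tens_faithful F G (f g : hom F G) : f ⊠ idm (munit C) = g ⊠ idm (munit C) -> f = g.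
Proof.
move=> e; rewrite -[f]compm1 -[g]compm1 -(runitK F).2 !compA -!runit_nat.
by rewrite e.
Qed.

Lemma tens_compr F G G' G'' (g' : hom G' G'') (g : hom G G') :
  idm F ⊠ (g' ∘ g) = (idm F ⊠ g') ∘ (idm F ⊠ g).
Proof. by rewrite -tensmM comp1m. Qed.
Lemma tens_compl F F' F'' G (f' : hom F' F'') (f : hom F F') :
  (f' ∘ f) ⊠ idm G = (f' ⊠ idm G) ∘ (f ⊠ idm G).
Proof. by rewrite -tensmM comp1m. Qed.

Lemma assoc_epi F G H K (f g : hom (F ⊗ (G ⊗ H)) K) :
  f ∘ assoc F G H = g ∘ assoc F G H -> f = g.
Proof. by move=> e; rewrite -[f]compm1 -[g]compm1 -(assocK F G H).2 !compA e. Qed.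
Lemma assoc_monic F G H K (f g : hom K ((F ⊗ G) ⊗ H)) :
  assoc F G H ∘ f = assoc F G H ∘ g -> f = g.
Proof. by move=> e; rewrite -[f]comp1m -[g]comp1m -(assocK F G H).1 -!compA e. Qed.

(** Two of the coherence laws of Mac Lane that Kelly deduced from the pentagon and the
  triangle: both sides are compared after tensoring with the unit, which is faithful. *)
Lemma lunit_assoc F G : lunit (F ⊗ G) ∘ assoc (munit C) F G = lunit F ⊠ idm G.
Proof.
apply: tens_munit_faithful; apply: assoc_epi.
have epi K (f g : hom ((munit C ⊗ (munit C ⊗ F)) ⊗ G) K) :
    f ∘ (assoc (munit C) (munit C) F ⊠ idm G) = g ∘ (assoc (munit C) (munit C) F ⊠ idm G) ->
    f = g.
  move=> e; rewrite -[f]compm1 -[g]compm1 -tensm1 -(assocK _ _ _).2 tens_compl.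
  by rewrite !compA e.
apply: epi; rewrite tens_compr -!compA (compA (idm (munit C) ⊠ assoc _ _ _)).
rewrite pentagon compA triangle -tensm1 -assoc_nat.
rewrite (compA (idm _ ⊠ (lunit F ⊠ _))) -assoc_nat -compA -tens_compl triangle.
by [].
Qed.

Lemma assoc_runit F G : (idm F ⊠ runit G) ∘ assoc F G (munit C) = runit (F ⊗ G).
Proof.
apply: munit_tens_faithful; apply: assoc_monic.
rewrite tens_compl compA assoc_nat -[in RHS]triangle -tensm1.
rewrite [RHS]compA assoc_nat -[RHS]compA -pentagon.
by rewrite [RHS]compA (compA (idm F ⊠ (idm G ⊠ _))) -tens_compr triangle.
Qed.

Lemma runit'_assoc F G :
  assoc' F G (munit C) ∘ (idm F ⊠ runit' G) = runit' (F ⊗ G).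
Proof.
have e : (idm F ⊠ runit G) ∘ (idm F ⊠ runit' G) = idm (F ⊗ G).
  by rewrite -tens_compr (runitK G).2 tensm1.
rewrite -[LHS]comp1m -(runitK (F ⊗ G)).1 -assoc_runit -compA -(compA _ (assoc _ _ _)).
by rewrite (compA (assoc F G _)) (assocK F G _).2 comp1m e compm1.
Qed.

Lemma assoc'_nat F F' G G' H H' (f : hom F F') (g : hom G G') (h : hom H H') :
  assoc' F' G' H' ∘ (f ⊠ (g ⊠ h)) = ((f ⊠ g) ⊠ h) ∘ assoc' F G H.
Proof.
apply: assoc_monic; rewrite !compA (assocK _ _ _).2 comp1m assoc_nat -compA.
by rewrite (assocK _ _ _).2 compm1.
Qed.

Lemma pentagon' F G H K :
  (assoc F G H ⊠ idm K) ∘ (assoc' (F ⊗ G) H K ∘ assoc' F G (H ⊗ K))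
  = assoc' F (G ⊗ H) K ∘ (idm F ⊠ assoc' G H K).
Proof.
apply: assoc_monic; rewrite [RHS]compA (assocK _ _ _).2 comp1m.
have e : (idm F ⊠ assoc' G H K) ∘ (idm F ⊠ assoc G H K) = idm _.
  by rewrite -tens_compr (assocK _ _ _).1 tensm1.
rewrite -[LHS]comp1m -e -compA -[RHS]compm1; congr (_ ∘ _).
rewrite !compA pentagon -!compA (compA (assoc (F ⊗ G) _ _)) (assocK _ _ _).2 comp1m.
exact: (assocK _ _ _).2.
Qed.
End Coherence.

(** * Module categories from categories enriched in Tambara modules *)

(** A category enriched in Tambara modules, on a set I of objects. Naturality of the
  composition follows from the unit laws. A monoid is the case of one object; a Morita
  context is the case of two. *)
Record tcat (k : fieldType) (C : kmoncat k) (I : Type) := Tcat {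
  tT : I -> I -> tamb C;
  tm : forall i j l (F H G : C), tT i j F H -> tT j l H G -> tT i l F G;
  te : forall i, tmor (tone C) (tT i i);
  tm_linl : forall i j l (F H G : C) (y : tT j l H G),
    linear (fun x : tT i j F H => tm x y);
  tm_linr : forall i j l (F H G : C) (x : tT i j F H),
    linear (fun y : tT j l H G => tm x y);
  tmA : forall i j l m (F H K G : C) (x : tT i j F H) (y : tT j l H K) (z : tT l m K G),
    tm (tm x y) z = tm x (tm y z);
  te_l : forall i j (F H G : C) (f : hom F H) (x : tT i j H G),
    tm (te i F H f) x = pmap f (idm G) x;
  te_r : forall i j (F H G : C) (x : tT i j F H) (g : hom H G),
    tm x (te j H G g) = pmap (idm F) g x;
  tm_tt : forall i j l (K F H G : C) (x : tT i j F H) (y : tT j l H G),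
    tm (tstr (tT i j) K x) (tstr (tT j l) K y) = tstr (tT i l) K (tm x y)
}.

Section TcatModule.
Variables (k : fieldType) (C : kmoncat k) (I : Type) (T : tcat C I).

Lemma teM i (F H G : C) (f : hom F H) (g : hom H G) :
  tm (te T i F H f) (te T i H G g) = te T i F G (g ∘ f).
Proof. by rewrite te_r -tfun_nat /= compm1. Qed.

Lemma te_tt i (H F G : C) (f : hom F G) :
  tstr (tT T i i) H (te T i F G f) = te T i (H ⊗ F) (H ⊗ G) (idm H ⊠ f).
Proof. by rewrite -tfun_tt. Qed.

Definition tcat_cat : kcat k.
Proof.
exists (I * C)%type (fun X Y => tT T X.1 Y.1 X.2 Y.2) (fun X => te T X.1 X.2 X.2 (idm X.2))
  (fun X Y Z g f => tm f g).
- by move=> X Y f; rewrite te_r pmap1.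
- by move=> X Y f; rewrite te_l pmap1.
- by move=> X Y Z W h g f; rewrite tmA.
- by move=> X Y Z f; exact: tm_linr.
- by move=> X Y Z g; exact: tm_linl.
Defined.

Definition tcat_act (F : C) : kfunctor tcat_cat tcat_cat.
Proof.
exists (fun X => (X.1, F ⊗ X.2) : tcat_cat) (fun X Y x => tstr (tT T X.1 Y.1) F x).
- by move=> X /=; rewrite te_tt tensm1.
- by move=> X Y Z g f /=; rewrite tm_tt.
- by move=> X Y; exact: tstr_lin.
Defined.

(** The free module category on I: the objects are formal F.i, and C acts on maps by the
  Tambara structure. The laws of a Tambara module are the naturality laws of the action. *)
Definition tcat_mod : modcat C.
Proof.
exists tcat_cat tcat_act
  (fun F G f X => te T X.1 (F ⊗ X.2) (G ⊗ X.2) (f ⊠ idm X.2))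
  (fun G F X => te T X.1 _ _ (assoc' G F X.2))
  (fun G F X => te T X.1 _ _ (assoc G F X.2))
  (fun X => te T X.1 _ _ (lunit' X.2))
  (fun X => te T X.1 _ _ (lunit X.2)) => /=.
- by move=> F G f X Y x; rewrite te_r te_l tstr_extra.
- by move=> F X; rewrite tensm1.
- by move=> F G H g f X; rewrite teM tens_compl.
- move=> F G X a f g; rewrite tensm_linl; exact: tfun_lin.
- move=> G F X; split; rewrite /= teM.
    by rewrite (assocK _ _ _).2.
  by rewrite (assocK _ _ _).1.
- move=> G F X Y x; rewrite te_r te_l tstr_assoc -pmapM (assocK _ _ _).2 comp1m.
  by [].
- by move=> G G' F F' g f X; rewrite te_tt !teM -assoc'_nat -tensmM compm1 comp1m.
- move=> X; split; rewrite /= teM.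
    by rewrite (lunitK _).2.
  by rewrite (lunitK _).1.
- by move=> X Y x; rewrite te_r te_l tstr_unit -pmapM (lunitK _).2 comp1m.
- by move=> H G F X; rewrite te_tt !teM pentagon'.
- move=> F X; rewrite !teM -lunit_assoc -!compA (compA (assoc _ _ _)) (assocK _ _ _).2.
  by rewrite comp1m (lunitK _).2.
- move=> F X; rewrite te_tt !teM -triangle -!compA (compA (assoc _ _ _)) (assocK _ _ _).2.
  by rewrite comp1m -tens_compr (lunitK _).2 tensm1.
Defined.

Definition tcat_gen (i : I) : tcat_mod := (i, munit C).

Lemma tcat_thru i (F : C) : thru (tcat_gen i) (idm ((i, F) : tcat_mod)).
Proof.
have -> : idm ((i, F) : tcat_mod)
  = (te T i _ _ (runit F) : hom (mact tcat_mod F (tcat_gen i)) ((i, F) : tcat_mod))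
    ∘ (te T i _ _ (runit' F) : hom ((i, F) : tcat_mod) (mact tcat_mod F (tcat_gen i))).
  by rewrite /= teM (runitK F).2.
exact: thru1.
Qed.

Section EndTcat.
Variables (A : tmonoid C) (i : I).
Variables (phi : forall F G : C, A F G -> tT T i i F G).
Variables (psi : forall F G : C, tT T i i F G -> A F G).
Hypothesis phiK : forall F G : C, cancel (@phi F G) (@psi F G).
Hypothesis psiK : forall F G : C, cancel (@psi F G) (@phi F G).
Hypothesis phi_lin : forall F G : C, linear (@phi F G).
Hypothesis phiM : forall (F H G : C) (a : A F H) (b : A H G),
  phi (amul a b) = tm (phi a) (phi b).
Hypothesis phi_unit : forall (F G : C) (f : hom F G), phi (aunit A f) = te T i F G f.
Hypothesis phi_tt : forall (H F G : C) (a : A F G), phi (tstr A H a) = tstr _ H (phi a).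

Lemma te_pmap (F F' G G' : C) (f : hom F' F) (g : hom G G') (x : tT T i i F G) :
  pmap f g x = tm (te T i _ _ f) (tm x (te T i _ _ g)).
Proof. by rewrite te_r te_l pmap_lr. Qed.

(** In the module category, F.(1.i) is only isomorphic to F.i, through the right unit of C;
  compatibility with the Tambara structures needs [assoc_runit]. *)
Definition tcat_end : miso A (end_monoid (tcat_gen i)).
Proof.
exists (fun F G a => pmap (runit F) (runit' G) (phi a) : end_monoid (tcat_gen i) F G)
  (fun F G (x : end_monoid (tcat_gen i) F G) =>
     psi (pmap (runit' F) (runit G) (x : tT T i i (F ⊗ munit C) (G ⊗ munit C)))).
- by move=> F G a; rewrite -pmapM !(runitK _).2 pmap1 phiK.
- by move=> F G a; rewrite psiK -pmapM !(runitK _).1 pmap1.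
- by move=> F G a x y; rewrite phi_lin; exact: (pmap_lin (tT T i i) (runit F) (runit' G)).
- move=> F H G a b; rewrite end_amul phiM /= !te_pmap !tmA -(tmA (te _ _ _ _ (runit' H))).
  by rewrite teM (runitK _).2 [tm (te _ _ _ _ (idm _)) _]te_l pmap1.
- move=> F G f; rewrite phi_unit -tfun_nat /= /aunit /=; congr (te T i _ _ _).
  by rewrite -compA -runit_nat compA (runitK _).1 comp1m.
- move=> H F G a; rewrite phi_tt /= /end_tt /= te_r te_l tstr_nat -!pmapM.
  by rewrite !comp1m assoc_runit runit'_assoc.
Defined.
End EndTcat.
End TcatModule.

(** * Morita equivalence from two generators of one module category *)

Section Factor.
Variables (k : fieldType) (C : kmoncat k).

(** A surjective map of Tambara modules is the cokernel of its kernel, and naturality of the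
  factorization is inherited from q. *)
Lemma tmor_factor (P Q S : tamb C) (q : tmor P Q) (h : tmor P S) :
  (forall (F G : C) (y : Q F G), exists x, q F G x = y) ->
  (forall (F G : C) (x : P F G), q F G x = 0 -> h F G x = 0) ->
  exists! w : tmor Q S, w ∘t q = h.
Proof.
move=> sur ker.
pose s (F G : C) (y : Q F G) : P F G := projT1 (cid (sur F G y)).
have qs F G y : q F G (s F G y) = y := projT2 (cid (sur F G y)).
pose w (F G : C) (y : Q F G) : S F G := h F G (s F G y).
have wq F G x : w F G (q F G x) = h F G x.
  apply/eqP; rewrite -subr_eq0 -(linear_B (@tfun_lin _ _ _ _ h F G)); apply/eqP; apply: ker.
  by rewrite (linear_B (@tfun_lin _ _ _ _ q F G)) qs subrr.
have wl F G : linear (w F G).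
  move=> a y z; rewrite -[in LHS](qs _ _ y) -[in LHS](qs _ _ z).
  by rewrite -(@tfun_lin _ _ _ _ q F G) wq (@tfun_lin _ _ _ _ h F G).
have wn F F' G G' (f : hom F' F) (g : hom G G') y : w F' G' (pmap f g y) = pmap f g (w F G y).
  by rewrite -[in LHS](qs _ _ y) -tfun_nat wq tfun_nat.
have wt H F G y : w _ _ (tstr Q H y) = tstr S H (w F G y).
  by rewrite -[in LHS](qs _ _ y) -tfun_tt wq tfun_tt.
exists (TMor wl wn wt); split; first by apply: tmor_eq => F G x; rewrite tcompE; exact: wq.
move=> v e; apply: tmor_eq => F G y; rewrite -(qs _ _ y).
have := tmor_congr e (s F G y); rewrite tcompE => ->; exact: wq.
Qed.

Variables (A B D : tmonoid C) (M : bimod A B) (N : bimod B D).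

Definition balanced (S : tamb C) (h : tmor (M ◇ N) S) : Prop :=
  forall (F H K G : C) (m : M F H) (b : B H K) (n : N K G),
    h F G (pure (rmul m b) n) = h F G (pure m (lmul b n)).

Lemma balancedP (S : tamb C) (h : tmor (M ◇ N) S) : balanced h <->
  h ∘t diam_mor (ract M) (tid N) = h ∘t (diam_mor (tid M) (lact N) ∘t diam_assoc M B N).
Proof.
split=> [hb|e].
  by apply: diam_ext3 => F H K G m b n; rewrite !tcompE diam_assocE !diam_morE; exact: hb.
move=> F H K G m b n.
have := tmor_congr e (pure (P := M ◇ B) (pure m b : (M ◇ B) F K) n : ((M ◇ B) ◇ N) F G).
by rewrite !tcompE diam_assocE !diam_morE.
Qed.

Lemma reltensor_intro (P : bimod A D) (q : tmor (M ◇ N) P) :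
  balanced q ->
  (forall (F G : C) (y : P F G), exists x, q F G x = y) ->
  (forall (S : tamb C) (h : tmor (M ◇ N) S), balanced h ->
     forall (F G : C) x, q F G x = 0 -> h F G x = 0) ->
  (forall (F H K G : C) (a : A F H) (m : M H K) (n : N K G),
     lmul a (q H G (pure m n)) = q F G (pure (lmul a m) n)) ->
  (forall (F H K G : C) (m : M F H) (n : N H K) (d : D K G),
     rmul (q F K (pure m n)) d = q F G (pure m (rmul n d))) ->
  is_reltensor M N P.
Proof.
move=> qb qs qk qL qR; exists q; split.
- split=> [|S h /balancedP hb]; first exact/balancedP.
  by apply: tmor_factor => //; exact: qk.
- by apply: diam_ext3 => *; rewrite !tcompE diam_assocE !diam_morE; exact: qL.
- by apply: diam_ext3 => *; rewrite !tcompE diam_assocE !diam_morE; exact: qR.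
Qed.

Lemma tid_bimod_iso (P : bimod A B) : @is_bimod_iso _ _ _ _ P P (tid P).
Proof.
apply: bijective_bimod_iso => [|F G x y //|F G y]; first exact/bimod_morP.
by exists y.
Qed.
End Factor.

Section HomBimodule.
Variables (k : fieldType) (C : kmoncat k) (N : modcat C).

Section HomTambara.
Variables X Y : N.

Definition hom_tamb_prof : prof C.
Proof.
exists (fun F G : C => hom (mact N F X) (mact N G Y))
       (fun F F' G G' f g x => mact2 g Y ∘ x ∘ mact2 f X).
- by move=> F F' G G' f g a x y; rewrite comp_linr comp_linl.
- by move=> F F' G G' g x a f f'; rewrite mact2_lin comp_linr.
- by move=> F F' G G' f x a g g'; rewrite mact2_lin !comp_linl.
- by move=> F G x; rewrite !mact2_1 comp1m compm1.
- by move=> F F' F'' G G' G'' f' f g' g x; rewrite !mact2_M !compA.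
Defined.

Definition hom_tt (H F G : C) (x : hom (mact N F X) (mact N G Y)) :
    hom (mact N (H ⊗ F) X) (mact N (H ⊗ G) Y) :=
  mmu H G Y ∘ fmor (mact N H) x ∘ mmu' H F X.

Lemma hom_tt_mu (H F G : C) (x : hom (mact N F X) (mact N G Y)) :
  hom_tt H x ∘ mmu H F X = mmu H G Y ∘ fmor (mact N H) x.
Proof. by rewrite /hom_tt -compA (mmuK H F X).1 compm1. Qed.

Definition hom_tamb : tamb C.
Proof.
exists hom_tamb_prof hom_tt => /=.
- by move=> H F G a x y; rewrite /hom_tt fmor_lin comp_linr comp_linl.
- move=> H F F' G G' f g x; apply: mmu_epi; rewrite hom_tt_mu.
  move: (hom_tt H x) (hom_tt_mu H x) => E eE; rewrite -!compA mmu_natr (compA E) eE.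
  by rewrite !compA mmu_natr !fmorM !compA.
- move=> H H' F G h x; apply: mmu_epi; rewrite !mact2_1 compm1 comp1m.
  move: (hom_tt H x) (hom_tt_mu H x) (hom_tt H' x) (hom_tt_mu H' x) => E eE E' eE'.
  rewrite -!compA eE mmu_natl !compA mmu_natl eE'.
  by rewrite -!compA mact2_nat.
- move=> H K F G x; apply: mmu_epi; rewrite hom_tt_mu.
  have epi Z (u v : hom (mact N (H ⊗ K) (mact N F X)) Z) :
      u ∘ mmu H K _ = v ∘ mmu H K _ -> u = v by exact: mmu_epi.
  apply: epi; move: (hom_tt H _) (hom_tt_mu H (hom_tt K x)) => E eE.
  rewrite -!compA mmuA (compA E) eE -(compA (mmu _ _ _)) -fmorM hom_tt_mu -mmu_nat.
  by rewrite compA mmu_assoc' fmorM -!compA.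
- move=> F G x; apply: mmu_epi; rewrite hom_tt_mu.
  have epi Z (u v : hom (mact N (munit C) (mact N F X)) Z) :
      u ∘ meta _ = v ∘ meta _ -> u = v.
    by move=> e; rewrite -[u]compm1 -[v]compm1 -(metaK (mact N F X)).2 !compA e.
  apply: epi; rewrite -!compA mmu1l compm1 -meta_nat !compA.
  by rewrite mmu_meta.
Defined.
End HomTambara.

Lemma hom_comp_tt (X Y Z : N) (H F G K : C) (x : hom (mact N F X) (mact N G Y))
    (y : hom (mact N G Y) (mact N K Z)) :
  hom_tt H y ∘ hom_tt H x = hom_tt H (y ∘ x).
Proof. by apply: mmu_epi; rewrite -compA !hom_tt_mu compA hom_tt_mu -compA -fmorM. Qed.

Section Actions.
Variables (A B : tmonoid C) (X Y : N).
Variables (al : miso A (end_monoid X)) (be : miso B (end_monoid Y)).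

Let alh (F G : C) (a : A F G) : hom (mact N F X) (mact N G X) := mfwd al a.
Let beh (F G : C) (b : B F G) : hom (mact N F Y) (mact N G Y) := mfwd be b.

Definition hom_bimod : bimod A B.
Proof.
apply: (@mk_bimod k C A B (hom_tamb X Y)
  (fun F H G a (m : hom (mact N H X) (mact N G Y)) => m ∘ alh a)
  (fun F H G (m : hom (mact N F X) (mact N H Y)) b => beh b ∘ m)).
- by move=> F H G m c a a'; rewrite /alh mfwd_lin; exact: comp_linr.
- by move=> F H G a; exact: comp_linl.
- by move=> F H G b; exact: comp_linr.
- by move=> F H G m c b b'; rewrite /beh mfwd_lin; exact: comp_linl.
- by move=> F H K G a a' m; rewrite /alh mfwd_mul end_amul compA.
- by move=> F H K G m b b'; rewrite /beh mfwd_mul end_amul compA.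
- by move=> F H K G a m b; rewrite compA.
- by move=> F H G f m; rewrite /alh mfwd_unit /= mact2_1 comp1m.
- by move=> F H G m g; rewrite /beh mfwd_unit /= mact2_1 compm1.
- by move=> K F H G a m; rewrite /alh mfwd_tt; exact: hom_comp_tt.
- by move=> K F H G m b; rewrite /beh mfwd_tt; exact: hom_comp_tt.
Defined.

Lemma hom_lmul (F H G : C) (a : A F H) (m : hom_bimod H G) :
  lmul a m = (m : hom (mact N H X) (mact N G Y)) ∘ alh a.
Proof. exact: lmul_mk. Qed.
Lemma hom_rmul (F H G : C) (m : hom_bimod F H) (b : B H G) :
  rmul m b = beh b ∘ (m : hom (mact N F X) (mact N H Y)).
Proof. exact: rmul_mk. Qed.
End Actions.

Section Pairing.
Variables (A B : tmonoid C) (X Y : N).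
Variables (al : miso A (end_monoid X)) (be : miso B (end_monoid Y)).
Hypothesis XY : thru Y (idm X).
Notation P := (hom_bimod al be).
Notation Q := (hom_bimod be al).

Definition pairing : tmor (P ◇ Q) A.
Proof.
apply: (@diam_lift _ _ P Q A (fun F H G
  (m : hom (mact N F X) (mact N H Y)) (n : hom (mact N H Y) (mact N G X)) =>
  mbwd al (n ∘ m : end_monoid X F G))).
- move=> F H G n c m m'; rewrite comp_linr; exact: (@mfwd_lin _ _ _ _ (miso_sym al)).
- move=> F H G m c n n'; rewrite comp_linl; exact: (@mfwd_lin _ _ _ _ (miso_sym al)).
- by move=> F G H H' h m n /=; rewrite !mact2_1 compm1 comp1m compA.
- move=> F F' G G' H f g m n; rewrite -(mfwd_pmap (miso_sym al)) /=.
  by rewrite !mact2_1 compm1 comp1m !compA.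
- move=> F H G K m n; rewrite -(mfwd_tt (miso_sym al)) /=; congr (mbwd al _).
  exact: hom_comp_tt.
Defined.

Lemma pairingE (F H G : C) (m : P F H) (n : Q H G) : pairing F G (pure m n)
  = mbwd al ((n : hom (mact N H Y) (mact N G X)) ∘ (m : hom (mact N F X) (mact N H Y))
      : end_monoid X F G).
Proof.
rewrite /= diam_lift_pure //.
- move=> {}F {}H {}G {}n c {}m m'; rewrite comp_linr; exact: (@mfwd_lin _ _ _ _ (miso_sym al)).
- move=> {}F {}H {}G {}m c {}n n'; rewrite comp_linl; exact: (@mfwd_lin _ _ _ _ (miso_sym al)).
- by move=> {}F {}G {}H H' h {}m {}n /=; rewrite !mact2_1 compm1 comp1m compA.
Qed.

(** Write the identity of X as a sum of b_i a_i through objects F_i.Y. Acting by F gives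
  u_i and v_i with sum of v_i u_i the identity of F.X, so every y is the value of the
  pairing at the sum of the u_i ⊗ y v_i. The same formula recovers a balanced map h from
  its values, because u_i ⊗ n m v_i = u_i (m v_i) ⊗ n = m ⊗ n, the middle factor m v_i
  being in [Y,Y]. *)
Lemma pairing_reltensor : reltensor_iso P Q (regular A).
Proof.
exists (regular A); last by exists (tid A); exact: (@tid_bimod_iso _ _ _ _ (regular A)).
have [n [Fs [a [b e]]]] := thruP XY.
pose u F i : P F (F ⊗ Fs i) := mmu F (Fs i) Y ∘ fmor (mact N F) (a i).
pose v F i : Q (F ⊗ Fs i) F := fmor (mact N F) (b i) ∘ mmu' F (Fs i) Y.
have vu F : \sum_i (v F i : hom (mact N _ Y) (mact N _ X)) ∘ u F i = idm (mact N F X).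
  under eq_bigr => i _.
    rewrite /u /v -compA (compA (mmu' _ _ _)) (mmuK _ _ _).1 comp1m -fmorM; over.
  by rewrite -fmor_sum -e fmor1.
apply: (reltensor_intro (P := regular A) (q := pairing)).
- by move=> F H K G m c x; rewrite !pairingE hom_lmul hom_rmul compA.
- move=> F G y.
  pose Y' : hom (mact N F X) (mact N G X) := mfwd al y.
  exists (\sum_i pure (u F i) (Y' ∘ (v F i : hom (mact N _ Y) (mact N _ X)) : Q _ _)).
  rewrite (lin_sum (@tfun_lin _ _ _ _ pairing F G)).
  under eq_bigr => i _ do rewrite pairingE -compA.
  rewrite -(lin_sum (@mfwd_lin _ _ _ _ (miso_sym al) F G)) /=.
  by rewrite -comp_sumr vu compm1; exact: mfwdK.
- move=> S h hb F G x.
  pose w (y : A F G) : S F G :=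
    \sum_i h F G (pure (u F i) ((mfwd al y : hom (mact N F X) (mact N G X))
      ∘ (v F i : hom (mact N _ Y) (mact N _ X)) : Q _ _)).
  have wl : linear w.
    move=> c y z; rewrite /w scaler_sumr -big_split; apply: eq_bigr => i _ /=.
    by rewrite mfwd_lin comp_linl (pure_linr (u F i)) (@tfun_lin _ _ _ _ h F G).
  suff wq : forall x, w (pairing F G x) = h F G x.
    by move=> x0; rewrite -wq x0; exact: linear_0 wl.
  apply: coend_ext.
  + exact: linear_comp wl (@tfun_lin _ _ _ _ pairing F G).
  + exact: (@tfun_lin _ _ _ _ h F G).
  move=> H m m'; rewrite pairingE /w mbwdK.
  pose M : hom (mact N F X) (mact N H Y) := m.
  pose c i : B (F ⊗ Fs i) H :=
    mbwd be (M ∘ (v F i : hom (mact N _ Y) (mact N _ X)) : end_monoid Y _ _).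
  transitivity (\sum_i h F G (pure (rmul (u F i) (c i)) m')).
    by apply: eq_bigr => i _; rewrite hb hom_lmul /c mbwdK compA.
  rewrite -(lin_sum (@tfun_lin _ _ _ _ h F G)) -(lin_sum (pure_linl m')).
  congr (h F G (pure _ m')); under eq_bigr => i _ do rewrite hom_rmul /c mbwdK -compA.
  by rewrite -comp_sumr vu compm1.
- move=> F H K G c m x; rewrite lmul_regular !pairingE hom_lmul.
  by apply: (can_inj (@mfwdK _ _ _ _ al F G)); rewrite mfwd_mul !mbwdK end_amul compA.
- move=> F H K G m x d; rewrite rmul_regular !pairingE hom_rmul.
  by apply: (can_inj (@mfwdK _ _ _ _ al F G)); rewrite mfwd_mul !mbwdK end_amul compA.
Qed.
End Pairing.

Lemma generators_morita (A B : tmonoid C) (X Y : N) :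
  miso A (end_monoid X) -> miso B (end_monoid Y) -> gen X -> gen Y -> morita_equiv A B.
Proof.
move=> al be gX gY; exists (hom_bimod al be), (hom_bimod be al).
by split; apply: pairing_reltensor.
Qed.
End HomBimodule.

(** * Relative tensor products in terms of elements *)

Section QuotientTambara.
Variables (k : fieldType) (C : kmoncat k) (P : tamb C).
Variable K : forall F G : C, P F G -> Prop.
Hypothesis KS : forall F G, subspace (@K F G).
Hypothesis Kmap : forall (F F' G G' : C) (f : hom F' F) (g : hom G G') (x : P F G),
  K x -> K (pmap f g x).
Hypothesis Ktt : forall (H F G : C) (x : P F G), K x -> K (tstr P H x).

Let quo F G : lmodType k := quotl (KS F G).
Let pi F G (x : P F G) : quo F G := qpi (KS F G) x.

Let piL F G a (x y : P F G) : pi (a *: x + y) = a *: pi x + pi y.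
Proof. exact: qpi_lin. Qed.

Let qmap (V : lmodType k) (F G : C) (f : P F G -> V) (u : quo F G) : V := f (repr u).
Let qmapE (V : lmodType k) F G (f : P F G -> V) : linear f ->
  (forall x, K x -> f x = 0) -> forall x, qmap f (pi x) = f x.
Proof.
move=> fl f0 x; apply/eqP; rewrite -subr_eq0 /qmap -(linear_B fl) f0 //.
exact: qrepr.
Qed.

Let qq F G (u : quo F G) : exists x, u = pi x.
Proof. by move: u; apply: qind => x; exists x. Qed.

Let qpmap (F F' G G' : C) (f : hom F' F) (g : hom G G') : quo F G -> quo F' G' :=
  qmap (fun x => pi (pmap f g x)).
Let qtt (H F G : C) : quo F G -> quo (H ⊗ F) (H ⊗ G) := qmap (fun x => pi (tstr P H x)).

Let qpmapE (F F' G G' : C) (f : hom F' F) (g : hom G G') (x : P F G) :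
  qpmap f g (pi x) = pi (pmap f g x).
Proof.
apply: qmapE => [|y Ky]; last by apply/qpi_eq0; exact: Kmap.
exact: linear_comp (qpi_lin _) (pmap_lin _ _ _).
Qed.

Let qttE (H F G : C) (x : P F G) : qtt H (pi x) = pi (tstr P H x).
Proof.
apply: qmapE => [|y Ky]; last by apply/qpi_eq0; exact: Ktt.
exact: linear_comp (qpi_lin _) (@tstr_lin _ _ P H F G).
Qed.

Definition quotient_prof : prof C.
Proof.
exists quo qpmap.
- move=> F F' G G' f g a u v; have [x ->] := qq u; have [y ->] := qq v.
  by rewrite -piL !qpmapE pmap_lin piL.
- move=> F F' G G' g u a f f'; have [x ->] := qq u.
  by rewrite !qpmapE pmap_linl piL.
- move=> F F' G G' f u a g g'; have [x ->] := qq u.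
  by rewrite !qpmapE pmap_linr piL.
- by move=> F G u; have [x ->] := qq u; rewrite qpmapE pmap1.
- by move=> F F' F'' G G' G'' f' f g' g u; have [x ->] := qq u; rewrite !qpmapE pmapM.
Defined.

Definition quotient_tamb : tamb C.
Proof.
exists quotient_prof qtt => /=.
- move=> H F G a u v; have [x ->] := qq u; have [y ->] := qq v.
  by rewrite -piL !qttE tstr_lin piL.
- by move=> H F F' G G' f g u; have [x ->] := qq u; rewrite !(qttE, qpmapE) tstr_nat.
- by move=> H H' F G h u; have [x ->] := qq u; rewrite !(qttE, qpmapE) tstr_extra.
- by move=> H L F G u; have [x ->] := qq u; rewrite !(qttE, qpmapE) tstr_assoc.
- by move=> F G u; have [x ->] := qq u; rewrite !(qttE, qpmapE) tstr_unit.
Defined.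

Definition quotient_proj : tmor P quotient_tamb.
Proof.
exists pi => /=.
- by move=> F G; exact: qpi_lin.
- by move=> *; rewrite qpmapE.
- by move=> *; rewrite qttE.
Defined.

Lemma quotient_proj_eq0 F G (x : P F G) : quotient_proj F G x = 0 <-> K x.
Proof. exact: qpi_eq0. Qed.

End QuotientTambara.

Section Pairings.
Variables (k : fieldType) (C : kmoncat k) (A B : tmonoid C).

(** A balanced pairing M x N -> A through which every balanced pairing of vector spaces
  factors: the elementwise content of an isomorphism of M ⊗_B N with A. *)
Record tensor_pairing (M : bimod A B) (N : bimod B A) := TensorPairing {
  pg : forall F H G : C, M F H -> N H G -> A F G;
  pg_linl : forall (F H G : C) (n : N H G), linear (fun m : M F H => pg m n);
  pg_linr : forall (F H G : C) (m : M F H), linear (fun n : N H G => pg m n);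
  pg_bal : forall (F H K G : C) (m : M F H) (b : B H K) (n : N K G),
    pg (rmul m b) n = pg m (lmul b n);
  pgL : forall (F H K G : C) (a : A F H) (m : M H K) (n : N K G),
    amul a (pg m n) = pg (lmul a m) n;
  pgR : forall (F H K G : C) (m : M F H) (n : N H K) (a : A K G),
    amul (pg m n) a = pg m (rmul n a);
  pg_tt : forall (K F H G : C) (m : M F H) (n : N H G),
    pg (tstr M K m) (tstr N K n) = tstr A K (pg m n);
  pg_ind : forall (F G : C) (S : A F G -> Prop), S 0 ->
    (forall H (m : M F H) (n : N H G) y, S y -> S (pg m n + y)) -> forall y, S y;
  pg_univ : forall (F G : C) (V : lmodType k) (be : forall H, M F H -> N H G -> V),
    (forall H n, linear (fun m : M F H => be H m n)) ->
    (forall H m, linear (fun n : N H G => be H m n)) ->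
    (forall H K (m : M F H) (b : B H K) (n : N K G),
       be K (rmul m b) n = be H m (lmul b n)) ->
    exists2 L : A F G -> V, linear L & forall H (m : M F H) (n : N H G), L (pg m n) = be H m n
}.

Variables (M : bimod A B) (N : bimod B A).

Inductive balancing (F G : C) : (M ◇ N) F G -> Prop :=
| bal_gen H K (m : M F H) (b : B H K) (n : N K G) :
    balancing (pure (rmul m b) n - pure m (lmul b n) : (M ◇ N) F G)
| bal_0 : balancing 0
| bal_lin a u v : balancing u -> balancing v -> balancing (a *: u + v).

Lemma bal_subspace F G : subspace (@balancing F G).
Proof. by split; [exact: bal_0|exact: bal_lin]. Qed.

Lemma bal_map (F F' G G' : C) (f : hom F' F) (g : hom G G') (x : (M ◇ N) F G) :
  balancing x -> balancing (pmap f g x).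
Proof.
elim=> [H K m b n||a u v _ IHu _ IHv].
- rewrite (linear_B (pmap_lin (M ◇ N) f g)) /= !diam_pmap_pure.
  by rewrite -!(aunit_lmul f) -!(rmul_unit _ g) -(lrmulA (aunit A f)) (lrmulA b); exact: bal_gen.
- by rewrite (linear_0 (pmap_lin (M ◇ N) f g)); exact: bal_0.
- by rewrite pmap_lin; exact: bal_lin.
Qed.

Lemma bal_tt (H F G : C) (x : (M ◇ N) F G) : balancing x -> balancing (tstr (M ◇ N) H x).
Proof.
elim=> [L K m b n||a u v _ IHu _ IHv].
- rewrite (linear_B (@tstr_lin _ _ (M ◇ N) H F G)) /= !diam_tt_pure.
  by rewrite -rmul_tt -lmul_tt; exact: bal_gen.
- by rewrite (linear_0 (@tstr_lin _ _ (M ◇ N) H F G)); exact: bal_0.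
- by rewrite tstr_lin; exact: bal_lin.
Qed.

(** Coequalizers of Tambara modules are computed on vector spaces: comparing the
  coequalizer q with explicit quotients shows that q is surjective and that its kernel is
  spanned by the balancing relations. A pairing with values in a single vector space,
  which is not a map of Tambara modules, can then be factored as well. *)
Lemma reltensor_iso_pairing : reltensor_iso M N (regular A) -> inhabited (tensor_pairing M N).
Proof.
move=> [P [q0 [[qb0 qu0] qL0 qR0]] [u [mu [v [mv vu uv]]]]].
have [uL uR] := (bimod_morP u).1 mu.
pose q := u ∘t q0.
have qb : balanced q.
  by apply/balancedP; apply: tmor_eq => F G x; exact: (congr1 (u F G) (tmor_congr qb0 x)).
have qL (F H K G : C) (a : A F H) (m : M H K) (n : N K G) :
    amul a (q H G (pure m n)) = q F G (pure (lmul a m) n).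
  have := tmor_congr qL0 (pure (P := A ◇ M) (pure a m : (A ◇ M) F K) n : ((A ◇ M) ◇ N) F G).
  rewrite !tcompE diam_assocE !diam_morE => e; rewrite -lmul_regular -uL.
  exact: (congr1 (u F G) e).
have qR (F H K G : C) (m : M F H) (n : N H K) (a : A K G) :
    amul (q F K (pure m n)) a = q F G (pure m (rmul n a)).
  have := tmor_congr qR0 (pure (P := M ◇ N) (pure m n : (M ◇ N) F K) a : ((M ◇ N) ◇ A) F G).
  rewrite !tcompE diam_assocE !diam_morE => e; rewrite -rmul_regular -uR.
  exact: (congr1 (u F G) e).
have qu S (h : tmor (M ◇ N) S) : balanced h ->
    exists2 w : tmor A S, w ∘t q = h & forall w', w' ∘t q = h -> w' = w.
  move=> /balancedP hb; have [w [wq wu]] := qu0 S h hb.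
  exists (w ∘t v).
    apply: tmor_eq => F G x; rewrite -(tmor_congr wq x).
    exact: (congr1 (w F G) (tmor_congr vu (q0 F G x))).
  move=> w' e; have -> : w = w' ∘t u.
    by apply: wu; apply: tmor_eq => F G x; exact: (tmor_congr e x).
  by apply: tmor_eq => F G x; symmetry; exact: (congr1 (w' F G) (tmor_congr uv x)).
(* The quotient of A by the image of q receives two maps, the projection and 0. *)
have qsur (F G : C) (y : A F G) : exists x, q F G x = y.
  pose K F G (y : A F G) := exists x, q F G x = y.
  have KS F' G' : subspace (@K F' G').
    split; first by exists 0; exact: (linear_0 (@tfun_lin _ _ _ _ q F' G')).
    by move=> a _ _ [x <-] [z <-]; exists (a *: x + z); exact: (@tfun_lin _ _ _ _ q F' G').
  have Kmap F1 F2 G1 G2 (f : hom F2 F1) (g : hom G1 G2) z : K F1 G1 z -> K F2 G2 (pmap f g z).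
    by move=> [x <-]; exists (pmap f g x); exact: tfun_nat.
  have Ktt H F' G' z : K F' G' z -> K _ _ (tstr A H z).
    by move=> [x <-]; exists (tstr _ H x); exact: tfun_tt.
  pose S := quotient_tamb KS Kmap Ktt.
  have [|w _ wu] := qu S (tzero (M ◇ N) S); first by [].
  have e1 : quotient_proj KS Kmap Ktt = w.
    apply: wu; apply: tmor_eq => F' G' x; apply/quotient_proj_eq0; by exists x.
  have e2 : tzero A S = w by apply: wu; apply: tmor_eq.
  have : quotient_proj KS Kmap Ktt F G y = 0 by rewrite e1 -e2.
  by move/quotient_proj_eq0.
have qker (F G : C) x : q F G x = 0 -> balancing x.
  pose pr := quotient_proj bal_subspace bal_map bal_tt.
  have [|w wq _] := qu _ pr.
    move=> F' H K G' m b n; apply/eqP; rewrite -subr_eq0; apply/eqP.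
    rewrite -(linear_B (@tfun_lin _ _ _ _ pr F' G')).
    by apply/quotient_proj_eq0; exact: bal_gen.
  move=> qx; apply/(quotient_proj_eq0 bal_subspace bal_map bal_tt).
  rewrite -[LHS](tmor_congr wq x) tcompE qx; exact: (linear_0 (@tfun_lin _ _ _ _ w F G)).
split; exists (fun F H G m n => q F G (pure m n)) => //.
- move=> F H G n; exact: (linear_comp (@tfun_lin _ _ _ _ q F G) (pure_linl n)).
- move=> F H G m; exact: (linear_comp (@tfun_lin _ _ _ _ q F G) (pure_linr m)).
- by move=> K F H G m n; rewrite -tfun_tt /= diam_tt_pure.
- move=> F G S S0 SD y; have [x <-] := qsur F G y; move: x.
  apply: coend_ind; first by rewrite (linear_0 (@tfun_lin _ _ _ _ q F G)).
  by move=> H m n x Sx; rewrite (linear_D (@tfun_lin _ _ _ _ q F G)); exact: SD.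
- move=> F G V be bl br bb.
  pose b0 := fun H (m : M F H) (n : N H G) => be H m n.
  have bd H H' (h : hom H H') (p : M F H) (n : N H' G) :
      b0 H' (pmap (idm F) h p) n = b0 H p (pmap h (idm G) n).
    by rewrite -rmul_unit -aunit_lmul; exact: bb.
  pose L0 := clift (P := M) (Q := N) b0.
  have L0E H (m : M F H) (n : N H G) : L0 (pure m n) = be H m n by exact: clift_pure.
  have L0l : linear (L0 : (M ◇ N) F G -> V) by exact: clift_lin.
  have L0k x : q F G x = 0 -> L0 x = 0.
    move=> /qker; elim=> [H K m b n||a y z _ ey _ ez].
    + by rewrite (linear_B L0l) !L0E bb subrr.
    + exact: linear_0 L0l.
    + by rewrite L0l ey ez scaler0 addr0.
  pose s y : (M ◇ N) F G := projT1 (cid (qsur F G y)).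
  have qs y : q F G (s y) = y := projT2 (cid (qsur F G y)).
  have LE x : L0 (s (q F G x)) = L0 x.
    apply/eqP; rewrite -subr_eq0 -(linear_B L0l); apply/eqP; apply: L0k.
    by rewrite (linear_B (@tfun_lin _ _ _ _ q F G)) qs subrr.
  exists (fun y => L0 (s y)) => [a y z|H m n]; last by rewrite LE L0E.
  by rewrite -L0l -[RHS]LE (@tfun_lin _ _ _ _ q F G) !qs.
Qed.
End Pairings.

(** * The linking category of a Morita equivalence *)

Section PairingCancellation.
Variables (k : fieldType) (C : kmoncat k) (A B : tmonoid C).
Variables (M : bimod A B) (N : bimod B A) (f : tensor_pairing M N).

(** The values of the pairing span A, in particular its unit. *)
Lemma pg_lmul_inj (D : tmonoid C) (Q : bimod A D) (F G : C) (x y : Q F G) :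
  (forall E H (m : M E H) (n : N H F), lmul (pg f m n) x = lmul (pg f m n) y) -> x = y.
Proof.
move=> e; rewrite -[x]lmul1 -[y]lmul1; move: (aunit A (idm F)).
apply: (pg_ind (t := f)); first by rewrite !(linear_0 (lmul_linl _)).
by move=> H m n a IH; rewrite !(linear_D (lmul_linl _)) IH e.
Qed.

Lemma pg_rmul_inj (D : tmonoid C) (Q : bimod D A) (F G : C) (x y : Q F G) :
  (forall H K (m : M G H) (n : N H K), rmul x (pg f m n) = rmul y (pg f m n)) -> x = y.
Proof.
move=> e; rewrite -[x]rmul1 -[y]rmul1; move: (aunit A (idm G)).
apply: (pg_ind (t := f)); first by rewrite !(linear_0 (rmul_linr _)).
by move=> H m n a IH; rewrite !(linear_D (rmul_linr _)) IH e.
Qed.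

End PairingCancellation.

Section Context.
Variables (k : fieldType) (C : kmoncat k) (A B : tmonoid C).
Variables (M : bimod A B) (N : bimod B A).

(** The contractions m ⊗ n ⊗ m' |-> f(m,n) m' and m ⊗ n ⊗ m' |-> m g(n,m') both identify
  M ⊗ N ⊗ M with M, but nothing relates f and g, so they may differ by an automorphism
  phi of M. It is obtained by factoring m ⊗ n |-> m g(n,m') through f and evaluating at
  the unit of A. *)
Lemma twist_exists (f : tensor_pairing M N) (g : tensor_pairing N M) (K G : C) (m' : M K G) :
  exists y : M K G, forall F H (m : M F H) (n : N H K),
    rmul m (pg g n m') = lmul (pg f m n) y.
Proof.
pose be F H (m : M F H) (n : N H K) : M F G := rmul m (pg g n m').
have hL F : exists2 L : A F K -> M F G, linear L &
    forall H (m : M F H) (n : N H K), L (pg f m n) = be F H m n.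
  apply: pg_univ.
  - by move=> H n; exact: rmul_linl.
  - by move=> H m; exact: (linear_comp (rmul_linr m) (pg_linl g m')).
  - by move=> H H' m b n; rewrite /be rmulA pgL.
have [L1 L1l L1E] := hL K.
exists (L1 (aunit A (idm K))) => F H m n.
have [L Ll LE] := hL F.
rewrite -/(be F H m n) -LE -[in LHS](amul1 (pg f m n)).
move: (pg f m n) => a; move: (aunit A (idm K)); apply: (pg_ind (t := f)).
  by rewrite (linear_0 (amul_linr _)) (linear_0 L1l) (linear_0 (lmul_linr _)) (linear_0 Ll).
move=> H' p q y IH; rewrite (linear_D (amul_linr _)) (linear_D Ll) IH.
rewrite (linear_D L1l) (linear_D (lmul_linr _)); congr (_ + _).
by rewrite pgL LE L1E /be lrmulA.
Qed.

(** The same comparison in the other direction, which will be the inverse of the first. *)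
Lemma untwist_exists (f : tensor_pairing M N) (g : tensor_pairing N M) (F H : C) (m : M F H) :
  exists y : M F H, forall K G (n : N H K) (m' : M K G),
    lmul (pg f m n) m' = rmul y (pg g n m').
Proof.
pose be G K (n : N H K) (m' : M K G) : M F G := lmul (pg f m n) m'.
have hL G : exists2 L : B H G -> M F G, linear L &
    forall K (n : N H K) (m' : M K G), L (pg g n m') = be G K n m'.
  apply: pg_univ.
  - by move=> K m'; exact: (linear_comp (lmul_linl m') (pg_linr f m)).
  - by move=> K n; exact: lmul_linr.
  - by move=> K K' n a m'; rewrite /be -pgR lmulA.
have [L1 L1l L1E] := hL H.
exists (L1 (aunit B (idm H))) => K G n m'.
have [L Ll LE] := hL G.
rewrite -/(be G K n m') -LE -[in LHS](amul1l (pg g n m')).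
move: (pg g n m') => b; move: (aunit B (idm H)); apply: (pg_ind (t := g)).
  by rewrite (linear_0 (amul_linl _)) (linear_0 L1l) (linear_0 (rmul_linl _)) (linear_0 Ll).
move=> H' p q y IH; rewrite (linear_D (amul_linl _)) (linear_D Ll) IH.
rewrite (linear_D L1l) (linear_D (rmul_linl _)); congr (_ + _).
by rewrite pgR LE L1E /be lrmulA.
Qed.

Section Untwist.
Variables (f : tensor_pairing M N) (g : tensor_pairing N M).

Let phi F G (m : M F G) : M F G := projT1 (cid (twist_exists f g m)).
Let phiE K G (m' : M K G) F H (m : M F H) (n : N H K) :
  rmul m (pg g n m') = lmul (pg f m n) (phi m').
Proof. exact: (projT2 (cid (twist_exists f g m'))). Qed.
Let psi F G (m : M F G) : M F G := projT1 (cid (untwist_exists f g m)).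
Let psiE F H (m : M F H) K G (n : N H K) (m' : M K G) :
  lmul (pg f m n) m' = rmul (psi m) (pg g n m').
Proof. exact: (projT2 (cid (untwist_exists f g m))). Qed.

Let phiL F H G (a : A F H) (m : M H G) : phi (lmul a m) = lmul a (phi m).
Proof.
apply: (pg_lmul_inj (f := f)) => E K p q.
by rewrite -phiE -lmulA pgR -phiE -pg_bal.
Qed.

Let psiR F H G (m : M F H) (b : B H G) : psi (rmul m b) = rmul (psi m) b.
Proof.
apply: (pg_rmul_inj (f := g)) => E K p q.
by rewrite -psiE pg_bal rmulA pgL psiE.
Qed.

Let phi_lin F G : linear (@phi F G).
Proof.
move=> a x y; apply: (pg_lmul_inj (f := f)) => E K p q.
by rewrite -phiE pg_linr rmul_linr !phiE -lmul_linr.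
Qed.

Let psi_lin F G : linear (@psi F G).
Proof.
move=> a x y; apply: (pg_rmul_inj (f := g)) => E K p q.
by rewrite -psiE pg_linl lmul_linl !psiE -rmul_linl.
Qed.

Let psiK F G : cancel (@psi F G) (@phi F G).
Proof.
move=> m; rewrite -[m in LHS]rmul1 -[RHS]rmul1; move: (aunit B (idm G)).
apply: (pg_ind (t := g)).
  by rewrite (linear_0 (rmul_linr _)) (linear_0 (@psi_lin _ _)) (linear_0 (@phi_lin _ _)).
move=> H n m' b IH; rewrite !(linear_D (rmul_linr _)) (linear_D (@psi_lin _ _)).
rewrite (linear_D (@phi_lin _ _)) IH; congr (_ + _).
by rewrite psiR -psiE phiL phiE.
Qed.

Let phiK F G : cancel (@phi F G) (@psi F G).
Proof.
move=> m; rewrite -[m in LHS]lmul1 -[RHS]lmul1; move: (aunit A (idm F)).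
apply: (pg_ind (t := f)).
  by rewrite (linear_0 (lmul_linl _)) (linear_0 (@phi_lin _ _)) (linear_0 (@psi_lin _ _)).
move=> H m' n a IH; rewrite !(linear_D (lmul_linl _)) (linear_D (@phi_lin _ _)).
rewrite (linear_D (@psi_lin _ _)) IH; congr (_ + _).
by rewrite phiL -phiE psiR -psiE.
Qed.

Let psiL F H G (a : A F H) (m : M H G) : psi (lmul a m) = lmul a (psi m).
Proof. by rewrite -{1}[m]psiK -phiL phiK. Qed.

Let phi_tt K F G (m : M F G) : phi (tstr M K m) = tstr M K (phi m).
Proof.
rewrite -[LHS]lmul1 -[in RHS](lmul1 (phi m)) -lmul_tt aunit_tt tensm1.
suff e (a : A F F) : lmul (tstr A K a) (phi (tstr M K m)) = lmul (tstr A K a) (tstr M K (phi m)).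
  by have := e (aunit A (idm F)); rewrite aunit_tt tensm1.
move: a; apply: (pg_ind (t := f)).
  by rewrite (linear_0 (@tstr_lin _ _ A K F F)) !(linear_0 (lmul_linl _)).
move=> H p q a IH; rewrite (linear_D (@tstr_lin _ _ A K F F)) !(linear_D (lmul_linl _)) IH.
by rewrite -pg_tt -phiE pg_tt rmul_tt phiE -lmul_tt -pg_tt.
Qed.

Let psi_tt K F G (m : M F G) : psi (tstr M K m) = tstr M K (psi m).
Proof. by rewrite -{1}[m]psiK -phi_tt phiK. Qed.

(** The second pairing corrected by the twist, so that both contractions of
  M ⊗ N ⊗ M agree. *)
Let h F H G (n : N F H) (m : M H G) : B F G := pg g n (psi m).

Let hM F H K G (m : M F H) (n : N H K) (m' : M K G) :
  rmul m (h n m') = lmul (pg f m n) m'.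
Proof. by rewrite /h phiE psiK. Qed.

Let N_faithful F G (x y : N F G) : (forall E (m : M E F), pg f m x = pg f m y) -> x = y.
Proof.
move=> e; apply: (pg_lmul_inj (f := g)) => E H n m.
have [|||L _ LE] := @pg_univ _ _ _ _ _ _ f H G (N E G) (fun K m n' => lmul (pg g n m) n').
- by move=> K n'; exact: (linear_comp (lmul_linl n') (pg_linr g n)).
- by move=> K m'; exact: lmul_linr.
- by move=> K K' m' b n'; rewrite -pgR lmulA.
by rewrite -!LE e.
Qed.

Let hN F H K G (n : N F H) (m : M H K) (n' : N K G) :
  lmul (h n m) n' = rmul n (pg f m n').
Proof. by apply: N_faithful => E m0; rewrite -pg_bal hM -pgL pgR. Qed.

Definition link_T (i j : bool) : tamb C :=
  match i, j with
  | true, true => A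
  | true, false => M
  | false, true => N
  | false, false => B
  end.

Definition link_m (i j l : bool) (F H G : C) :
    link_T i j F H -> link_T j l H G -> link_T i l F G :=
  match i, j, l with
  | true, true, true => fun a b => amul a b
  | true, true, false => fun a m => lmul a m
  | true, false, true => fun m n => pg f m n
  | true, false, false => fun m b => rmul m b
  | false, true, true => fun n a => rmul n a
  | false, true, false => fun n m => h n m
  | false, false, true => fun b n => lmul b n
  | false, false, false => fun b c => amul b c
  end.

Definition link_e (i : bool) : tmor (tone C) (link_T i i) :=
  if i is true then tunit A else tunit B.

(** The linking category: endomorphisms A and B of two objects, maps M and N between them.
  The case of [link_m] that composes N with M uses the corrected pairing h; with it the
  composition is associative. *)
Definition linking : tcat C bool.
Proof.
exists link_T link_m link_e.
- move=> [] [] [] F H G y /=;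
    [exact: amul_linl|exact: lmul_linl|exact: pg_linl|exact: rmul_linl
    |exact: rmul_linl|exact: pg_linl|exact: lmul_linl|exact: amul_linl].
- move=> [] [] [] F H G x /=;
    [exact: amul_linr|exact: lmul_linr|exact: pg_linr|exact: rmul_linr
    |exact: rmul_linr| |exact: lmul_linr|exact: amul_linr].
  exact: (linear_comp (pg_linr g x) (@psi_lin H G)).
- move=> [] [] [] [] F H K G x y z /=.
  + exact: amulA.
  + exact: lmulA.
  + by rewrite pgL.
  + exact: lrmulA.
  + by rewrite pgR.
  + by rewrite hM.
  + exact: pg_bal.
  + exact: rmulA.
  + exact: rmulA.
  + by rewrite /h pg_bal psiL.
  + exact: hN.
  + by rewrite /h pgR psiR.
  + exact: lrmulA.
  + by rewrite /h pgL.
  + exact: lmulA.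
  + exact: amulA.
- by move=> [] [] F H G u x /=; rewrite ?[LHS]aunit_mul ?[LHS]aunit_lmul.
- by move=> [] [] F H G x u /=; rewrite ?[LHS]amul_unit ?[LHS]rmul_unit.
- move=> [] [] [] K F H G x y /=;
    [exact: amul_tt|exact: lmul_tt|exact: pg_tt|exact: rmul_tt
    |exact: rmul_tt| |exact: lmul_tt|exact: amul_tt].
  by rewrite /h psi_tt pg_tt.
Defined.

(** Each unit is a sum of values of a pairing, that is, of composites through the other
  object. *)
Lemma linking_gen i : gen (tcat_gen linking i).
Proof.
have via (i1 i2 : bool) (F H G : C) (x : hom ((i1, F) : tcat_mod linking) ((i2, H) : tcat_mod linking))
    (y : hom ((i2, H) : tcat_mod linking) ((i1, G) : tcat_mod linking)) :
    thru (tcat_gen linking i2) (y ∘ x).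
  by rewrite -[y]compm1; apply: thru_comp; exact: tcat_thru.
have thruA (a : A (munit C) (munit C)) :
    thru (tcat_gen linking false)
      (a : hom (tcat_gen linking true) (tcat_gen linking true)).
  move: a; apply: (pg_ind (t := f)) => [|H m n y]; first exact: thru0.
  by apply: thru_add; exact: (via true false _ H _ m n).
have thruB (b : B (munit C) (munit C)) :
    thru (tcat_gen linking true)
      (b : hom (tcat_gen linking false) (tcat_gen linking false)).
  move: b; apply: (pg_ind (t := g)) => [|H n m y]; first exact: thru0.
  by rewrite -[m]phiK; apply: thru_add; exact: (via false true _ H _ n (phi m)).
move=> [j F]; apply: (thru_trans _ (tcat_thru linking j F)).
by case: i j => [] []; [exact: thru_self|exact: thruB|exact: thruA|exact: thru_self].
Qed.

Definition linking_endA : miso A (end_monoid (tcat_gen linking true)).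
Proof. by apply: (@tcat_end k C bool linking A true (fun _ _ a => a) (fun _ _ a => a)). Defined.

Definition linking_endB : miso B (end_monoid (tcat_gen linking false)).
Proof. by apply: (@tcat_end k C bool linking B false (fun _ _ b => b) (fun _ _ b => b)). Defined.
End Untwist.
End Context.

Definition monoid_tcat (k : fieldType) (C : kmoncat k) (A : tmonoid C) : tcat C unit.
Proof.
exists (fun _ _ => A) (fun _ _ _ F H G a b => amul a b) (fun _ => tunit A).
- by move=> _ _ _ F H G b; exact: amul_linl.
- by move=> _ _ _ F H G a; exact: amul_linr.
- by move=> _ _ _ _ F H K G a b c; exact: amulA.
- by move=> _ _ F H G u a; exact: aunit_mul.
- by move=> _ _ F H G a u; exact: amul_unit.
- by move=> _ _ _ K F H G a b; exact: amul_tt.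
Defined.

Section Realization.
Variables (k : fieldType) (C : kmoncat k).

(** The Cauchy completion of the free module category on one object with monoid A. *)
Lemma monoid_realized (A : tmonoid C) : exists (N : modcat C) (X : N),
  [/\ cauchy_complete N, gen X & inhabited (miso A (end_monoid X))].
Proof.
pose X := tcat_gen (monoid_tcat A) tt.
exists (cauchy_mod (tcat_mod (monoid_tcat A))), (cau_emb X).
have gX : gen X.
  by move=> [[] F]; exact: (tcat_thru (monoid_tcat A) tt F).
split; [exact: cauchyP|exact: gen_cau_emb|].
split; apply: miso_trans (cau_emb_miso X).
by apply: (@tcat_end k C unit (monoid_tcat A) A tt (fun _ _ a => a) (fun _ _ a => a)).
Qed.

(** Converse of [generators_morita]. *)
Lemma morita_generators (A B : tmonoid C) : morita_equiv A B ->
  exists (N : modcat C) (X Y : N), [/\ cauchy_complete N, gen X, gen Y,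
    inhabited (miso A (end_monoid X)) & inhabited (miso B (end_monoid Y))].
Proof.
move=> [M [N [/reltensor_iso_pairing[f] /reltensor_iso_pairing[g]]]].
pose X := tcat_gen (linking f g) true; pose Y := tcat_gen (linking f g) false.
exists (cauchy_mod (tcat_mod (linking f g))), (cau_emb X), (cau_emb Y).
split; first exact: cauchyP.
- by apply: gen_cau_emb; exact: linking_gen.
- by apply: gen_cau_emb; exact: linking_gen.
- by split; apply: miso_trans (cau_emb_miso X); exact: linking_endA.
- by split; apply: miso_trans (cau_emb_miso Y); exact: linking_endB.
Qed.
End Realization.

(** * The bijection *)

Section Bijection.
Variables (k : fieldType) (C : kmoncat k).

Lemma miso_modcat_equiv (M N : modcat C) (X : M) (Y : N) :
  cauchy_complete M -> cauchy_complete N -> gen X -> gen Y ->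
  miso (end_monoid X) (end_monoid Y) -> modcat_equiv M N.
Proof.
move=> ccM ccN gX gY th; apply/modcat_equivP; exists (matched_corr th).
exact: matched_total.
Qed.

Lemma morita_modcat_equiv (M N : modcat C) (X : M) (Y : N) :
  cauchy_complete M -> cauchy_complete N -> gen X -> gen Y ->
  morita_equiv (end_monoid X) (end_monoid Y) -> modcat_equiv M N.
Proof.
move=> ccM ccN gX gY /morita_generators[L [P [Q [ccL gP gQ [a] [b]]]]].
have /modcat_equivP[U tU] := miso_modcat_equiv ccM ccL gX gP a.
have /modcat_equivP[W tW] := miso_modcat_equiv ccL ccN gQ gY (miso_sym b).
by apply/modcat_equivP; exists (corr_trans U W); exact: ctotal_trans.
Qed.

(** The generator Y is moved along the correspondence to an object V of M with [V,V]
  isomorphic to [Y,Y]; then X and V are two generators of M. *)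
Lemma corr_morita (A B : tmonoid C) (M N : modcat C) (W : corr M N) (X : M) (Y : N) :
  ctotal W -> gen X -> gen Y -> miso A (end_monoid X) -> miso B (end_monoid Y) ->
  morita_equiv A B.
Proof.
move=> tW gX gY a b; have [V [w]] := tW.2 Y.
apply: (generators_morita (X := X) (Y := V)) => //.
  exact: miso_trans b (miso_sym (corr_miso w)).
exact: (gen_cfwd (W := corr_sym W) w (ctotal_sym tW) gY).
Qed.

Lemma modcat_equiv_morita (M N : modcat C) (X : M) (Y : N) :
  gen X -> gen Y -> modcat_equiv M N -> morita_equiv (end_monoid X) (end_monoid Y).
Proof.
move=> gX gY /modcat_equivP[W tW].
exact: (corr_morita tW gX gY (miso_refl _) (miso_refl _)).
Qed.

Lemma morita_refl (A : tmonoid C) : morita_equiv A A.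
Proof.
have [N [X [ccN gX [a]]]] := monoid_realized A.
exact: (generators_morita a a gX gX).
Qed.

(** Realize both equivalences by pairs of generators (X,Y) and (Y',Z) of Cauchy complete
  module categories. As [Y,Y] and [Y',Y'] are both isomorphic to B, the two categories
  correspond, and X and Z can be compared. *)
Lemma morita_trans (A B D : tmonoid C) :
  morita_equiv A B -> morita_equiv B D -> morita_equiv A D.
Proof.
move=> /morita_generators[N [X [Y [ccN gX gY [a] [b]]]]].
move=> /morita_generators[N' [Y' [Z [ccN' gY' gZ [b'] [d]]]]].
have tW := matched_total (miso_trans (miso_sym b) b') ccN ccN' gY gY'.
exact: (corr_morita tW gX gZ a d).
Qed.

Lemma smonoid_equivalence : Equivalence (@smonoid_morita k C).
Proof.
split=> [A|A B [M [N [h h']]]|A B D].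
- exact: morita_refl.
- by exists N, M.
- exact: morita_trans.
Qed.
End Bijection.

Lemma Quot_eq T (R : T -> T -> Prop) : Equivalence R ->
  forall x y, cls R x = cls R y <-> R x y.
Proof.
move=> [Rr Rs Rt] x y; split=> [e|xy].
  have : proj1_sig (cls R y) y by exact: Rr.
  by rewrite -e.
have e : R x = R y.
  apply: functional_extensionality_dep => z; apply/propext; split=> h.
    exact: Rt (Rs _ _ xy) h.
  exact: Rt xy h.
rewrite /cls; move: (ex_intro _ x _) (ex_intro _ y _); rewrite {1 2}e => p q.
by congr exist; exact: Prop_irrelevance.
Qed.

Lemma Quot_surj T (R : T -> T -> Prop) (c : Quot R) : exists x, c = cls R x.
Proof.
case: c => S [x e]; exists x; subst S; congr exist; exact: Prop_irrelevance.
Qed.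

Theorem corollary10p19 (k : fieldType) (C : kmoncat k) :
  [/\ Equivalence (@stmodcat_equiv k C),
      Equivalence (@smonoid_morita k C),
      forall M : stmodcat C, exists X : M, cyclic_generator X
    & exists f : Quot (@stmodcat_equiv k C) -> Quot (@smonoid_morita k C),
        bijective f /\
        forall (M : stmodcat C) (X : M), cyclic_generator X ->
          exists A : smonoid C,
            smon A = end_monoid X /\
            f (cls (@stmodcat_equiv k C) M) = cls (@smonoid_morita k C) A].
Proof.
have eM := stmodcat_equivalence C; have eA := smonoid_equivalence C.
split=> //; first exact: stmodcat_generator.
pose gn (M : stmodcat C) : M := projT1 (cid (stmodcat_generator M)).
have gnP (M : stmodcat C) : gen (gn M).
  by apply: cyclic_gen; exact: (projT2 (cid (stmodcat_generator M))).
pose mon (M : stmodcat C) (X : M) (gX : gen X) : smonoid C :=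
  SMonoid (end_simple gX (@stm_simple _ _ M)).
pose rep (c : Quot (@stmodcat_equiv k C)) : stmodcat C := projT1 (cid (Quot_surj c)).
have repP c : c = cls _ (rep c) := projT2 (cid (Quot_surj c)).
pose f c : Quot (@smonoid_morita k C) := cls _ (mon _ _ (gnP (rep c))).
have fE (M : stmodcat C) (X : M) (gX : gen X) : f (cls _ M) = cls _ (mon M X gX).
  apply/(Quot_eq eA); apply: modcat_equiv_morita => //.
  by apply/(Quot_eq eM); rewrite -repP.
exists f; split; last first.
  move=> M X /cyclic_gen gX; exists (mon M X gX); split=> //; exact: fE.
have f_inj c c' : f c = f c' -> c = c'.
  rewrite [c]repP [c']repP (fE _ _ (gnP _)) (fE _ _ (gnP _)) => /(Quot_eq eA) e.
  apply/(Quot_eq eM); exact: (morita_modcat_equiv (stm_cauchy _) (stm_cauchy _) (gnP _) (gnP _) e).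
have f_sur d : exists c, f c = d.
  have [A ->] := Quot_surj d.
  have [N [X [ccN gX [a]]]] := monoid_realized A.
  pose S := StModCat ccN (simple_end gX (miso_simple a (@smon_simple _ _ A))).
  exists (cls _ S); rewrite (fE S X gX); apply/(Quot_eq eA).
  exact: (generators_morita (miso_refl _) a gX gX).
exists (fun d => projT1 (cid (f_sur d))) => [c|d].
  exact: f_inj (projT2 (cid (f_sur (f c)))).
exact: (projT2 (cid (f_sur d))).
Qed.
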